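(* Let $(\mathbf W(\omega))_\omega\subseteq\mathscr C^\alpha(\mathbb R,\mathbb R^M)$ be a rough path cocycle over a metric dynamical system $(\Omega,\mathcal F,P,(\theta_t)_{t\in\mathbb R})$. Let $G_0\in C^\infty(\mathbb R^D,\mathbb R^D)\cap C^3_{\mathrm b}(\mathbb R^D,\mathbb R^D)$ and $G\in C^\infty(\mathbb R^D,\mathscr L(\mathbb R^M,\mathbb R^D))\cap C^3_{\mathrm b}(\mathbb R^D,\mathscr L(\mathbb R^M,\mathbb R^D))$ be such that (i) $G_0$ is Lipschitz and linearly growing, and (ii) the derivative of $\mathrm DG(\cdot)G(\cdot)$ is bounded. Then the RDE $\mathrm dY_t=G_0(Y_t)\,\mathrm dt+G(Y_t)\,\mathrm d\mathbf W_t(\omega)$ with $Y_0=y_0\in\mathbb R^D$ generates a cocycle $\phi:\mathbb R\times\Omega\times\mathbb R^D\to\mathbb R^D$ on the entire time axis $\mathbb R$.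
   Context: Fix $\alpha\in(1/3,1/2]$; $X_{s,t}:=X_t-X_s$. For compact $I$, $\mathscr C^\alpha(I,\mathbb V)$ is the set of pairs $\mathbf W=(W,\mathbb W)$, $W:I\to\mathbb V$, $\mathbb W:I^2\to\mathbb V\otimes\mathbb V$, with $\sup_{s<t}|W_{s,t}|/(t-s)^\alpha<\infty$, $\sup_{s<t}|\mathbb W_{s,t}|/(t-s)^{2\alpha}<\infty$ and $W_{s,u}\otimes W_{u,t}=\mathbb W_{s,t}-\mathbb W_{s,u}-\mathbb W_{u,t}$ for $s<u<t$. $\mathscr C^\alpha(\mathbb R,\mathbb V)$: pairs whose restrictions to all compact intervals containing $0$ belong to $\mathscr C^\alpha(I,\mathbb V)$. A controlled rough path $(Y,Y')\in\mathscr D^{2\alpha}_{\mathbf W}(I,\mathbb V_2)$ consists of $\alpha$-Hölder $Y$ and $Y'$ (values in $\mathbb V_2$, $\mathscr L(\mathbb V_1,\mathbb V_2)$) with $\sup_{s<t}|Y_{s,t}-Y'_sW_{s,t}|/(t-s)^{2\alpha}<\infty$; $\int_s^tY\,\mathrm d\mathbf W=\lim_{|\mathrm P|\to0}\sum_{[u,v]\in\mathrm P}Y_uW_{u,v}+Y'_u\mathbb W_{u,v}$ with $Y'_u(v\otimes w)=(Y'_uv)w$. The RDE means $Y_t=y_0+\int_0^tG_0(Y_s)\mathrm ds+\int_0^tG(Y_s)\mathrm d\mathbf W_s(\omega)$ for $t\ge0$, with $Y'=G(Y)$ and $G(Y)$ controlled with derivative $\mathrm DG(Y)Y'$. $C^k_{\mathrm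 b}$: $C^k$ maps with bounded derivatives. A metric dynamical system is a probability space with a measurable flow $(t,\omega)\mapsto\theta_t\omega$ of $P$-preserving maps, $\theta_0=\mathrm{id}$, $\theta_{t+s}=\theta_t\theta_s$. A cocycle (random dynamical system) with time $\mathbb R$ is a measurable $\phi:\mathbb R\times\Omega\times\mathbb R^D\to\mathbb R^D$ with $\phi(0,\omega,\cdot)=\mathrm{id}$, $\phi(t+s,\omega,x)=\phi(t,\theta_s\omega,\phi(s,\omega,x))$ for all $x,\omega,s,t$, and $\phi(\cdot,\omega,\cdot)$ continuous for all $\omega$. A rough path cocycle satisfies $\mathbf W_{t_1+s,t_2+s}(\omega)=\mathbf W_{t_1,t_2}(\theta_s\omega)$ for all $\omega$ and $s,t_1,t_2\in\mathbb R$, $t_1<t_2$. ''The RDE generates a cocycle on $\mathbb R$'' means: its solution flow $\phi(t,\omega,y_0)$, $t\ge0$, extended to negative times by $\phi(t,\omega,\cdot):=\phi(-t,\theta_t\omega,\cdot)^{-1}$, $t<0$, is such a cocycle.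
   Formalization: The increments of the rough path cocycle, W_{s,t}(ω) and its second-order part for s<t, are additionally assumed measurable in ω; without this the flow φ need not be measurable, hence need not be a cocycle (take θ_t=id, W_t(ω)=t f(ω) with f non-measurable, G=1, G_0=0). *)

(* Defs.v *)
From HB Require Import structures.
From mathcomp Require Import all_boot all_order all_algebra.
From mathcomp Require Import all_classical all_reals all_analysis.

Set Implicit Arguments.
Unset Strict Implicit.
Unset Printing Implicit Defensive.

Import Order.TTheory GRing.Theory Num.Theory.
Import numFieldNormedType.Exports.

Local Open Scope classical_set_scope.
Local Open Scope ring_scope.

(* Conventions.  R^n is 'cV[R]_n, with the sup norm of the library (all norms
   being equivalent, no notion below depends on this choice); L(R^m, R^n) is
   'M[R]_(n, m) acting by A *m v; the space of linear maps from R^m to a general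
   normed space V is {linear 'cV[R]_m -> V}, estimated in operator norm;
   R^m (x) R^m is 'M[R]_m, with v (x) w = v *m w^T. *)

Section RoughPaths.
Context {R : realType} {M : nat}.
Implicit Types (a b s t al : R) (W : R -> 'cV[R]_M) (WW : R -> R -> 'M[R]_M).

Definition tensor (v w : 'cV[R]_M) : 'M[R]_M := v *m w^T.

Definition hoelder {V : normedModType R} a b al (f : R -> V) : Prop :=
  exists C : R, forall s t, a <= s -> s < t -> t <= b ->
    `|f t - f s| <= C * (t - s) `^ al.

Definition rough_path_on a b al W WW : Prop :=
  [/\ hoelder a b al W,
      exists C : R, forall s t, a <= s -> s < t -> t <= b ->
        `|WW s t| <= C * (t - s) `^ (2 * al)
    & forall s u t, a <= s -> s < u -> u < t -> t <= b ->
        tensor (W u - W s) (W t - W u) = WW s t - WW s u - WW u t].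

Definition rough_path al W WW : Prop :=
  forall a b, a <= 0 -> 0 <= b -> rough_path_on a b al W WW.

Definition controlled {V : normedModType R} a b al W
    (Y : R -> V) (Y' : R -> {linear 'cV[R]_M -> V}) : Prop :=
  [/\ hoelder a b al Y,
      exists C : R, forall s t v, a <= s -> s < t -> t <= b ->
        `|Y' t v - Y' s v| <= C * (t - s) `^ al * `|v|
    & exists C : R, forall s t, a <= s -> s < t -> t <= b ->
        `|Y t - Y s - Y' s (W t - W s)| <= C * (t - s) `^ (2 * al)].

(* [P] encodes the partition s = x_0 < x_1 < ... < x_n = t as [:: x_1; ...; x_n],
   as in [itv_partition]; [steps s P] lists the pairs (x_i, x_i+1). *)
Definition steps s (P : seq R) : seq (R * R) := zip (s :: P) P.

Definition mesh s (P : seq R) : R :=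
  \big[Order.max/0]_(x <- steps s P) (x.2 - x.1).

Definition mesh_filter s t : set_system (seq R) :=
  filter_from [set e : R | 0 < e]
    (fun e => [set P | itv_partition s t P /\ mesh s P < e]).

Context {D : nat}.

(* The action of L : R^M -> L(R^M, R^D) on R^M (x) R^M, i.e. the linear extension
   of v (x) w |-> (L v) w; see [tensor_applyE]. *)
Definition tensor_apply (L : {linear 'cV[R]_M -> 'M[R]_(D, M)})
    (A : 'M[R]_M) : 'cV[R]_D :=
  \sum_(i < M) \sum_(j < M) A i j *: (L (delta_mx i 0) *m delta_mx j 0).

Lemma tensor_applyE (L : {linear 'cV[R]_M -> 'M[R]_(D, M)}) (v w : 'cV[R]_M) :
  tensor_apply L (tensor v w) = L v *m w.
Proof.
rewrite /tensor_apply /tensor.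
have decomp (u : 'cV[R]_M) : u = \sum_(i < M) u i 0 *: delta_mx i 0.
  by rewrite {1}(matrix_sum_delta u); apply: eq_bigr => i _; rewrite big_ord1.
rewrite [in RHS](decomp v) linear_sum mulmx_suml; apply: eq_bigr => i _.
rewrite [in RHS](decomp w) mulmx_sumr; apply: eq_bigr => j _.
have -> : L (v i 0 *: delta_mx i 0) = v i 0 *: L (delta_mx i 0) by rewrite linearZ.
by rewrite -scalemxAl -scalemxAr scalerA !mxE big_ord1 !mxE.
Qed.

Definition rough_sum W WW (Y : R -> 'M[R]_(D, M))
    (Y' : R -> {linear 'cV[R]_M -> 'M[R]_(D, M)}) s (P : seq R) : 'cV[R]_D :=
  \sum_(x <- steps s P)
    (Y x.1 *m (W x.2 - W x.1) + tensor_apply (Y' x.1) (WW x.1 x.2)).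

Definition is_rough_integral W WW (Y : R -> 'M[R]_(D, M))
    (Y' : R -> {linear 'cV[R]_M -> 'M[R]_(D, M)}) s t (I : 'cV[R]_D) : Prop :=
  rough_sum W WW Y Y' s P @[P --> mesh_filter s t] --> I.

Definition cV_integral s t (f : R -> 'cV[R]_D) : 'cV[R]_D :=
  \col_i (\int[lebesgue_measure]_(r in `[s, t]) f r i 0).

Definition rde_solution al W WW (G0 : 'cV[R]_D -> 'cV[R]_D)
    (G : 'cV[R]_D -> 'M[R]_(D, M)) (y0 : 'cV[R]_D) (Y : R -> 'cV[R]_D) : Prop :=
  let Y' s : {linear 'cV[R]_M -> 'cV[R]_D} := mulmx (G (Y s)) in
  let GY s := G (Y s) in
  let GY' s : {linear 'cV[R]_M -> 'M[R]_(D, M)} := 'd G (Y s) \o Y' s in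
  [/\ forall T, 0 < T -> controlled 0 T al W Y Y',
      forall T, 0 < T -> controlled 0 T al W GY GY'
    & forall t, 0 <= t -> exists2 I : 'cV[R]_D,
        is_rough_integral W WW GY GY' 0 t I
        & Y t = y0 + cV_integral 0 t (fun s => G0 (Y s)) + I].

End RoughPaths.

Section SmoothMaps.
Context {R : realType} {D : nat} {V : normedModType R}.
Implicit Types (f : 'cV[R]_D -> V) (vs : seq 'cV[R]_D).

(* [iterD f [:: v_1; ...; v_k] x] is D^k f(x)(v_1, ..., v_k). *)
Fixpoint iterD f vs : 'cV[R]_D -> V :=
  if vs is v :: vs' then fun x => 'd (iterD f vs') x v else f.

(* Since R^D is finite dimensional, D^j f is differentiable (continuous) as soon
   as all the x |-> D^j f(x)(v_1, ..., v_j) are. *)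
Definition C_ (k : nat) f : Prop :=
  (forall vs, (size vs < k)%N -> forall x, differentiable (iterD f vs) x) /\
  (forall vs, (size vs <= k)%N -> continuous (iterD f vs)).

Definition C_infty f : Prop := forall k, C_ k f.

(* The derivatives of orders 1, ..., k are bounded in operator norm; f itself is
   not required to be bounded. *)
Definition C_b (k : nat) f : Prop :=
  C_ k f /\
  forall j, (1 <= j <= k)%N ->
    exists C : R, forall vs x, size vs = j ->
      `|iterD f vs x| <= C * \prod_(v <- vs) `|v|.

Definition linear_growth f : Prop :=
  exists C : R, forall x, `|f x| <= C * (1 + `|x|).

End SmoothMaps.

(* y |-> DG(y)G(y), with values in L(R^M, L(R^M, R^D)), has a bounded derivative. *)
Definition DGG_bounded_derivative {R : realType} {D M : nat}
    (G : 'cV[R]_D -> 'M[R]_(D, M)) : Prop :=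
  exists C : R, forall (y h : 'cV[R]_D) (v : 'cV[R]_M),
    `|'d (fun z : 'cV[R]_D => 'd G z (G z *m v)) y h| <= C * `|h| * `|v|.

(* 'M[R]_(m, n) with its Borel sigma-algebra. *)
Definition borel_mx (R : realType) (m n : nat) :=
  g_sigma_algebraType (@open 'M[R]_(m, n)).

Section Cocycles.
Context {R : realType} {d : measure_display} {Omega : measurableType d}.
Implicit Types (theta : R -> Omega -> Omega).

Definition metric_dynamical_system (P : probability Omega R) theta : Prop :=
  [/\ measurable_fun [set: measurableTypeR R * Omega]
        (fun p => theta p.1 p.2),
      forall t (A : set Omega), measurable A -> P (theta t @^-1` A) = P A,
      forall omega, theta 0 omega = omega
    & forall t s omega, theta (t + s) omega = theta t (theta s omega)].

(* Only the increments (W_{s,t}, WW_{s,t}) with s < t are required to be random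
   variables and to be stationary under theta. *)
Definition rough_path_cocycle {M : nat} (al : R) theta
    (W : Omega -> R -> 'cV[R]_M) (WW : Omega -> R -> R -> 'M[R]_M) : Prop :=
  [/\ forall omega, rough_path al (W omega) (WW omega),
      forall s t, s < t ->
        measurable_fun [set: Omega]
          (fun omega => W omega t - W omega s : borel_mx R M 1) /\
        measurable_fun [set: Omega] (fun omega => WW omega s t : borel_mx R M M)
    & forall omega s t1 t2, t1 < t2 ->
        W omega (t2 + s) - W omega (t1 + s)
          = W (theta s omega) t2 - W (theta s omega) t1 /\
        WW omega (t1 + s) (t2 + s) = WW (theta s omega) t1 t2].

Definition cocycle {D : nat} theta
    (phi : R -> Omega -> 'cV[R]_D -> 'cV[R]_D) : Prop :=
  [/\ measurable_fun [set: measurableTypeR R * Omega * borel_mx R D 1]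
        (fun p => phi p.1.1 p.1.2 p.2 : borel_mx R D 1),
      forall omega x, phi 0 omega x = x,
      forall t s omega x,
        phi (t + s) omega x = phi t (theta s omega) (phi s omega x)
    & forall omega, continuous (fun p : R * 'cV[R]_D => phi p.1 omega p.2)].

(* [phi] is the solution flow for t >= 0 (existence and uniqueness), extended to
   t < 0 by inversion. *)
Definition extended_solution_flow {D M : nat} (al : R) theta
    (W : Omega -> R -> 'cV[R]_M) (WW : Omega -> R -> R -> 'M[R]_M)
    (G0 : 'cV[R]_D -> 'cV[R]_D) (G : 'cV[R]_D -> 'M[R]_(D, M))
    (phi : R -> Omega -> 'cV[R]_D -> 'cV[R]_D) : Prop :=
  [/\ forall omega y0,
        rde_solution al (W omega) (WW omega) G0 G y0 (fun t => phi t omega y0),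
      forall omega y0 Y, rde_solution al (W omega) (WW omega) G0 G y0 Y ->
        forall t, 0 <= t -> Y t = phi t omega y0
    & forall omega t, t < 0 ->
        cancel (phi (- t) (theta t omega)) (phi t omega) /\
        cancel (phi t omega) (phi (- t) (theta t omega))].

End Cocycles.

(* Main.v *)
(* Davie's approach to rough differential equations, in the form of a nonlinear
   sewing lemma.  The Taylor step
     mu_{s,t}(x) = x + G(x) W_{s,t} + (t - s) G_0(x) + DG(x)G(x) WW_{s,t}
   makes sense for all s, t in R once WW is extended to s > t by Chen's relation,
   and it is an almost flow: mu_{u,t} o mu_{s,u} - mu_{s,t} is of order
   (1 + |x|) |t - s|^{3 alpha}, and locally Lipschitz in x with the same rate.
   Since 3 alpha > 1 and mu_{s,t} moves x by at most C (1 + |x|) |t - s|^alpha, the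
   compositions of mu along uniform partitions stay bounded and converge to a flow
   phi_{s,t} with phi_{t,s} = phi_{s,t}^{-1}.  The linear growth in |x| of the defect
   is where the boundedness of the derivative of DG G enters: G need not be bounded.

   A path solves the equation iff its increments agree with mu up to
   O(|t - s|^{3 alpha}), by sewing for the rough integral, and such paths are
   exactly the orbits of phi.  As mu depends on W only through its increments,
   stationarity turns the flow into a cocycle.  For fixed (t, x) the flow is a
   limit of compositions of measurable maps; it is jointly continuous in (t, x),
   hence jointly measurable. *)

Require Import Defs.
From HB Require Import structures.
From mathcomp Require Import all_boot all_order all_algebra.
From mathcomp Require Import all_classical all_reals all_analysis.
From mathcomp Require Import measurable_realfun.
From mathcomp Require Import ring lra zify.
Import Order.TTheory GRing.Theory Num.Theory.
Import numFieldNormedType.Exports.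
Local Open Scope classical_set_scope.
Local Open Scope ring_scope.

Set Implicit Arguments.
Unset Strict Implicit.
Unset Printing Implicit Defensive.

(* [zmod] proves identities between sums of signed atoms in an abelian group:
   negative atoms move left, then positive ones, cancelling when they meet. *)
Ltac zmod :=
  apply/eqP; rewrite -subr_eq0 -[eqbLHS]add0r ?(opprD, opprK, addrA);
  repeat first
  [ rewrite addrK | rewrite subrK
  | match goal with
    | |- context [@Algebra.add _ (@Algebra.add _ ?x ?b) (@Algebra.opp _ ?a)] =>
      lazymatch b with
      | @Algebra.opp _ _ => fail
      | _ => rewrite (addrAC x b (- a))
      end
    end ];
  repeat first
  [ rewrite addrK | rewrite subrK
  | match goal with
    | |- context [@Algebra.add _ (@Algebra.add _ ?x (@Algebra.opp _ ?b)) ?a] =>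
      lazymatch a with
      | @Algebra.opp _ _ => fail
      | _ => rewrite (addrAC x (- b) a)
      end
    end ]; by rewrite eqxx.

Lemma le_of_eq {R : realType} (x y : R) : x = y -> x <= y.
Proof. by move=> ->. Qed.

(** * Nonlinear sewing *)

Section PowerBounds.
Context {R : realType}.
Implicit Types x y p q c e ga : R.

Lemma powR_succ x ga : 0 <= x -> 0 < ga -> x `^ ga = x * x `^ (ga - 1).
Proof.
move=> x0 ga0; have e1 : 1 + (ga - 1) = ga by ring.
rewrite -{2}(powRr1 x0) -powRD; last first.
  by rewrite e1 (gt_eqF ga0).
by rewrite e1.
Qed.

Lemma le_powR x y p : 0 <= p -> 0 <= x -> x <= y -> x `^ p <= y `^ p.
Proof.
move=> p0 x0 xy; apply: ge0_ler_powR => //; rewrite nnegrE //.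
exact: le_trans xy.
Qed.

Lemma powR_small c p e : 0 <= c -> 0 < p -> 0 < e ->
  exists2 d, 0 < d & forall x, 0 <= x -> x <= d -> c * x `^ p <= e.
Proof.
move=> c0 p0 e0; have c1 : 0 < c + 1 by lra.
exists ((e / (c + 1)) `^ p^-1); first by apply: powR_gt0; rewrite divr_gt0.
move=> x x0 xd; have : x `^ p <= e / (c + 1).
  have := le_powR (ltW p0) x0 xd; rewrite -powRrM mulVf ?gt_eqF //.
  by rewrite powRr1 // divr_ge0 ?ltW.
rewrite ler_pdivlMr // => H; apply: le_trans H.
by rewrite mulrC ler_wpM2l ?powR_ge0 // lerDl.
Qed.

Lemma powR_le_bound x y p q : 0 <= x -> x <= y -> 0 <= q -> q <= p ->
  0 < x -> x `^ p <= y `^ (p - q) * x `^ q.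
Proof.
move=> x0 xy q0 qp xpos; rewrite -{1}[p](subrK q) (@powRD _ x); last first.
  by rewrite (gt_eqF xpos) implybT.
by rewrite ler_wpM2r ?powR_ge0 // le_powR // subr_ge0.
Qed.

(* [(2/3)^(ga-1) < 1] is the gain of cutting [k >= 2] steps into two halves. *)
Lemma halves_powR ga (k : nat) : 1 < ga -> (2 <= k)%N ->
  k./2%:R `^ ga + (k - k./2)%:R `^ ga <= (2 / 3) `^ (ga - 1) * k%:R `^ ga.
Proof.
move=> ga1 k2; have ga0 : 0 < ga by lra.
have ha : (3 * k./2 <= 2 * k)%N.
  by have := odd_double_half k; rewrite -mul2n; lia.
have hb : (3 * (k - k./2) <= 2 * k)%N.
  by have := odd_double_half k; rewrite -mul2n; case: (odd k) => /=; lia.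
have key (j : nat) : (3 * j <= 2 * k)%N ->
    j%:R `^ ga <= j%:R * ((2 / 3) `^ (ga - 1) * k%:R `^ (ga - 1)) :> R.
  move=> hj; rewrite powR_succ // ler_wpM2l // -powRM ?ler0n ?divr_ge0 //.
  apply: le_powR => //; first lra.
  by move: hj; rewrite -(ler_nat R) !natrM; lra.
apply: le_trans (lerD (key _ ha) (key _ hb)) _.
rewrite -mulrDl -natrD subnKC; last by lia.
by rewrite [k%:R `^ ga]powR_succ //; lra.
Qed.

Lemma two_thirds_powR ga : 1 < ga -> 0 <= (2 / 3 : R) `^ (ga - 1) < 1.
Proof.
move=> ga1; rewrite powR_ge0 /=.
have : (2 / 3) `^ (ga - 1) < 1 `^ (ga - 1) :> R.
  by apply: gt0_ltr_powR; rewrite ?nnegrE; lra.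
by rewrite powR1.
Qed.

End PowerBounds.

Lemma halves_lt (k : nat) : (1 < k)%N -> (k./2 < k)%N && (k - k./2 < k)%N.
Proof. by have := odd_double_half k; rewrite -mul2n; lia. Qed.

Lemma halving_close {R : realType} (K e th C X PJ PL PK : R) :
  0 <= th -> th < 1 -> e = (1 - th) / 2 -> K * (1 - th) = 2 * C ->
  0 <= K -> 0 <= X -> 0 <= PK -> PJ + PL <= th * PK ->
  (1 + e) * (K * X * PL) + (1 + e) * (K * X * PJ) + C * X * PK <= K * X * PK.
Proof.
move=> th0 th1 eE KE K0 X0 P0 hP; have e0 : 0 <= 1 + e by lra.
have : (1 + e) * (K * X) * (PJ + PL) <= (1 + e) * (K * X) * (th * PK).
  by rewrite ler_wpM2l // mulr_ge0 // mulr_ge0.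
have the : th * (1 + e) <= (1 + th) / 2 by rewrite eE; nra.
have : (K * X * PK) * (th * (1 + e)) <= (K * X * PK) * ((1 + th) / 2).
  by rewrite ler_wpM2l // !mulr_ge0.
have : X * PK * (K * (1 - th)) = X * PK * (2 * C) by rewrite KE.
by lra.
Qed.

Lemma chain_doubling {R : realType} (f : nat -> R) (d h : R) (n m k : nat) :
  0 < d -> 0 <= h -> h <= d / 2 -> (forall j, 0 <= f j) ->
  (forall j i, (j + i <= n)%N -> i%:R * h <= d -> f (j + i)%N <= 2 * f j) ->
  (k <= n)%N -> k%:R * h <= m%:R * (d / 2) -> f k <= 2 ^+ m.+1 * f 0%N.
Proof.
move=> d0 h0 hd f0 fdbl; elim: m k => [|m ih] k kn km.
  by rewrite expr1; apply: (fdbl 0%N) => //; rewrite mul0r in km; lra.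
have [kd|kd] := leP (k%:R * h) d.
  apply: le_trans (fdbl 0%N k kn kd) _; rewrite ler_wpM2r //.
  by rewrite exprS ler_peMr // exprn_ege1 // ler1n.
have hpos : 0 < h.
  by rewrite lt_neqAle h0 andbT; apply/negP => /eqP he; rewrite -he mulr0 in kd; lra.
pose i := Num.truncn (d / h).
have /andP[i1 i2] : i%:R <= d / h < i.+1%:R by apply: truncn_itv; rewrite divr_ge0 ?ltW.
have {}i1 : i%:R * h <= d by rewrite -ler_pdivlMr.
have {}i2 : d <= (i%:R + 1) * h by rewrite natr1 -ler_pdivrMr // ltW.
have ik : (i <= k)%N.
  by rewrite -(ler_nat R) -(ler_pM2r hpos); lra.
have -> : k = (k - i + i)%N by rewrite subnK.
apply: le_trans (fdbl _ _ _ i1) _; first by rewrite subnK.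
have : f (k - i)%N <= 2 ^+ m.+1 * f 0%N.
  apply: ih; first by rewrite (leq_trans _ kn) // leq_subr.
  rewrite natrB // mulrBl; move: km; rewrite -natr1; lra.
by rewrite [2 ^+ m.+2]exprS; lra.
Qed.

Section Scheme.
Context {R : realType} {V : normedModType R} (mu : R -> R -> V -> V).

Fixpoint scheme (s h : R) (k : nat) (x : V) : V :=
  if k is k'.+1
  then mu (s + k'%:R * h) (s + k'.+1%:R * h) (scheme s h k' x) else x.

Lemma scheme_add s h j k x :
  scheme s h (j + k) x = scheme (s + j%:R * h) h k (scheme s h j x).
Proof.
elim: k => [|k ih]; first by rewrite addn0.
rewrite addnS /= ih; congr (mu _ _ _).
- by rewrite natrD; ring.
- by rewrite -addnS natrD; ring.
Qed.

(* Consecutive one-step errors are transported to the end of the grid by the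
   Lipschitz bound [L] on the remaining composition. *)
Lemma scheme_telescope s h N (z : nat -> V) (L e : R) :
  (forall j, (j < N)%N ->
    `|scheme (s + j.+1%:R * h) h (N - j.+1) (z j.+1)
      - scheme (s + j.+1%:R * h) h (N - j.+1)
          (mu (s + j%:R * h) (s + j.+1%:R * h) (z j))| <= L * e) ->
  `|z N - scheme s h N (z 0%N)| <= N%:R * (L * e).
Proof.
move=> step; pose w j := scheme (s + j%:R * h) h (N - j) (z j).
have wN : w N = z N by rewrite /w subnn.
have w0 : w 0%N = scheme s h N (z 0%N) by rewrite /w subn0 mul0r addr0.
rewrite -wN -w0.
suff H j : (j <= N)%N -> `|w j - w 0%N| <= j%:R * (L * e) by exact: H.
elim: j => [|j ih] jN; first by rewrite subrr normr0 mul0r.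
apply: le_trans (ler_distD (w j) _ _) _.
rewrite -natr1 mulrDl mul1r addrC lerD //; first exact/ih/ltnW.
rewrite /w -(subnSK jN) -[(N - j.+1).+1]add1n scheme_add /=.
rewrite mul0r addr0 mul1r (_ : s + j%:R * h + h = s + j.+1%:R * h); last first.
  by rewrite -natr1; ring.
exact: step.
Qed.

End Scheme.

Lemma grid_between {R : realType} (a b s h : R) (j k : nat) : (j <= k)%N ->
  a <= s <= b -> a <= s + k%:R * h <= b -> a <= s + j%:R * h <= b.
Proof.
move=> jk /andP[as_ sb] /andP[ak kb].
have j0 : 0 <= j%:R :> R by [].
have : j%:R <= k%:R :> R by rewrite ler_nat.
by case: (leP 0 h) => h0 jk'; apply/andP; split; nra.
Qed.

Lemma grid_ordered {R : realType} (s h : R) (j k : nat) : (j <= k)%N ->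
  (s <= s + j%:R * h <= s + k%:R * h) || (s + k%:R * h <= s + j%:R * h <= s).
Proof.
move=> jk; have j0 : 0 <= j%:R :> R by [].
have : j%:R <= k%:R :> R by rewrite ler_nat.
case: (leP 0 h) => h0 jk'; apply/orP; [left|right]; apply/andP; split; nra.
Qed.

Record sewable {R : realType} {V : normedModType R} (a b al ga C : R)
    (mu : R -> R -> V -> V) : Prop := Sewable {
  sew_al : 0 < al;
  sew_ga : 1 < ga;
  sew_C : 0 <= C;
  sew_close : forall s t x, a <= s <= b -> a <= t <= b ->
    `|mu s t x - x| <= C * (1 + `|x|) * `|t - s| `^ al;
  sew_lip : forall s t x y, a <= s <= b -> a <= t <= b ->
    `|mu s t x - mu s t y - (x - y)| <= C * `|t - s| `^ al * `|x - y|;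
  sew_defect : forall s u t x,
    a <= s <= b -> a <= u <= b -> a <= t <= b ->
    (s <= u <= t) || (t <= u <= s) ->
    `|mu u t (mu s u x) - mu s t x| <= C * (1 + `|x|) * `|t - s| `^ ga }.

Lemma sewable_id {R : realType} {V : normedModType R} (a b al ga C : R)
    (mu : R -> R -> V -> V) s x :
  sewable a b al ga C mu -> a <= s <= b -> mu s s x = x.
Proof.
case=> al0 _ _ mu_close _ _ hs; apply/eqP; rewrite -subr_eq0 -normr_le0.
by apply: le_trans (mu_close _ _ x hs hs) _; rewrite subrr normr0 powR0 ?mulr0 ?gt_eqF.
Qed.

Lemma scheme_estimate {R : realType} {V : normedModType R} (a b al ga C : R)
    (mu : R -> R -> V -> V) : sewable a b al ga C mu ->
  exists K d : R, [/\ 0 <= K, 0 < d,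
    C * d `^ al + K * d `^ ga <= 1
  & forall s h k x, a <= s <= b -> a <= s + k%:R * h <= b -> k%:R * `|h| <= d ->
    `|scheme mu s h k x - mu s (s + k%:R * h) x|
      <= K * (1 + `|x|) * (k%:R * `|h|) `^ ga].
Proof.
move=> hmu; have [al0 ga1 C0 mu_close mu_lip mu_defect] := hmu.
have ga0 : 0 < ga by lra.
have /andP[th0 th1] := two_thirds_powR ga1.
set th := (2 / 3) `^ (ga - 1) in th0 th1.
pose K := 2 * C / (1 - th); have K0 : 0 <= K by rewrite divr_ge0; lra.
have KE : K * (1 - th) = 2 * C by rewrite mulfVK //; lra.
pose e := (1 - th) / 2.
have e0 : 0 < e / 2 by rewrite /e; lra.
have [d1 d10 hd1] := powR_small C0 al0 e0.
have [d2 d20 hd2] := powR_small K0 ga0 e0.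
pose d : R := Num.min d1 d2.
have d0 : 0 < d by rewrite lt_min d10.
have dd1 : d <= d1 by rewrite ge_min lexx.
have dd2 : d <= d2 by rewrite ge_min lexx orbT.
exists K, d; split => //.
  have := hd1 _ (ltW d0) dd1; have := hd2 _ (ltW d0) dd2; rewrite /e; lra.
move=> s h k; elim/ltn_ind: k s => k ih s x hs ht kd.
have [k2|] := ltnP 1 k; last first.
  case: k ih ht kd => [|[|//]] ih ht kd _ /=.
    by rewrite !mul0r addr0 (sewable_id _ hmu) // subrr normr0 powR0 ?mulr0 ?gt_eqF.
  rewrite mul0r addr0 mul1r mul1r subrr normr0.
  by rewrite mulr_ge0 ?powR_ge0 // mulr_ge0 // addr_ge0.
have hn : 0 <= `|h| by [].
pose j := k./2; pose l := (k - j)%N.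
have /andP[jk lk] : (j < k)%N && (l < k)%N by exact: halves_lt.
have kE : k = (j + l)%N by rewrite subnKC // ltnW.
have tE : s + k%:R * h = s + j%:R * h + l%:R * h by rewrite {1}kE natrD; ring.
have hu : a <= s + j%:R * h <= b by apply: grid_between ht => //; exact: ltnW.
have jkR : j%:R <= k%:R :> R by rewrite ler_nat ltnW.
have lkR : l%:R <= k%:R :> R by rewrite ler_nat ltnW.
have jd : j%:R * `|h| <= d by apply: le_trans kd; rewrite ler_wpM2r.
have ld : l%:R * `|h| <= d by apply: le_trans kd; rewrite ler_wpM2r.
have Hj := ih j jk s x hs hu jd.
rewrite kE scheme_add -kE tE.
set u := s + j%:R * h in hu Hj *.
set y := scheme mu s h j x in Hj *.
have ht' : a <= u + l%:R * h <= b by rewrite -tE.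
have Hl := ih l lk u y hu ht' ld.
set t := u + l%:R * h in ht' Hl *.
have {}tE : t = s + k%:R * h by rewrite tE.
have ord : (s <= u <= t) || (t <= u <= s).
  by rewrite tE; apply: grid_ordered; exact: ltnW.
have Hd := mu_defect _ _ _ x hs hu ht' ord.
have Hlip := mu_lip _ _ y (mu s u x) hu ht'.
have Hc := mu_close _ _ x hs hu.
have us : `|u - s| = j%:R * `|h|.
  by rewrite /u addrAC subrr add0r normrM normr_nat.
have ts : `|t - s| = k%:R * `|h|.
  by rewrite tE addrAC subrr add0r normrM normr_nat.
have tu : `|t - u| = l%:R * `|h|.
  by rewrite /t addrAC subrr add0r normrM normr_nat.
rewrite us in Hc; rewrite ts in Hd; rewrite tu in Hlip.
have sum_le : (j%:R * `|h|) `^ ga + (l%:R * `|h|) `^ ga <= th * (k%:R * `|h|) `^ ga.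
  rewrite !powRM // -mulrDl mulrA ler_wpM2r ?powR_ge0 //.
  exact: halves_powR.
have small r : 0 <= r -> r <= d -> C * r `^ al <= e / 2 /\ K * r `^ ga <= e / 2.
  by move=> r0 rd; split; [apply: hd1|apply: hd2] => //; apply: le_trans rd _.
have [sj1 sj2] := small _ (mulr_ge0 (ler0n _ _) hn) jd.
have [sl1 _] := small _ (mulr_ge0 (ler0n _ _) hn) ld.
move: (powR_ge0 (j%:R * `|h|) ga) (powR_ge0 (l%:R * `|h|) ga)
  (powR_ge0 (k%:R * `|h|) ga) => p1 p2 p3.
move: sum_le sj1 sj2 sl1 Hj Hl Hd Hlip Hc p1 p2 p3.
set PJ := (j%:R * `|h|) `^ ga; set PL := (l%:R * `|h|) `^ ga.
set PK := (k%:R * `|h|) `^ ga; set QJ := _ `^ al; set QL := (l%:R * `|h|) `^ al.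
move=> sum_le sj1 sj2 sl1 Hj Hl Hd Hlip Hc p1 p2 p3.
set X := 1 + `|x| in Hj Hd Hc *.
have X1 : 1 <= X by rewrite /X lerDl.
have Y1 : 1 + `|y| <= X * (1 + e).
  have : `|y| <= `|x| + C * X * QJ + K * X * PJ.
    have -> : y = x + (mu s u x - x) + (y - mu s u x) by zmod.
    apply: le_trans (ler_normD _ _) _; rewrite lerD //.
    by apply: le_trans (ler_normD _ _) _; rewrite lerD.
  have X0 : 0 <= X := le_trans ler01 X1.
  have XE : X = 1 + `|x| by [].
  move: XE (ler_wpM2l X0 sj1) (ler_wpM2l X0 sj2); clear; lra.
have N1 : `|mu u t y - mu u t (mu s u x)| <= (1 + e) * (K * X * PJ).
  have -> : mu u t y - mu u t (mu s u x)
      = mu u t y - mu u t (mu s u x) - (y - mu s u x) + (y - mu s u x).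
    by rewrite subrK.
  apply: le_trans (ler_normD _ _) _.
  have le_e : (C * QL) * `|y - mu s u x| <= e * `|y - mu s u x|.
    by rewrite ler_wpM2r //; move: sl1 e0; clear; lra.
  have e1 : 0 <= 1 + e by move: e0; clear; lra.
  have := ler_wpM2l e1 Hj; move: le_e; clear -Hlip; lra.
have N2 : K * (1 + `|y|) * PL <= (1 + e) * (K * X * PL).
  have : (K * PL) * (1 + `|y|) <= (K * PL) * (X * (1 + e)).
    by rewrite ler_wpM2l // mulr_ge0.
  by clear; lra.
have -> : scheme mu u h l y - mu s t x = (scheme mu u h l y - mu u t y)
   + (mu u t y - mu u t (mu s u x)) + (mu u t (mu s u x) - mu s t x).
  by zmod.
apply: le_trans (ler_normD _ _) _.
apply: le_trans (lerD (ler_normD _ _) (lexx _)) _.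
have F := halving_close th0 th1 (erefl e) KE K0 (_ : 0 <= X) p3 sum_le.
move: F (le_trans ler01 X1) N1 N2 Hl Hd; clear; move=> F X0; move: (F X0); lra.
Qed.

Record sewable_loc {R : realType} {V : normedModType R} (a b al ga : R)
    (mu : R -> R -> V -> V) : Prop := SewableLoc {
  sew_defect_lip : forall r, exists2 Cr : R, 0 <= Cr &
    forall s u t x y, a <= s <= b -> a <= u <= b -> a <= t <= b ->
      (s <= u <= t) || (t <= u <= s) -> `|x| <= r -> `|y| <= r ->
      `|mu u t (mu s u x) - mu s t x - (mu u t (mu s u y) - mu s t y)|
        <= Cr * `|x - y| * `|t - s| `^ ga;
  sew_second : forall r, exists2 Cr : R, 0 <= Cr &
    forall s t x y e, a <= s <= b -> a <= t <= b ->
      `|x| <= r -> `|y| <= r -> `|x + e| <= r -> `|y + e| <= r ->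
      `|mu s t (x + e) - mu s t x - (mu s t (y + e) - mu s t y)|
        <= Cr * `|e| * `|x - y| * `|t - s| `^ al }.

Lemma scheme_estimate_lip {R : realType} {V : normedModType R} (a b al ga C : R)
    (mu : R -> R -> V -> V) r :
  sewable a b al ga C mu -> sewable_loc a b al ga mu -> 0 <= r ->
  exists K d : R, [/\ 0 <= K, 0 < d,
    C * d `^ al + K * d `^ ga <= 1
  & forall s h k x y, a <= s <= b -> a <= s + k%:R * h <= b -> k%:R * `|h| <= d ->
    (forall j, (j <= k)%N -> `|scheme mu s h j x| <= r) ->
    (forall j, (j <= k)%N -> `|scheme mu s h j y| <= r) ->
    `|scheme mu s h k x - scheme mu s h k y
      - (mu s (s + k%:R * h) x - mu s (s + k%:R * h) y)|
      <= K * `|x - y| * (k%:R * `|h|) `^ ga].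
Proof.
move=> hmu [mu_defect_lip mu_second] r0.
have [al0 ga1 C0 mu_close mu_lip mu_defect] := hmu.
have ga0 : 0 < ga by lra.
have [KA [dA [KA0 dA0 dAe HA]]] := scheme_estimate hmu.
have [C4 C40 H4] := mu_defect_lip r.
have [C5 C50 H5] := mu_second (2 * r + 1).
have /andP[th0 th1] := two_thirds_powR ga1.
set th := (2 / 3) `^ (ga - 1) in th0 th1.
pose C' := 2 * C5 * KA * (1 + r) + C4.
have C'0 : 0 <= C'.
  by rewrite addr_ge0 // mulr_ge0 ?addr_ge0 // mulr_ge0 // mulr_ge0.
pose K := 2 * C' / (1 - th); have K0 : 0 <= K by rewrite divr_ge0; lra.
have KE : K * (1 - th) = 2 * C' by rewrite mulfVK //; lra.
pose e : R := (1 - th) / 2.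
have e0 : 0 < e / 2 by rewrite /e; lra.
have [d1 d10 hd1] := powR_small C0 al0 e0.
have [d2 d20 hd2] := powR_small K0 ga0 e0.
pose d : R := Num.min (Num.min d1 d2) (Num.min dA 1).
have d0 : 0 < d by rewrite !lt_min d10 d20 dA0 ltr01.
have dd1 : d <= d1 by rewrite !ge_min lexx.
have dd2 : d <= d2 by rewrite !ge_min lexx orbT.
have ddA : d <= dA by rewrite !ge_min lexx !orbT.
have dd3 : d <= 1 by rewrite !ge_min lexx !orbT.
exists K, d; split => //.
  have := hd1 _ (ltW d0) dd1; have := hd2 _ (ltW d0) dd2; rewrite /e; lra.
move=> s h k; elim/ltn_ind: k s => k ih s x y hs ht kd gx gy.
have [k2|] := ltnP 1 k; last first.
  case: k {ih gx gy} ht kd => [|[|//]] ht kd _ /=.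
    by rewrite !mul0r addr0 !(sewable_id _ hmu) // subrr normr0 powR0 ?mulr0 ?gt_eqF.
  rewrite mul0r addr0 mul1r mul1r subrr normr0.
  by rewrite mulr_ge0 ?powR_ge0 // mulr_ge0.
have hn : 0 <= `|h| by [].
pose j := k./2; pose l := (k - j)%N.
have /andP[jk lk] : (j < k)%N && (l < k)%N by exact: halves_lt.
have kE : k = (j + l)%N by rewrite subnKC // ltnW.
have tE : s + k%:R * h = s + j%:R * h + l%:R * h by rewrite {1}kE natrD; ring.
have hu : a <= s + j%:R * h <= b by apply: grid_between ht => //; exact: ltnW.
have jkR : j%:R <= k%:R :> R by rewrite ler_nat ltnW.
have lkR : l%:R <= k%:R :> R by rewrite ler_nat ltnW.
have jd : j%:R * `|h| <= d by apply: le_trans kd; rewrite ler_wpM2r.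
have ld : l%:R * `|h| <= d by apply: le_trans kd; rewrite ler_wpM2r.
have le_jk i : (i <= j)%N -> (i <= k)%N by move=> ij; apply: leq_trans ij (ltnW jk).
have Hj := ih j jk s x y hs hu jd (fun i ij => gx i (le_jk i ij))
  (fun i ij => gy i (le_jk i ij)).
have HAx := HA s h j x hs hu (le_trans jd ddA).
have HAy := HA s h j y hs hu (le_trans jd ddA).
have gx' i : (i <= l)%N ->
    `|scheme mu (s + j%:R * h) h i (scheme mu s h j x)| <= r.
  by move=> il; rewrite -scheme_add; apply: gx; rewrite kE leq_add2l.
have gy' i : (i <= l)%N ->
    `|scheme mu (s + j%:R * h) h i (scheme mu s h j y)| <= r.
  by move=> il; rewrite -scheme_add; apply: gy; rewrite kE leq_add2l.
rewrite kE !scheme_add -kE tE.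
have rx : `|x| <= r := gx 0%N isT.
have ry : `|y| <= r := gy 0%N isT.
have rx' := gx j (ltnW jk).
set u := s + j%:R * h in hu Hj HAx HAy gx' gy' *.
set x' := scheme mu s h j x in Hj HAx gx' rx' *.
set y' := scheme mu s h j y in Hj HAy gy' *.
have ht' : a <= u + l%:R * h <= b by rewrite -tE.
have Hl := ih l lk u x' y' hu ht' ld gx' gy'.
set t := u + l%:R * h in ht' Hl *.
have {}tE : t = s + k%:R * h by rewrite tE.
have ord : (s <= u <= t) || (t <= u <= s).
  by rewrite tE; apply: grid_ordered; exact: ltnW.
have Hd := H4 s u t x y hs hu ht' ord rx ry.
set e1 := x' - mu s u x in HAx.
set e2 := y' - mu s u y in HAy.
have x'E : x' = mu s u x + e1 by rewrite addrC subrK.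
have y'E : y' = mu s u y + e2 by rewrite addrC subrK.
have Hlip := mu_lip _ _ (mu s u y + e1) (mu s u y + e2) hu ht'.
have Hlip0 := mu_lip _ _ x y hs hu.
have Hcx := mu_close _ _ x hs hu.
have Hcy := mu_close _ _ y hs hu.
have us : `|u - s| = j%:R * `|h|.
  by rewrite /u addrAC subrr add0r normrM normr_nat.
have ts : `|t - s| = k%:R * `|h|.
  by rewrite tE addrAC subrr add0r normrM normr_nat.
have tu : `|t - u| = l%:R * `|h|.
  by rewrite /t addrAC subrr add0r normrM normr_nat.
have H5' := H5 u t (mu s u x) (mu s u y) e1 hu ht'.
rewrite us in Hcx Hcy Hlip0; rewrite ts in Hd; rewrite tu in Hlip H5'.
have sum_le : (j%:R * `|h|) `^ ga + (l%:R * `|h|) `^ ga <= th * (k%:R * `|h|) `^ ga.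
  rewrite !powRM // -mulrDl mulrA ler_wpM2r ?powR_ge0 //.
  exact: halves_powR.
have small p : 0 <= p -> p <= d -> C * p `^ al <= e / 2 /\ K * p `^ ga <= e / 2.
  by move=> p0 pd; split; [apply: hd1|apply: hd2] => //; apply: le_trans pd _.
have jh0 : 0 <= j%:R * `|h| by rewrite mulr_ge0.
have lh0 : 0 <= l%:R * `|h| by rewrite mulr_ge0.
have [sj1 sj2] := small _ jh0 jd.
have [sl1 _] := small _ lh0 ld.
have ql1 : (l%:R * `|h|) `^ al <= 1.
  by have := le_powR (ltW al0) lh0 (le_trans ld dd3); rewrite powR1.
have pjk : (j%:R * `|h|) `^ ga <= (k%:R * `|h|) `^ ga.
  by apply: le_powR => //; [exact: ltW|rewrite ler_wpM2r].
have sA : C * (j%:R * `|h|) `^ al + KA * (j%:R * `|h|) `^ ga <= 1.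
  apply: le_trans dAe; rewrite lerD // ler_wpM2l //; apply: le_powR => //;
    by [exact: ltW | exact: le_trans jd ddA].
move: (powR_ge0 (j%:R * `|h|) ga) (powR_ge0 (l%:R * `|h|) ga)
  (powR_ge0 (k%:R * `|h|) ga) (powR_ge0 (j%:R * `|h|) al)
  (powR_ge0 (l%:R * `|h|) al) => p1 p2 p3 p4 p5.
move: sum_le sj1 sj2 sl1 sA ql1 pjk Hj Hl Hd Hlip Hlip0 Hcx Hcy HAx HAy H5' p1 p2 p3 p4 p5.
set PJ := (j%:R * `|h|) `^ ga; set PL := (l%:R * `|h|) `^ ga.
set PK := (k%:R * `|h|) `^ ga; set QJ := _ `^ al; set QL := (l%:R * `|h|) `^ al.
move=> sum_le sj1 sj2 sl1 sA ql1 pjk Hj Hl Hd Hlip Hlip0 Hcx Hcy HAx HAy H5' p1 p2 p3 p4 p5.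
clear small hd1 hd2 ih gx gy gx' gy' HA H4 H5 dAe.
set X := `|x - y| in Hj Hd Hlip0 *.
have X0 : 0 <= X by exact: normr_ge0.
have rA (z : R) : z <= r -> C * (1 + z) * QJ + KA * (1 + z) * PJ <= r + 1.
  move=> zr; apply: le_trans (_ : (1 + r) * (C * QJ + KA * PJ) <= _).
    have c1 : 0 <= C * QJ by rewrite mulr_ge0.
    have c2 : 0 <= KA * PJ by rewrite mulr_ge0.
    have := ler_wpM2r c1 zr; have := ler_wpM2r c2 zr; clear; lra.
  have r10 : 0 <= 1 + r by rewrite addr_ge0.
  by have := ler_wpM2l r10 sA; clear; lra.
have b1 : `|mu s u x| <= 2 * r + 1.
  have -> : mu s u x = x + (mu s u x - x) by zmod.
  apply: le_trans (ler_normD _ _) _; have := rA _ rx.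
  have : 0 <= KA * (1 + `|x|) * PJ by rewrite mulr_ge0 // mulr_ge0 // addr_ge0.
  by move: rx Hcx; clear; lra.
have b2 : `|mu s u y| <= 2 * r + 1.
  have -> : mu s u y = y + (mu s u y - y) by zmod.
  apply: le_trans (ler_normD _ _) _; have := rA _ ry.
  have : 0 <= KA * (1 + `|y|) * PJ by rewrite mulr_ge0 // mulr_ge0 // addr_ge0.
  by move: ry Hcy; clear; lra.
have ne1 : `|e1| <= KA * (1 + r) * PJ.
  apply: le_trans HAx _; by rewrite ler_wpM2r // ler_wpM2l // lerD2l.
have b3 : `|mu s u x + e1| <= 2 * r + 1 by rewrite -x'E; move: rx' r0; clear; lra.
have b4 : `|mu s u y + e1| <= 2 * r + 1.
  have -> : mu s u y + e1 = y + (mu s u y - y) + e1 by zmod.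
  apply: le_trans (ler_normD _ _) _; apply: le_trans (lerD (ler_normD _ _) (lexx _)) _.
  have := rA _ (lexx r).
  have : C * (1 + `|y|) * QJ <= C * (1 + r) * QJ.
    by rewrite ler_wpM2r // ler_wpM2l // lerD2l.
  by move: ry Hcy ne1; clear; lra.
have {}H5' := H5' b1 b2 b3 b4.
have Hee : `|e1 - e2| <= K * X * PJ.
  by apply: le_trans Hj; apply: le_of_eq; congr `|_|; rewrite /e1 /e2; zmod.
have bd : `|mu s u x - mu s u y| <= (1 + C * QJ) * X.
  have -> : mu s u x - mu s u y = (mu s u x - mu s u y - (x - y)) + (x - y) by zmod.
  by apply: le_trans (ler_normD _ _) _; rewrite -/X; move: Hlip0; clear; lra.
have xy' : `|x' - y'| <= (1 + e) * X.
  have -> : x' - y' = mu s u x - mu s u y + (e1 - e2) by rewrite /e1 /e2; zmod.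
  apply: le_trans (ler_normD _ _) _.
  have : (K * PJ) * X <= e / 2 * X by rewrite ler_wpM2r.
  have : (C * QJ) * X <= e / 2 * X by rewrite ler_wpM2r.
  by move: bd Hee; clear; lra.
have M2 : `|mu u t (mu s u y + e1) - mu u t (mu s u y + e2)| <= (1 + e) * (K * X * PJ).
  have E : mu s u y + e1 - (mu s u y + e2) = e1 - e2 by zmod.
  have -> : mu u t (mu s u y + e1) - mu u t (mu s u y + e2) =
    mu u t (mu s u y + e1) - mu u t (mu s u y + e2) - (mu s u y + e1 - (mu s u y + e2))
     + (e1 - e2) by zmod.
  apply: le_trans (ler_normD _ _) _.
  rewrite E in Hlip *.
  have le_e : (C * QL) * `|e1 - e2| <= e * `|e1 - e2|.
    by rewrite ler_wpM2r //; move: sl1 e0; clear; lra.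
  have e1' : 0 <= 1 + e by move: e0; clear; lra.
  have := ler_wpM2l e1' Hee; move: le_e Hlip; clear; lra.
have M1 : C5 * `|e1| * `|mu s u x - mu s u y| * QL
     <= 2 * C5 * KA * (1 + r) * X * PK.
  have s1 : `|mu s u x - mu s u y| <= 2 * X.
    apply: le_trans bd _; rewrite ler_wpM2r //.
    have : 0 <= KA * PJ by rewrite mulr_ge0.
    by move: sA; clear; lra.
  have s2 : `|e1| <= KA * (1 + r) * PK.
    by apply: le_trans ne1 _; rewrite ler_wpM2l // mulr_ge0 // addr_ge0.
  have n1 : 0 <= `|e1| by []. have n2 : 0 <= `|mu s u x - mu s u y| by [].
  apply: le_trans (_ : C5 * `|e1| * `|mu s u x - mu s u y| <= _).
    by rewrite ler_piMr // mulr_ge0 // mulr_ge0.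
  apply: le_trans (_ : C5 * (KA * (1 + r) * PK) * (2 * X) <= _); last by clear; lra.
  rewrite ler_pM // ?mulr_ge0 // ler_wpM2l //.
have N2 : K * `|x' - y'| * PL <= (1 + e) * (K * X * PL).
  have : (K * PL) * `|x' - y'| <= (K * PL) * ((1 + e) * X).
    by rewrite ler_wpM2l // mulr_ge0.
  by clear; lra.
have -> : scheme mu u h l x' - scheme mu u h l y' - (mu s t x - mu s t y)
  = (scheme mu u h l x' - scheme mu u h l y' - (mu u t x' - mu u t y'))
  + (mu u t (mu s u x + e1) - mu u t (mu s u x) - (mu u t (mu s u y + e1) - mu u t (mu s u y)))
  + (mu u t (mu s u y + e1) - mu u t (mu s u y + e2))
  + (mu u t (mu s u x) - mu s t x - (mu u t (mu s u y) - mu s t y)).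
  by rewrite -x'E -y'E; zmod.
apply: le_trans (ler_normD _ _) _.
apply: le_trans (lerD (ler_normD _ _) (lexx _)) _.
apply: le_trans (lerD (lerD (ler_normD _ _) (lexx _)) (lexx _)) _.
have F := halving_close th0 th1 (erefl e) KE K0 X0 p3 sum_le.
have C'E : C' * X * PK = 2 * C5 * KA * (1 + r) * X * PK + C4 * X * PK.
  by rewrite /C'; ring.
move: F C'E M1 M2 N2 Hl Hd H5'; clear; lra.
Qed.

Lemma scheme_move {R : realType} {V : normedModType R} (a b al ga C : R)
    (mu : R -> R -> V -> V) : sewable a b al ga C mu ->
  exists K d : R, [/\ 0 <= K, 0 < d
  & forall s h k x, a <= s <= b -> a <= s + k%:R * h <= b -> k%:R * `|h| <= d ->
    `|scheme mu s h k x - mu s (s + k%:R * h) x|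
      <= K * (1 + `|x|) * (k%:R * `|h|) `^ ga /\
    `|scheme mu s h k x - x| <= 1 + `|x|].
Proof.
move=> hmu; have [K [d [K0 d0 Kd HA]]] := scheme_estimate hmu.
have [al0 ga1 C0 mu_close _ _] := hmu.
exists K, d; split=> // s h k x hs ht kd; have {}HA := HA s h k x hs ht kd.
split=> //; apply: le_trans (ler_distD (mu s (s + k%:R * h) x) _ _) _.
have {mu_close} := mu_close _ _ x hs ht.
rewrite [X in `|X| `^ al]addrAC subrr add0r normrM normr_nat => Hc.
have kh0 : 0 <= k%:R * `|h| by rewrite mulr_ge0.
have X0 : 0 <= 1 + `|x| by rewrite addr_ge0.
have : C * (k%:R * `|h|) `^ al <= C * d `^ al.
  by rewrite ler_wpM2l // le_powR // ltW.
have : K * (k%:R * `|h|) `^ ga <= K * d `^ ga.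
  by rewrite ler_wpM2l // le_powR // (le_trans ler01) // ltW.
move=> h1 h2; have h3 := ler_wpM2l X0 (lerD h1 h2); have h4 := ler_wpM2l X0 Kd.
by move: h3 h4 Hc HA; clear; lra.
Qed.

Lemma grid_norm {R : realType} (a b s h : R) (k : nat) :
  a <= s <= b -> a <= s + k%:R * h <= b -> k%:R * `|h| <= b - a.
Proof.
move=> /andP[s1 s2] /andP[t1 t2]; rewrite -[k%:R]normr_nat -normrM ler_norml.
by apply/andP; split; lra.
Qed.

Lemma le_truncS {R : realType} (x : R) : x <= (Num.truncn x).+1%:R.
Proof.
have [x0|/ltW x0] := leP 0 x; last exact: le_trans x0 (ler0n _ _).
by have := truncn_itv x0; case/andP => _ /ltW.
Qed.

Lemma scheme_growth {R : realType} {V : normedModType R} (a b al ga C : R)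
    (mu : R -> R -> V -> V) : sewable a b al ga C mu ->
  exists h0 G : R, [/\ 0 < h0, 1 <= G
  & forall s h k x, a <= s <= b -> a <= s + k%:R * h <= b -> `|h| <= h0 ->
    1 + `|scheme mu s h k x| <= G * (1 + `|x|)].
Proof.
move=> hmu; have [K [d [_ d0 HA]]] := scheme_move hmu.
pose m := (Num.truncn ((b - a) / (d / 2))).+1.
exists (d / 2), (2 ^+ m.+1); split; [by rewrite divr_gt0| by rewrite exprn_ege1 ?ler1n |].
move=> s h k x hs ht hh.
have := @chain_doubling R (fun j => 1 + `|scheme mu s h j x|) d `|h| k m k d0
  (normr_ge0 _) hh; apply => //.
- move=> j i jik ih; rewrite scheme_add.
  have hu : a <= s + j%:R * h <= b.
    by apply: grid_between hs ht; apply: leq_trans jik; exact: leq_addr.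
  have hu' : a <= s + j%:R * h + i%:R * h <= b.
    by rewrite -addrA -mulrDl -natrD; exact: grid_between ht.
  have [_] := HA _ _ _ (scheme mu s h j x) hu hu' ih.
  move: (scheme mu s h j x) => y; set z := scheme _ _ _ _ _ => zy.
  have := ler_normD (z - y) y; rewrite subrK; move: zy; clear; lra.
- apply: le_trans (grid_norm hs ht) _; rewrite -ler_pdivrMr ?divr_gt0 //.
  exact: le_truncS.
Qed.

Lemma mu_growth {R : realType} {V : normedModType R} (a b al ga C : R)
    (mu : R -> R -> V -> V) : sewable a b al ga C mu ->
  exists h0 G : R, [/\ 0 < h0, 1 <= G
  & forall s t x, a <= s <= b -> a <= t <= b -> `|t - s| <= h0 ->
    1 + `|mu s t x| <= G * (1 + `|x|)].
Proof.
move=> hmu; have [h0 [G [h00 G1 HG]]] := scheme_growth hmu.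
exists h0, G; split=> // s t x hs ht hh.
have := HG s (t - s) 1%N x hs; rewrite mul1r addrC subrK => /(_ ht hh) /=.
by rewrite mul0r addr0 mul1r [s + _]addrC subrK.
Qed.

Lemma scheme_lipschitz {R : realType} {V : normedModType R} (a b al ga C : R)
    (mu : R -> R -> V -> V) (r : R) :
  sewable a b al ga C mu -> sewable_loc a b al ga mu -> 0 <= r ->
  exists h0 L : R, [/\ 0 < h0, 1 <= L
  & forall s h k x y, a <= s <= b -> a <= s + k%:R * h <= b -> `|h| <= h0 ->
    `|x| <= r -> `|y| <= r ->
    `|scheme mu s h k x - scheme mu s h k y| <= L * `|x - y|].
Proof.
move=> hmu hloc r0; have [hG [G [hG0 G1 HG]]] := scheme_growth hmu.
have r10 : 0 <= G * (1 + r) by rewrite mulr_ge0 ?addr_ge0 // (le_trans ler01).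
have [K [d [K0 d0 Kd HB]]] := scheme_estimate_lip hmu hloc r10.
have [al0 ga1 C0 _ mu_lip _] := hmu.
pose m := (Num.truncn ((b - a) / (d / 2))).+1.
exists (Num.min hG (d / 2)), (2 ^+ m.+1); split.
- by rewrite lt_min hG0 divr_gt0.
- by rewrite exprn_ege1 ?ler1n.
move=> s h k x y hs ht; rewrite le_min => /andP[hhG hh] xr yr.
have gr z j : `|z| <= r -> (j <= k)%N -> `|scheme mu s h j z| <= G * (1 + r).
  move=> zr jk; have := HG s h j z hs (grid_between jk hs ht) hhG.
  have : G * (1 + `|z|) <= G * (1 + r) by rewrite ler_wpM2l ?lerD2l // (le_trans ler01).
  by clear; lra.
have := @chain_doubling R (fun j => `|scheme mu s h j x - scheme mu s h j y|)
  d `|h| k m k d0 (normr_ge0 _) hh; apply => //.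
- move=> j i jik ih; rewrite !scheme_add.
  have hu : a <= s + j%:R * h <= b.
    by apply: grid_between hs ht; apply: leq_trans jik; exact: leq_addr.
  have hu' : a <= s + j%:R * h + i%:R * h <= b.
    by rewrite -addrA -mulrDl -natrD; exact: grid_between ht.
  have gr' z : `|z| <= r -> forall l, (l <= i)%N ->
      `|scheme mu (s + j%:R * h) h l (scheme mu s h j z)| <= G * (1 + r).
    move=> zr l li; rewrite -scheme_add; apply: gr => //.
    by apply: leq_trans jik; rewrite leq_add2l.
  have := HB _ _ _ _ _ hu hu' ih (gr' _ xr) (gr' _ yr).
  have := mu_lip _ _ (scheme mu s h j x) (scheme mu s h j y) hu hu'.
  rewrite [X in `|X| `^ al]addrAC subrr add0r normrM normr_nat.
  set p := scheme mu s h j x; set q := scheme mu s h j y.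
  set t := _ + i%:R * h; set p' := scheme _ _ _ _ p; set q' := scheme _ _ _ _ q.
  have ih0 : 0 <= i%:R * `|h| by rewrite mulr_ge0.
  have : C * (i%:R * `|h|) `^ al <= C * d `^ al.
    by rewrite ler_wpM2l // le_powR // ltW.
  have : K * (i%:R * `|h|) `^ ga <= K * d `^ ga.
    by rewrite ler_wpM2l // le_powR // (le_trans ler01) // ltW.
  move=> h1 h2 h3 h4; have X0 : 0 <= `|p - q| by [].
  have h5 := ler_wpM2l X0 (lerD h1 h2); have h6 := ler_wpM2l X0 Kd.
  have -> : p' - q' = (p' - q' - (mu (s + j%:R * h) t p - mu (s + j%:R * h) t q))
    + (mu (s + j%:R * h) t p - mu (s + j%:R * h) t q - (p - q)) + (p - q) by zmod.
  apply: le_trans (ler_normD _ _) _.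
  apply: le_trans (lerD (ler_normD _ _) (lexx _)) _.
  by move: h3 h4 h5 h6; clear; lra.
- apply: le_trans (grid_norm hs ht) _; rewrite -ler_pdivrMr ?divr_gt0 //.
  exact: le_truncS.
Qed.

Lemma scheme_shadow {R : realType} {V : normedModType R} (a b al ga C : R)
    (mu : R -> R -> V -> V) (r : R) :
  sewable a b al ga C mu -> sewable_loc a b al ga mu -> 0 <= r ->
  exists h0 L : R, [/\ 0 < h0, 1 <= L
  & forall s h N (z : nat -> V) e, a <= s <= b -> a <= s + N%:R * h <= b ->
    `|h| <= h0 -> (forall j, (j <= N)%N -> `|z j| <= r) ->
    (forall j, (j < N)%N ->
      `|z j.+1 - mu (s + j%:R * h) (s + j.+1%:R * h) (z j)| <= e) ->
    `|z N - scheme mu s h N (z 0%N)| <= N%:R * (L * e)].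
Proof.
move=> hmu hloc r0; have [hG [G [hG0 G1 HG]]] := mu_growth hmu.
have G0 : 0 <= G := le_trans ler01 G1.
have r10 : 0 <= G * (1 + r) by rewrite mulr_ge0 ?addr_ge0.
have [hL [L [hL0 L1 HL]]] := scheme_lipschitz hmu hloc r10.
exists (Num.min hG hL), L; split=> //; first by rewrite lt_min hG0.
move=> s h N z e hs ht; rewrite le_min => /andP[hhG hhL] zr ze.
apply: scheme_telescope => j jN.
have hj i : (i <= N)%N -> a <= s + i%:R * h <= b by move=> iN; apply: grid_between ht.
apply: le_trans (HL _ _ _ _ _ (hj _ jN) _ hhL _ _) _.
- by rewrite -addrA -mulrDl -natrD subnKC.
- have := zr _ jN; have : (1 + r) * (G - 1) >= 0.
    by apply: mulr_ge0; [exact: addr_ge0 | rewrite subr_ge0].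
  by clear; lra.
- have hstep : `|s + j.+1%:R * h - (s + j%:R * h)| <= hG.
    by rewrite -natr1 (_ : _ - _ = h) //; ring.
  have := HG _ _ (z j) (hj _ (ltnW jN)) (hj _ jN) hstep.
  have : G * (1 + `|z j|) <= G * (1 + r) by rewrite ler_wpM2l // lerD2l zr // ltnW.
  by clear; lra.
- by rewrite ler_wpM2l ?(le_trans ler01) // ze.
Qed.

Lemma scheme_refine {R : realType} {V : normedModType R} (a b al ga C : R)
    (mu : R -> R -> V -> V) (r : R) :
  sewable a b al ga C mu -> sewable_loc a b al ga mu -> 0 <= r ->
  exists h0 E : R, [/\ 0 < h0, 0 <= E
  & forall s h N k x, a <= s <= b -> a <= s + N%:R * h <= b -> `|h| <= h0 ->
    `|x| <= r ->
    `|scheme mu s (h / k.+1%:R) (N * k.+1) x - scheme mu s h N x|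
      <= E * (N%:R * `|h| `^ ga)].
Proof.
move=> hmu hloc r0; have [hG [G [hG0 G1 HG]]] := scheme_growth hmu.
have [K [d [K0 d0 HA]]] := scheme_move hmu.
have G0 : 0 <= G := le_trans ler01 G1.
have r10 : 0 <= G * (1 + r) by rewrite mulr_ge0 ?addr_ge0.
have [hL [L [hL0 L1 HL]]] := scheme_shadow hmu hloc r10.
exists (Num.min (Num.min hG d) hL), (L * (K * (1 + G * (1 + r)))); split.
- by rewrite !lt_min hG0 d0.
- by rewrite !mulr_ge0 ?addr_ge0 // (le_trans ler01).
move=> s h N k x hs ht; rewrite !le_min -andbA => /and3P[hhG hd hhL] xr.
pose h' := h / k.+1%:R.
have kh' : k.+1%:R * h' = h by rewrite mulrC divfK // pnatr_eq0.
have jE (j : nat) : s + (j * k.+1)%:R * h' = s + j%:R * h by rewrite natrM -mulrA kh'.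
have nh' : `|h'| <= `|h|.
  by rewrite -[in leRHS]kh' [leRHS]normrM normr_nat ler_peMl // ler1n.
pose z j := scheme mu s h' (j * k.+1) x.
have zr j : (j <= N)%N -> `|z j| <= G * (1 + r).
  move=> jN; have := HG s h' (j * k.+1)%N x hs.
  rewrite jE => /(_ (grid_between jN hs ht) (le_trans nh' hhG)).
  have : G * (1 + `|x|) <= G * (1 + r) by rewrite ler_wpM2l // lerD2l.
  by rewrite -/(z j); clear; lra.
have -> : L * (K * (1 + G * (1 + r))) * (N%:R * `|h| `^ ga)
   = N%:R * (L * (K * (1 + G * (1 + r)) * `|h| `^ ga)) by ring.
have -> : scheme mu s h N x = scheme mu s h N (z 0%N) by rewrite /z mul0n.
apply: HL => // j jN.
have hj i : (i <= N)%N -> a <= s + i%:R * h <= b by move=> iN; apply: grid_between ht.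
have -> : z j.+1 = scheme mu (s + j%:R * h) h' k.+1 (z j).
  by rewrite /z mulSn addnC scheme_add jE.
have := HA (s + j%:R * h) h' k.+1 (z j) (hj _ (ltnW jN)).
rewrite kh' -addrA -[X in _ + (_ + X)]mul1r -mulrDl natr1.
rewrite -[X in X * `|h'|]normr_nat -normrM kh'.
case/(_ (hj _ jN) hd) => Hz _; apply: le_trans Hz _.
by rewrite ler_wpM2r ?powR_ge0 // ler_wpM2l // lerD2l zr // ltnW.
Qed.

Definition flow {R : realType} {V : completeNormedModType R}
    (mu : R -> R -> V -> V) (s t : R) (x : V) : V :=
  lim (scheme mu s ((t - s) / N.+1%:R) N.+1 x @[N --> \oo]).

Definition grid_rate {R : realType} (ga : R) (N : nat) : R :=
  N.+1%:R^-1 `^ (ga - 1).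

Lemma grid_rate_small {R : realType} (ga c e : R) : 1 < ga -> 0 <= c -> 0 < e ->
  exists N0, forall N, (N0 <= N)%N -> c * grid_rate ga N <= e.
Proof.
move=> ga1 c0 e0; have ga0 : 0 < ga - 1 by lra.
have [d d0 hd] := powR_small c0 ga0 e0.
exists (Num.truncn d^-1) => N hN; apply: hd; first by rewrite invr_ge0.
rewrite invf_ple ?posrE // ?ltr0n //; apply: le_trans (le_truncS _) _.
by rewrite ler_nat.
Qed.

Lemma grid_rateE {R : realType} (ga h : R) (N : nat) : 1 < ga ->
  N.+1%:R * `|h / N.+1%:R| `^ ga = `|h| `^ ga * grid_rate ga N.
Proof.
move=> ga1; have N0 : 0 < N.+1%:R :> R by rewrite ltr0n.
rewrite normrM normfV normr_nat powRM ?invr_ge0 //.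
rewrite [_^-1 `^ ga]powR_succ ?invr_ge0 //; last by lra.
by rewrite mulrCA; congr (_ * _); rewrite mulrA divff ?mul1r // gt_eqF.
Qed.

Lemma uniform_end {R : realType} (s t : R) (N : nat) :
  s + N.+1%:R * ((t - s) / N.+1%:R) = t.
Proof. by rewrite mulrC divfK ?pnatr_eq0 // addrC subrK. Qed.

Lemma uniform_step {R : realType} (a b s t d : R) : 0 < d ->
  a <= s <= b -> a <= t <= b ->
  forall N, (Num.truncn ((b - a) / d) <= N)%N -> `|(t - s) / N.+1%:R| <= d.
Proof.
move=> d0 /andP[s1 s2] /andP[t1 t2] N hN.
rewrite normrM normfV normr_nat ler_pdivrMr ?ltr0n //.
apply: (@le_trans _ _ (b - a)); first by rewrite ler_norml; apply/andP; split; lra.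
rewrite mulrC -ler_pdivrMr //; apply: le_trans (le_truncS _) _.
by rewrite ler_nat.
Qed.

Lemma scheme_cauchy {R : realType} {V : normedModType R} (a b al ga C : R)
    (mu : R -> R -> V -> V) (r : R) :
  sewable a b al ga C mu -> sewable_loc a b al ga mu -> 0 <= r ->
  exists N0 (E : R), 0 <= E /\
    forall s t x N M, a <= s <= b -> a <= t <= b -> `|x| <= r ->
    (N0 <= N)%N -> (N0 <= M)%N ->
    `|scheme mu s ((t - s) / N.+1%:R) N.+1 x
      - scheme mu s ((t - s) / M.+1%:R) M.+1 x|
      <= E * (grid_rate ga N + grid_rate ga M).
Proof.
move=> hmu hloc r0; have [h0 [E [h00 E0 HE]]] := scheme_refine hmu hloc r0.
have [al0 ga1 C0 _ _ _] := hmu.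
exists (Num.truncn ((b - a) / h0)), (E * (b - a) `^ ga); split.
  by rewrite mulr_ge0 ?powR_ge0.
move=> s t x N M hs ht xr hN hM.
have ba : `|t - s| `^ ga <= (b - a) `^ ga.
  apply: le_powR; [by lra | by [] |].
  by have := @grid_norm R a b s (t - s) 1 hs; rewrite !mul1r addrC subrK => /(_ ht).
pose h1 := (t - s) / N.+1%:R; pose h2 := (t - s) / M.+1%:R.
have key K K' : (Num.truncn ((b - a) / h0) <= K)%N ->
    `|scheme mu s ((t - s) / K.+1%:R / K'.+1%:R) (K.+1 * K'.+1) x
      - scheme mu s ((t - s) / K.+1%:R) K.+1 x|
    <= E * (b - a) `^ ga * grid_rate ga K.
  move=> hK; have := HE s ((t - s) / K.+1%:R) K.+1 K' x hs.
  rewrite uniform_end => /(_ ht (uniform_step h00 hs ht hK) xr) /le_trans; apply.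
  rewrite grid_rateE // -mulrA ler_wpM2l // ler_wpM2r // powR_ge0 //.
apply: le_trans (ler_distD (scheme mu s ((t - s) / N.+1%:R / M.+1%:R) (N.+1 * M.+1) x) _ _) _.
rewrite mulrDr lerD //; first by rewrite distrC; exact: key.
by rewrite mulrAC mulnC; exact: key.
Qed.

Lemma cauchy_seq_cvg {R : realType} {V : completeNormedModType R} (u : nat -> V) :
  (forall e : R, 0 < e -> exists N0, forall N M, (N0 <= N)%N -> (N0 <= M)%N ->
     `|u N - u M| <= e) -> cvg (u n @[n --> \oo]).
Proof.
move=> Hu; apply/cauchy_cvgP/cauchyP => e e0.
have e20 : 0 < e / 2 by rewrite divr_gt0.
have [N0 HN] := Hu _ e20; exists (u N0).
exists N0 => //= n hn; rewrite -ball_normE /=.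
by apply: le_lt_trans (HN _ _ _ _) _ => //; rewrite ltr_pdivrMr // ltr_pMr // ltr1n.
Qed.

Lemma flow_rate {R : realType} {V : completeNormedModType R} (a b al ga C : R)
    (mu : R -> R -> V -> V) (r : R) :
  sewable a b al ga C mu -> sewable_loc a b al ga mu -> 0 <= r ->
  exists N0 (E : R), 0 <= E /\
    forall s t x N, a <= s <= b -> a <= t <= b -> `|x| <= r -> (N0 <= N)%N ->
    `|flow mu s t x - scheme mu s ((t - s) / N.+1%:R) N.+1 x|
      <= E * grid_rate ga N.
Proof.
move=> hmu hloc r0; have [N0 [E [E0 HE]]] := scheme_cauchy hmu hloc r0.
have [_ ga1 _ _ _ _] := hmu.
exists N0, E; split=> // s t x N hs ht xr hN.
pose u n := scheme mu s ((t - s) / n.+1%:R) n.+1 x.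
have cu : cvg (u n @[n --> \oo]).
  apply: cauchy_seq_cvg => e e0; have e20 : 0 < e / 2 by rewrite divr_gt0.
  have [N1 HN1] := grid_rate_small ga1 E0 e20.
  exists (maxn N0 N1) => n m; rewrite !geq_max => /andP[n1 n2] /andP[m1 m2].
  apply: le_trans (HE _ _ _ _ _ hs ht xr n1 m1) _.
  by have := HN1 _ n2; have := HN1 _ m2; rewrite mulrDr; lra.
apply/ler_addgt0Pr => e e0; have e20 : 0 < e / 2 by rewrite divr_gt0.
have [N1 HN1] := grid_rate_small ga1 E0 e20.
have /cvgrPdist_le/(_ _ e20)[N2 _ HN2] : u n @[n --> \oo] --> flow mu s t x.
  exact: cu.
pose n := maxn (maxn N0 N1) N2.
have n0 : (N0 <= n)%N by rewrite !leq_max leqnn.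
have n1 : (N1 <= n)%N by rewrite !leq_max leqnn orbT.
have n2 : (N2 <= n)%N by rewrite !leq_max leqnn !orbT.
apply: le_trans (ler_distD (u n) _ _) _.
have H1 : `|flow mu s t x - u n| <= e / 2 := HN2 n n2.
have H2 := HE _ _ _ _ _ hs ht xr n0 hN.
by move: H1 H2 (HN1 _ n1); rewrite -/(u n) mulrDr; clear; lra.
Qed.

Lemma grid_rate_le_eventually {R : realType} (ga c A B : R) (N0 : nat) :
  1 < ga -> 0 <= c ->
  (forall N, (N0 <= N)%N -> A <= B + c * grid_rate ga N) -> A <= B.
Proof.
move=> ga1 c0 H; apply/ler_addgt0Pr => e e0.
have [N1 HN1] := grid_rate_small ga1 c0 e0.
have := H (maxn N0 N1) (leq_maxl _ _).
by have := HN1 (maxn N0 N1) (leq_maxr _ _); lra.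
Qed.

Lemma flow_close {R : realType} {V : completeNormedModType R} (a b al ga C : R)
    (mu : R -> R -> V -> V) :
  sewable a b al ga C mu -> sewable_loc a b al ga mu ->
  exists K d : R, [/\ 0 <= K, 0 < d
  & forall s t x, a <= s <= b -> a <= t <= b -> `|t - s| <= d ->
    `|flow mu s t x - mu s t x| <= K * (1 + `|x|) * `|t - s| `^ ga].
Proof.
move=> hmu hloc; have [K [d [K0 d0 HA]]] := scheme_move hmu.
have [_ ga1 _ _ _ _] := hmu.
exists K, d; split=> // s t x hs ht td.
have [N0 [E [E0 HE]]] := flow_rate hmu hloc (normr_ge0 x).
apply: (grid_rate_le_eventually (N0 := N0) ga1 E0) => N hN.
apply: le_trans (ler_distD (scheme mu s ((t - s) / N.+1%:R) N.+1 x) _ _) _.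
rewrite addrC lerD ?HE //.
have := HA s ((t - s) / N.+1%:R) N.+1 x hs; rewrite uniform_end.
rewrite -[X in X * _]normr_nat -normrM mulrC divfK ?pnatr_eq0 //.
by case/(_ ht td).
Qed.

Lemma flow_growth {R : realType} {V : completeNormedModType R} (a b al ga C : R)
    (mu : R -> R -> V -> V) :
  sewable a b al ga C mu -> sewable_loc a b al ga mu ->
  exists2 G : R, 1 <= G &
    forall s t x, a <= s <= b -> a <= t <= b -> 1 + `|flow mu s t x| <= G * (1 + `|x|).
Proof.
move=> hmu hloc; have [h0 [G [h00 G1 HG]]] := scheme_growth hmu.
have [_ ga1 _ _ _ _] := hmu.
exists G => // s t x hs ht.
have [N0 [E [E0 HE]]] := flow_rate hmu hloc (normr_ge0 x).
apply: (grid_rate_le_eventually (N0 := maxn N0 (Num.truncn ((b - a) / h0))) ga1 E0) => N.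
rewrite geq_max => /andP[hN hN'].
have := HG s ((t - s) / N.+1%:R) N.+1 x hs; rewrite uniform_end.
move=> /(_ ht (uniform_step h00 hs ht hN')).
have := HE s t x N hs ht (lexx _) hN.
set y := scheme _ _ _ _ _ => h1 h2.
have := ler_normD (flow mu s t x - y) y; rewrite subrK.
by move: h1 h2; clear; lra.
Qed.

Lemma flow_lipschitz {R : realType} {V : completeNormedModType R} (a b al ga C : R)
    (mu : R -> R -> V -> V) (r : R) :
  sewable a b al ga C mu -> sewable_loc a b al ga mu -> 0 <= r ->
  exists2 L : R, 1 <= L &
    forall s t x y, a <= s <= b -> a <= t <= b -> `|x| <= r -> `|y| <= r ->
    `|flow mu s t x - flow mu s t y| <= L * `|x - y|.
Proof.
move=> hmu hloc r0; have [h0 [L [h00 L1 HL]]] := scheme_lipschitz hmu hloc r0.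
have [_ ga1 _ _ _ _] := hmu.
exists L => // s t x y hs ht xr yr.
have [N0 [E [E0 HE]]] := flow_rate hmu hloc r0.
have E20 : 0 <= 2 * E by rewrite mulr_ge0.
apply: (grid_rate_le_eventually (N0 := maxn N0 (Num.truncn ((b - a) / h0))) ga1 E20) => N.
rewrite geq_max => /andP[hN hN'].
have := HL s ((t - s) / N.+1%:R) N.+1 x y hs; rewrite uniform_end.
move=> /(_ ht (uniform_step h00 hs ht hN') xr yr).
have := HE s t x N hs ht xr hN; have := HE s t y N hs ht yr hN.
set x' := scheme _ _ _ _ x; set y' := scheme _ _ _ _ y => h1 h2 h3.
have -> : flow mu s t x - flow mu s t y = (flow mu s t x - x') + (x' - y')
   - (flow mu s t y - y') by zmod.
apply: le_trans (ler_normB _ _) _.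
apply: le_trans (lerD (ler_normD _ _) (lexx _)) _.
by move: h1 h2 h3; clear; lra.
Qed.

Lemma grid_step_ordered {R : realType} (s h : R) (j k : nat) : (j < k)%N ->
  (s <= s + j%:R * h) && (s + j%:R * h <= s + j.+1%:R * h <= s + k%:R * h) ||
  (s + k%:R * h <= s + j.+1%:R * h) && (s + j.+1%:R * h <= s + j%:R * h <= s).
Proof.
move=> jk; have j0 : 0 <= j%:R :> R by [].
have j1 : j.+1%:R = j%:R + 1 :> R by rewrite natr1.
have : j.+1%:R <= k%:R :> R by rewrite ler_nat.
rewrite j1 => jk'; case: (leP 0 h) => h0; apply/orP; [left|right];
  apply/and3P; split; nra.
Qed.

Lemma flow_unique {R : realType} {V : completeNormedModType R} (a b al ga C : R)
    (mu : R -> R -> V -> V) (Y : R -> V) (s t r K d : R) :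
  sewable a b al ga C mu -> sewable_loc a b al ga mu ->
  a <= s <= b -> a <= t <= b -> 0 <= K -> 0 < d ->
  (forall u, (s <= u <= t) || (t <= u <= s) -> `|Y u| <= r) ->
  (forall u v, (s <= u) && (u <= v <= t) || (t <= v) && (v <= u <= s) ->
     `|v - u| <= d -> `|Y v - mu u v (Y u)| <= K * `|v - u| `^ ga) ->
  Y t = flow mu s t (Y s).
Proof.
move=> hmu hloc hs ht K0 d0 Yr Ymu.
have [_ ga1 _ _ _ _] := hmu.
have ss : (s <= s <= t) || (t <= s <= s) by rewrite lexx /= andbT le_total.
have r0 : 0 <= r := le_trans (normr_ge0 _) (Yr _ ss).
have [h0 [L [h00 L1 HL]]] := scheme_shadow hmu hloc r0.
have [N0 [E [E0 HE]]] := flow_rate hmu hloc r0.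
have c0 : 0 <= L * K * `|t - s| `^ ga + E.
  by rewrite addr_ge0 // mulr_ge0 ?powR_ge0 // mulr_ge0 // (le_trans ler01).
apply/eqP; rewrite -subr_eq0 -normr_le0.
apply: (grid_rate_le_eventually (N0 := maxn N0 (maxn (Num.truncn ((b - a) / h0))
  (Num.truncn ((b - a) / d)))) ga1 c0) => N.
rewrite !geq_max => /and3P[hN hN1 hN2].
pose h := (t - s) / N.+1%:R; pose z j := Y (s + j%:R * h).
have hh0 : `|h| <= h0 := uniform_step h00 hs ht hN1.
have hd : `|h| <= d := uniform_step d0 hs ht hN2.
have tE : s + N.+1%:R * h = t := uniform_end s t N.
have htE : a <= s + N.+1%:R * h <= b by rewrite tE.
have between j : (j <= N.+1)%N ->
    (s <= s + j%:R * h <= t) || (t <= s + j%:R * h <= s).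
  by move=> jN; have := grid_ordered s h jN; rewrite tE.
have H1 := HL s h N.+1 z (K * `|h| `^ ga) hs htE hh0 _ _.
have H2 := HE s t (Y s) N hs ht (Yr _ ss) hN.
have z0 : z 0%N = Y s by rewrite /z mul0r addr0.
have zN : z N.+1 = Y t by rewrite /z tE.
apply: le_trans (ler_distD (scheme mu s h N.+1 (Y s)) _ _) _.
rewrite add0r mulrDl lerD //; last by rewrite distrC.
move: H1; rewrite z0 zN => H1; apply: le_trans (H1 _ _) _.
- by move=> j jN; apply/Yr/between.
- move=> j jN; have hE : s + j.+1%:R * h - (s + j%:R * h) = h by rewrite -natr1; ring.
  have := Ymu (s + j%:R * h) (s + j.+1%:R * h); rewrite hE; apply => //.
  by have := grid_step_ordered s h jN; rewrite tE.
- rewrite (_ : _ * (L * _) = L * K * (N.+1%:R * `|h| `^ ga)); last by ring.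
  by rewrite grid_rateE // mulrA.
Qed.

Lemma flow_id {R : realType} {V : completeNormedModType R} (a b al ga C : R)
    (mu : R -> R -> V -> V) s x :
  sewable a b al ga C mu -> sewable_loc a b al ga mu -> a <= s <= b ->
  flow mu s s x = x.
Proof.
move=> hmu hloc hs; have [K [d [K0 d0 HK]]] := flow_close hmu hloc.
have [_ ga1 _ _ _ _] := hmu; have ga0 : ga != 0 by apply: lt0r_neq0; lra.
have := HK s s x hs hs; rewrite subrr normr0 => /(_ (ltW d0)).
rewrite (sewable_id _ hmu) // powR0 // mulr0 normr_le0 subr_eq0.
by move/eqP.
Qed.

Lemma grid_rate_mono {R : realType} (ga : R) (m n : nat) : 1 < ga -> (m <= n)%N ->
  grid_rate ga n <= grid_rate ga m.
Proof.
move=> ga1 mn; apply: le_powR; rewrite ?invr_ge0 //; first by lra.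
by rewrite lef_pV2 ?posrE ?ltr0n // ler_nat.
Qed.

Lemma flow_rate_grid {R : realType} {V : completeNormedModType R} (a b al ga C : R)
    (mu : R -> R -> V -> V) (r : R) :
  sewable a b al ga C mu -> sewable_loc a b al ga mu -> 0 <= r ->
  exists N0 (E : R), 0 <= E /\
    forall s h j m x, (0 < j)%N -> a <= s <= b -> a <= s + j%:R * h <= b ->
    `|x| <= r -> (N0 <= m)%N ->
    `|flow mu s (s + j%:R * h) x - scheme mu s (h / m.+1%:R) (j * m.+1) x|
      <= E * grid_rate ga m.
Proof.
move=> hmu hloc r0; have [N0 [E [E0 HE]]] := flow_rate hmu hloc r0.
have [_ ga1 _ _ _ _] := hmu.
exists N0, E; split=> // s h j m x j0 hs ht xr hm.
have jm : (j * m.+1 = (j * m.+1).-1.+1)%N by rewrite prednK // muln_gt0 j0.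
have mN : (m <= (j * m.+1).-1)%N.
  by rewrite -ltnS -jm leq_pmull.
have := HE s (s + j%:R * h) x _ hs ht xr (leq_trans hm mN); rewrite -jm.
rewrite addrAC subrr add0r natrM.
have -> : j%:R * h / (j%:R * m.+1%:R) = h / m.+1%:R.
  by rewrite invfM mulrACA divff ?mul1r // pnatr_eq0 -lt0n.
by move/le_trans; apply; rewrite ler_wpM2l // grid_rate_mono.
Qed.

Lemma flow_add_grid {R : realType} {V : completeNormedModType R} (a b al ga C : R)
    (mu : R -> R -> V -> V) s h j k x :
  sewable a b al ga C mu -> sewable_loc a b al ga mu ->
  a <= s <= b -> a <= s + (j + k)%:R * h <= b ->
  flow mu s (s + (j + k)%:R * h) x
    = flow mu (s + j%:R * h) (s + (j + k)%:R * h) (flow mu s (s + j%:R * h) x).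
Proof.
move=> hmu hloc hs ht.
have hu : a <= s + j%:R * h <= b by apply: grid_between hs ht; exact: leq_addr.
have [->|j0] := posnP j; first by rewrite mul0r addr0 (flow_id _ hmu hloc).
have [k0|k0] := posnP k.
  by rewrite k0 addn0 in ht *; rewrite [RHS](flow_id _ hmu hloc).
have [_ ga1 _ _ _ _] := hmu.
set u := s + j%:R * h in hu *.
have tE : s + (j + k)%:R * h = u + k%:R * h by rewrite /u natrD; ring.
rewrite tE in ht *; set t := u + k%:R * h in ht *.
set y := flow mu s u x.
have r0 : 0 <= `|x| + `|y| + 1 by rewrite !addr_ge0.
have [N0 [E [E0 HE]]] := flow_rate_grid hmu hloc r0.
have [L L1 HL] := flow_lipschitz hmu hloc r0.
have [N1 HN1] := grid_rate_small ga1 E0 ltr01.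
have c0 : 0 <= E + E + L * E by rewrite !addr_ge0 // mulr_ge0 // (le_trans ler01).
apply/eqP; rewrite -subr_eq0 -normr_le0.
apply: (grid_rate_le_eventually (N0 := maxn N0 N1) ga1 c0) => m.
rewrite geq_max => /andP[m0 m1].
have xr : `|x| <= `|x| + `|y| + 1 by rewrite -addrA lerDl addr_ge0.
have yr : `|y| <= `|x| + `|y| + 1 by rewrite addrAC lerDr addr_ge0.
have H1 := HE s h j m x j0 hs hu xr m0.
rewrite -/u -/y in H1.
have H2 := HE s h (j + k)%N m x _ hs _ xr m0.
rewrite tE addn_gt0 j0 -/t in H2; have {}H2 := H2 isT ht.
have jm : s + (j * m.+1)%:R * (h / m.+1%:R) = u.
  by rewrite natrM -mulrA [_ * (h / _)]mulrC divfK // pnatr_eq0.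
rewrite mulnDl scheme_add jm in H2.
set X := scheme _ _ _ _ x in H1 H2; set Z := scheme _ _ _ _ X in H2.
have Xr : `|X| <= `|x| + `|y| + 1.
  have := HN1 _ m1; have := ler_distD y X 0; rewrite !subr0 distrC.
  by have : 0 <= `|x| by []; move: H1; clear; lra.
have H3 := HE u h k m X k0 hu ht Xr m0; rewrite -/t -/Z in H3.
have H4 := HL u t X y hu ht Xr yr.
have -> : flow mu s t x - flow mu u t y
   = (flow mu s t x - Z) - (flow mu u t X - Z) + (flow mu u t X - flow mu u t y) by zmod.
apply: le_trans (ler_normD _ _) _.
apply: le_trans (lerD (ler_normB _ _) (lexx _)) _.
have : L * `|X - y| <= L * (E * grid_rate ga m).
  by rewrite ler_wpM2l ?(le_trans ler01) // distrC.
by move: H2 H3 H4; clear; lra.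
Qed.

Lemma scheme_continuous_end {R : realType} {V : normedModType R}
    (mu : R -> R -> V -> V) (s : R) (n : R) (k : nat) (x : V) :
  continuous (fun p : R * R * V => mu p.1.1 p.1.2 p.2) ->
  continuous (fun t : R => scheme mu s ((t - s) / n) k x).
Proof.
move=> cmu; elim: k => [|k ih] t /=; first exact: cvg_cst.
have cg (j : nat) : continuous (fun t : R => s + j%:R * ((t - s) / n)).
  move=> t'; apply: cvgD; first exact: cvg_cst.
  apply: cvgM; first exact: cvg_cst.
  apply: cvgM; last exact: cvg_cst.
  by apply: cvgB; [exact: cvg_id | exact: cvg_cst].
apply: (@continuous_comp _ _ _ (fun t : R => (s + k%:R * ((t - s) / n),
   s + k.+1%:R * ((t - s) / n), scheme mu s ((t - s) / n) k x))
  (fun p : R * R * V => mu p.1.1 p.1.2 p.2)); last exact: cmu.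
exact: (cvg_pair (cvg_pair (cg k t) (cg k.+1 t)) (ih t)).
Qed.

Lemma flow_continuous_end {R : realType} {V : completeNormedModType R}
    (a b al ga C : R) (mu : R -> R -> V -> V) s t x e :
  sewable a b al ga C mu -> sewable_loc a b al ga mu ->
  continuous (fun p : R * R * V => mu p.1.1 p.1.2 p.2) ->
  a <= s <= b -> a <= t <= b -> 0 < e ->
  exists2 d, 0 < d & forall t', a <= t' <= b -> `|t' - t| <= d ->
    `|flow mu s t x - flow mu s t' x| <= e.
Proof.
move=> hmu hloc cmu hs ht e0; have [_ ga1 _ _ _ _] := hmu.
have [N0 [E [E0 HE]]] := flow_rate hmu hloc (normr_ge0 x).
have e30 : 0 < e / 3 by rewrite divr_gt0.
have [N1 HN1] := grid_rate_small ga1 E0 e30.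
pose N := maxn N0 N1.
have := @scheme_continuous_end R V mu s N.+1%:R N.+1 x cmu t.
move/cvgrPdist_le => /(_ _ e30)/nbhs_ballP[d /= d0 Hd].
exists (d / 2); first by rewrite divr_gt0.
move=> t' ht' tt'; have {Hd} := Hd t'; rewrite -ball_normE /= distrC.
have d2 : d / 2 < d by rewrite ltr_pdivrMr // ltr_pMr // ltr1n.
move=> /(_ (le_lt_trans tt' d2)).
have := HE s t x N hs ht (lexx _) (leq_maxl _ _).
have := HE s t' x N hs ht' (lexx _) (leq_maxl _ _).
have := HN1 N (leq_maxr _ _).
set X := scheme _ _ _ _ _; set Y := scheme _ _ _ _ _ => h1 h2 h3 h4.
have -> : flow mu s t x - flow mu s t' x = (flow mu s t x - Y) + (Y - X)
  - (flow mu s t' x - X) by zmod.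
apply: le_trans (ler_normB _ _) _.
apply: le_trans (lerD (ler_normD _ _) (lexx _)) _.
by move: h1 h2 h3 h4; clear; lra.
Qed.

Lemma flow_add {R : realType} {V : completeNormedModType R}
    (a b al ga C : R) (mu : R -> R -> V -> V) s u t x :
  sewable a b al ga C mu -> sewable_loc a b al ga mu ->
  continuous (fun p : R * R * V => mu p.1.1 p.1.2 p.2) ->
  a <= s <= b -> a <= u <= b -> a <= t <= b ->
  (s <= u <= t) || (t <= u <= s) ->
  flow mu s t x = flow mu u t (flow mu s u x).
Proof.
move=> hmu hloc cmu hs hu ht hb.
have [<-|su] := eqVneq s u; first by rewrite (flow_id _ hmu hloc).
set y := flow mu s u x.
apply/eqP; rewrite -subr_eq0 -normr_le0; apply/ler_addgt0Pr => e e0.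
have e20 : 0 < e / 2 by rewrite divr_gt0.
have [d1 d10 H1] := flow_continuous_end x hmu hloc cmu hs ht e20.
have [d2 d20 H2] := flow_continuous_end y hmu hloc cmu hu ht e20.
pose d := Num.min d1 d2; have d0 : 0 < d by rewrite lt_min d10.
pose N := Num.truncn ((b - a) / d).
pose h := (u - s) / N.+1%:R.
have hd : `|h| <= d := uniform_step d0 hs hu (leqnn N).
have uE : s + N.+1%:R * h = u := uniform_end s u N.
have us0 : u - s != 0 by rewrite subr_eq0 eq_sym.
pose q := (t - s) / (u - s).
have q1 : 1 <= q.
  rewrite /q; case/orP: hb => /andP[h1 h2].
    have us : 0 < u - s by rewrite lt_neqAle eq_sym us0 subr_ge0.
    by rewrite ler_pdivlMr // mul1r lerD2r.
  have us : 0 < s - u by rewrite lt_neqAle eq_sym -opprB oppr_eq0 us0 opprB subr_ge0.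
  by rewrite -[t - s]opprB -[u - s]opprB invrN mulrNN ler_pdivlMr // mul1r lerD2l lerN2.
have q0 : 0 <= N.+1%:R * q by rewrite mulr_ge0 // (le_trans ler01).
have tE : t - s = N.+1%:R * q * h.
  have n0 : N.+1%:R != 0 :> R by rewrite pnatr_eq0.
  by rewrite /q /h; move: (N.+1%:R) n0 => n n0; field; rewrite us0 n0.
pose k := Num.truncn (N.+1%:R * q).
have /andP[k1 k2] := truncn_itv q0; rewrite -/k in k1 k2.
have Nk : (N.+1 <= k)%N.
  have : N.+1%:R < k.+1%:R :> R by apply: le_lt_trans k2; rewrite ler_peMr.
  by rewrite ltr_nat ltnS.
pose t' := s + k%:R * h.
have tt' : `|t' - t| <= d.
  have -> : t' - t = (k%:R - N.+1%:R * q) * h by rewrite /t' mulrBl -tE; ring.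
  rewrite normrM; apply: le_trans hd; rewrite ler_piMl //.
  rewrite -natr1 in k2; rewrite ler_norml; apply/andP; split; lra.
have ht' : a <= t' <= b.
  have kh0 : 0 <= k%:R :> R by [].
  move: tE k1 kh0 hs ht; rewrite /t'; move: (N.+1%:R * q) (k%:R) => q' k' tE k1 k0.
  move=> /andP[? ?] /andP[? ?].
  by case: (leP 0 h) => h0; apply/andP; split; nra.
have kE : k = (N.+1 + (k - N.+1))%N by rewrite subnKC.
have step : flow mu s t' x = flow mu u t' y.
  rewrite /t' kE /y -uE; apply: (flow_add_grid _ hmu hloc) => //.
  by rewrite -kE.
have -> : flow mu s t x - flow mu u t y = (flow mu s t x - flow mu s t' x)
   - (flow mu u t y - flow mu u t' y) by rewrite step; zmod.
apply: le_trans (ler_normB _ _) _; rewrite add0r.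
have d1' : `|t' - t| <= d1 by apply: le_trans tt' _; rewrite ge_min lexx.
have d2' : `|t' - t| <= d2 by apply: le_trans tt' _; rewrite ge_min lexx orbT.
by have := H1 _ ht' d1'; have := H2 _ ht' d2'; lra.
Qed.

Lemma flow_inv {R : realType} {V : completeNormedModType R}
    (a b al ga C : R) (mu : R -> R -> V -> V) s t x :
  sewable a b al ga C mu -> sewable_loc a b al ga mu ->
  continuous (fun p : R * R * V => mu p.1.1 p.1.2 p.2) ->
  (forall u v y, a <= u <= b -> a <= v <= b ->
     `|mu u v (mu v u y) - y| <= C * (1 + `|y|) * `|v - u| `^ ga) ->
  a <= s <= b -> a <= t <= b ->
  flow mu t s (flow mu s t x) = x.
Proof.
move=> hmu hloc cmu mu_back hs ht; have [al0 ga1 C0 _ mu_lip _] := hmu.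
have [K [d [K0 d0 HK]]] := flow_close hmu hloc.
have [G G1 HG] := flow_growth hmu hloc.
have G0 : 0 <= G := le_trans ler01 G1.
pose r := G * (1 + `|x|); have r0 : 0 <= r by rewrite mulr_ge0 // addr_ge0.
have inab u v w : a <= u <= b -> a <= w <= b -> (u <= v <= w) || (w <= v <= u) ->
    a <= v <= b.
  by move=> /andP[? ?] /andP[? ?] /orP[]/andP[? ?]; apply/andP; split; lra.
have Yr u : a <= u <= b -> `|flow mu s u x| <= r.
  by move=> hu; have := HG s u x hs hu; rewrite -/r; clear; lra.
pose E := C * (1 + r) + (1 + C * (b - a) `^ al) * (K * (1 + r)).
have E0 : 0 <= E.
  by rewrite addr_ge0 // mulr_ge0 // ?addr_ge0 // mulr_ge0 ?powR_ge0 // addr_ge0.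
have := @flow_unique R V a b al ga C mu (fun u => flow mu s u x) t s r E d
  hmu hloc ht hs E0 d0.
rewrite [flow mu s s x](flow_id _ hmu hloc) // => H; rewrite -H //.
- by move=> u hu; apply: Yr; exact: (inab t u s).
- move=> u v huv uvd.
  have hu : a <= u <= b.
    apply: (inab t u s) => //; case/orP: huv => /and3P[? ? ?]; apply/orP;
      [left|right]; apply/andP; split; lra.
  have hv : a <= v <= b.
    apply: (inab t v s) => //; case/orP: huv => /and3P[? ? ?]; apply/orP;
      [left|right]; apply/andP; split; lra.
  have hsvu : (s <= v <= u) || (u <= v <= s).
    by case/orP: huv => /and3P[? ? ?]; apply/orP; [right|left]; apply/andP; split; lra.
  rewrite [flow mu s u x](flow_add _ hmu hloc cmu hs hv hu hsvu).
  set y := flow mu s v x; have yr : `|y| <= r := Yr _ hv.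
  have H1 := mu_back u v y hu hv.
  have vud : `|u - v| <= d by rewrite distrC.
  have H2 := HK v u y hv hu vud; rewrite distrC in H2.
  have H3 := mu_lip u v (mu v u y) (flow mu v u y) hu hv.
  have vu : `|v - u| `^ al <= (b - a) `^ al.
    apply: le_powR; [exact: ltW|by []|].
    have := @grid_norm R a b u (v - u) 1 hu; rewrite !mul1r addrC subrK; exact.
  have -> : y - mu u v (flow mu v u y) = (mu u v (mu v u y) - mu u v (flow mu v u y)
    - (mu v u y - flow mu v u y)) + (mu v u y - flow mu v u y)
    - (mu u v (mu v u y) - y) by zmod.
  apply: le_trans (ler_normB _ _) _.
  apply: le_trans (lerD (ler_normD _ _) (lexx _)) _.
  rewrite [`|u - v|]distrC in H2.
  set P := `|v - u| `^ ga in H1 H2 *.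
  have P0 : 0 <= P by rewrite powR_ge0.
  have H1' : C * (1 + `|y|) * P <= C * (1 + r) * P.
    by rewrite ler_wpM2r // ler_wpM2l // lerD2l.
  have H2' : K * (1 + `|y|) * P <= K * (1 + r) * P.
    by rewrite ler_wpM2r // ler_wpM2l // lerD2l.
  set N := `|mu v u y - flow mu v u y| in H2 H3 *.
  have N0 : 0 <= N by exact: normr_ge0.
  have H4 : C * `|v - u| `^ al * N <= C * (b - a) `^ al * (K * (1 + r) * P).
    rewrite -!mulrA ler_wpM2l // ler_pM ?powR_ge0 // mulrA.
    exact: le_trans H2 H2'.
  have H5 := le_trans H2 H2'.
  rewrite /E; move: H1 H1' H3 H4 H5; clear; lra.
Qed.

Lemma flow_comp {R : realType} {V : completeNormedModType R}
    (a b al ga C : R) (mu : R -> R -> V -> V) s u t x :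
  sewable a b al ga C mu -> sewable_loc a b al ga mu ->
  continuous (fun p : R * R * V => mu p.1.1 p.1.2 p.2) ->
  (forall u v y, a <= u <= b -> a <= v <= b ->
     `|mu u v (mu v u y) - y| <= C * (1 + `|y|) * `|v - u| `^ ga) ->
  a <= s <= b -> a <= u <= b -> a <= t <= b ->
  flow mu u t (flow mu s u x) = flow mu s t x.
Proof.
move=> hmu hloc cmu mu_back hs hu ht.
have add p q w := flow_add w hmu hloc cmu p q.
have inv p q w := flow_inv w hmu hloc cmu mu_back p q.
have [h1|h1] := boolP ((s <= u <= t) || (t <= u <= s)).
  by rewrite -(flow_add x hmu hloc cmu hs hu ht).
have [h2|h2] := boolP ((s <= t <= u) || (u <= t <= s)).
  by rewrite (flow_add x hmu hloc cmu hs ht hu h2) (flow_inv _ hmu hloc cmu mu_back).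
have h3 : (u <= s <= t) || (t <= s <= u).
  by move: h1 h2; case: (leP s u) => ?; case: (leP u t) => ?; case: (leP s t) => ? /=;
    rewrite ?orbT ?orbF ?andbT //; lra.
by rewrite (flow_add _ hmu hloc cmu hu hs ht h3) (flow_inv _ hmu hloc cmu mu_back).
Qed.

Lemma flow_close_ball {R : realType} {V : completeNormedModType R} (a b al ga C : R)
    (mu : R -> R -> V -> V) (r : R) :
  sewable a b al ga C mu -> sewable_loc a b al ga mu -> 0 <= r ->
  exists2 K : R, 0 <= K & forall s t x, a <= s <= b -> a <= t <= b -> `|x| <= r ->
    `|flow mu s t x - mu s t x| <= K * `|t - s| `^ ga.
Proof.
move=> hmu hloc r0; have [K [d [K0 d0 HK]]] := flow_close hmu hloc.
have [G G1 HG] := flow_growth hmu hloc.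
have [al0 ga1 C0 mu_close _ _] := hmu.
have G0 : 0 <= G := le_trans ler01 G1.
pose B := G * (1 + r) + (r + C * (1 + r) * (b - a) `^ al).
have B0 : 0 <= B.
  by rewrite !addr_ge0 // mulr_ge0 ?addr_ge0 ?powR_ge0 // mulr_ge0 // addr_ge0.
have dga : 0 < d `^ ga by rewrite powR_gt0.
exists (K * (1 + r) + B / d `^ ga).
  by apply: addr_ge0; [rewrite mulr_ge0 // addr_ge0 | rewrite divr_ge0 // ltW].
move=> s t x hs ht xr; have P0 := powR_ge0 `|t - s| ga.
have [td|dt] := leP `|t - s| d.
  apply: le_trans (HK s t x hs ht td) _.
  rewrite ler_wpM2r //; apply: (@le_trans _ _ (K * (1 + r))).
    by rewrite ler_wpM2l // lerD2l.
  by rewrite lerDl divr_ge0 // ltW.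
apply: (@le_trans _ _ B).
  have := HG s t x hs ht; have := mu_close s t x hs ht.
  have ts : `|t - s| `^ al <= (b - a) `^ al.
    apply: le_powR; [exact: ltW|by []|].
    have := @grid_norm R a b s (t - s) 1 hs; rewrite !mul1r addrC subrK; exact.
  have h1 : C * (1 + `|x|) * `|t - s| `^ al <= C * (1 + r) * (b - a) `^ al.
    by rewrite ler_pM ?powR_ge0 // ?mulr_ge0 ?addr_ge0 // ler_wpM2l // lerD2l.
  have h2 : G * (1 + `|x|) <= G * (1 + r) by rewrite ler_wpM2l // lerD2l.
  move=> h3 h4.
  have -> : flow mu s t x - mu s t x = flow mu s t x - x - (mu s t x - x) by zmod.
  apply: le_trans (ler_normB _ _) _.
  apply: le_trans (lerD (ler_normB _ _) (lexx _)) _.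
  by rewrite /B; move: h1 h2 h3 h4 xr; clear; lra.
rewrite mulrDl ler_wpDl // ?mulr_ge0 ?addr_ge0 //.
rewrite mulrAC ler_pdivlMr // ler_wpM2l // le_powR ?ltW //; lra.
Qed.

(** * Vector fields *)

Section MatrixNorm.
Context {R : realType}.

Lemma mx_norm_entry {m n : nat} (A : 'M[R]_(m, n)) i j : `|A i j| <= `|A|.
Proof.
rewrite [leRHS]/Num.Def.normr /= mx_normrE.
exact: (le_bigmax _ (fun ij => `|A ij.1 ij.2|) (i, j)).
Qed.

Lemma mx_norm_le {m n : nat} (A : 'M[R]_(m, n)) c : 0 <= c ->
  (forall i j, `|A i j| <= c) -> `|A| <= c.
Proof.
move=> c0 H; rewrite [leLHS]/Num.Def.normr /= mx_normrE.
by apply: bigmax_le => // -[i j] _ /=.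
Qed.

Lemma mulmx_norm {m n p : nat} (A : 'M[R]_(m, n)) (B : 'M[R]_(n, p)) :
  `|A *m B| <= n%:R * `|A| * `|B|.
Proof.
apply: mx_norm_le => [|i j]; first by rewrite !mulr_ge0.
rewrite mxE; apply: le_trans (ler_norm_sum _ _ _) _.
apply: le_trans (_ : \sum_(k < n) `|A| * `|B| <= _).
  by apply: ler_sum => k _; rewrite normrM ler_pM // mx_norm_entry.
by rewrite sumr_const card_ord -[X in X <= _]mulr_natl mulrA.
Qed.

Lemma mean_value_ineq {m n : nat} (f df : R -> 'M[R]_(m, n)) (c : R) :
  (forall r, is_derive (r : R) (1 : R) f (df r)) ->
  (forall r, 0 <= r <= 1 -> `|df r| <= c) -> `|f 1 - f 0| <= c.
Proof.
move=> hf hc.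
have h0 : 0 <= (0 : R) <= 1 by rewrite lexx ler01.
have c0 : 0 <= c := le_trans (normr_ge0 _) (hc _ h0).
apply: mx_norm_le => // i j.
have hij r : is_derive (r : R) (1 : R) (fun r => f r i j : R) (df r i j).
  have dr : derivable f r 1 by apply: ex_derive; exact: hf.
  apply: DeriveDef; first by have /derivable_mxP := dr; apply.
  have := @derive_mx R R m n f r 1 dr.
  rewrite (@derive_val _ _ _ _ _ _ _ (hf r)) => /matrixP/(_ i j).
  by rewrite mxE => <-.
have cij : {within `[0, 1], continuous (fun r => f r i j : R)}.
  apply: continuous_subspaceT => r.
  apply: differentiable_continuous; apply/derivable1_diffP.
  exact: ex_derive.
have [r r01] := @MVT_segment R _ _ 0 1 ler01 (fun r _ => hij r) cij.
rewrite subr0 mulr1 !mxE => ->; apply: le_trans (mx_norm_entry _ _ _) _.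
by apply: hc; rewrite in_itv in r01.
Qed.

Lemma is_derive_line {U V : normedModType R} (f : U -> V) (x v : U) (r : R) :
  differentiable f (x + r *: v) ->
  is_derive (r : R) (1 : R) (fun r : R => f (x + r *: v)) ('d f (x + r *: v) v).
Proof.
move=> df.
have dl : is_diff (r : R) (fun r : R => x + r *: v) (fun r : R => r *: v).
  rewrite -[X in is_diff _ _ X]add0r.
  exact: (@is_diffD R R U (cst x) (fun r => r *: v) (cst 0) (fun r => r *: v) r).
have dc := @is_diff_comp R R U V (fun r : R => x + r *: v) (fun r : R => r *: v)
  f ('d f (x + r *: v)) r dl (differentiableP df).
apply: DeriveDef; first exact/diff_derivable.
by rewrite deriveE // diff_val /= scale1r.
Qed.

Lemma is_derive_scale {V : normedModType R} (A : V) (r : R) :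
  is_derive (r : R) (1 : R) (fun r : R => r *: A) A.
Proof.
by apply: DeriveDef; [exact/diff_derivable | rewrite deriveE // diff_val scale1r].
Qed.

Lemma lipschitz_of_diff {U : normedModType R} {m n : nat} (f : U -> 'M[R]_(m, n))
    (c : R) : (forall z, differentiable f z) ->
  (forall z v, `|'d f z v| <= c * `|v|) ->
  forall x y, `|f x - f y| <= c * `|x - y|.
Proof.
move=> df hc x y.
have := @mean_value_ineq m n (fun r => f (y + r *: (x - y)))
  (fun r => 'd f (y + r *: (x - y)) (x - y)) (c * `|x - y|)
  (fun r => @is_derive_line _ _ f y (x - y) r (df _)) (fun r _ => hc _ _).
by rewrite scale1r scale0r addr0 [y + (x - y)](_ : _ = x) //; zmod.
Qed.

Lemma second_difference {U : normedModType R} {m n : nat} (f : U -> 'M[R]_(m, n))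
    (c : R) : (forall z, differentiable f z) ->
  (forall v z, differentiable (fun z => 'd f z v) z) ->
  (forall v w z, `|'d (fun z => 'd f z v) z w| <= c * `|w| * `|v|) ->
  forall x y e, `|f (x + e) - f x - (f (y + e) - f y)| <= c * `|e| * `|x - y|.
Proof.
move=> df ddf hc x y e.
have lip v z w : `|'d f z v - 'd f w v| <= c * `|v| * `|z - w|.
  apply: (@lipschitz_of_diff U m n (fun z => 'd f z v)) => [z'|z' w'].
    exact: ddf.
  by apply: le_trans (hc _ _ _) _; rewrite mulrAC.
have := @mean_value_ineq m n
  (fun r => f (y + e + r *: (x - y)) - f (y + r *: (x - y)))
  (fun r => 'd f (y + e + r *: (x - y)) (x - y) - 'd f (y + r *: (x - y)) (x - y))
  (c * `|e| * `|x - y|).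
rewrite !scale1r !scale0r !addr0 [y + e + (x - y)](_ : _ = x + e); last by zmod.
rewrite [y + (x - y)](_ : _ = x); last by zmod.
apply=> r; first by apply: is_deriveB; exact: is_derive_line.
move=> _; apply: le_trans (lip _ _ _) _.
by rewrite [y + e + _ - _](_ : _ = e); [rewrite mulrAC | zmod].
Qed.

End MatrixNorm.

Lemma sub_subC {V : zmodType} (p q u v : V) : p - q - (u - v) = p - u - (q - v).
Proof. by zmod. Qed.

Lemma sub_sub_subC {V : zmodType} (p q u v x y : V) :
  p - q - (x - y) - (u - v) = (p - u - x) - (q - v - y).
Proof. by zmod. Qed.

Lemma sub_sub_subK {V : zmodType} (p q u x y : V) :
  p - (x - y) - q = (p - u - x) - (q - u - y).
Proof. by zmod. Qed.

Section SmoothMap.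
Context {R : realType} {D : nat} {m n : nat}.
Implicit Types (f : 'cV[R]_D -> 'M[R]_(m, n)) (x y z v w u e g : 'cV[R]_D).

Record C3_bounded f (c : R) : Prop := C3Bounded {
  c3_ge0 : 0 <= c;
  c3_diff : forall z, differentiable f z;
  c3_diff2 : forall v z, differentiable (fun z => 'd f z v) z;
  c3_diff3 : forall v w z,
    differentiable (fun z => 'd (fun z => 'd f z v) z w) z;
  c3_bound1 : forall z v, `|'d f z v| <= c * `|v|;
  c3_bound2 : forall v w z, `|'d (fun z => 'd f z v) z w| <= c * `|w| * `|v|;
  c3_bound3 : forall v w u z,
    `|'d (fun z => 'd (fun z => 'd f z v) z w) z u| <= c * `|u| * `|w| * `|v| }.

Lemma C_b3_bounded f : C_b 3 f -> exists c, C3_bounded f c.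
Proof.
move=> [[df _] bf].
have [c1 h1] := bf 1%N isT; have [c2 h2] := bf 2%N isT; have [c3 h3] := bf 3%N isT.
pose c := `|c1| + `|c2| + `|c3|.
have le1 : c1 <= c by rewrite (le_trans (ler_norm _)) // /c -addrA lerDl addr_ge0.
have le2 : c2 <= c by rewrite (le_trans (ler_norm _)) // /c addrAC lerDr addr_ge0.
have le3 : c3 <= c by rewrite (le_trans (ler_norm _)) // /c lerDr addr_ge0.
exists c; split.
- by rewrite !addr_ge0.
- exact: (df [::]).
- by move=> v; exact: (df [:: v]).
- by move=> v w; exact: (df [:: w; v]).
- move=> z v; have := h1 [:: v] z erefl; rewrite big_seq1 => /le_trans; apply.
  by rewrite ler_wpM2r.
- move=> v w z; have := h2 [:: w; v] z erefl.
  rewrite big_cons big_seq1 mulrA => /le_trans; apply.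
  by rewrite !ler_wpM2r.
- move=> v w u z; have := h3 [:: u; w; v] z erefl.
  rewrite !big_cons big_nil mulr1 !mulrA => /le_trans; apply.
  by rewrite !ler_wpM2r.
Qed.

Lemma c3_lip f c x y : C3_bounded f c -> `|f x - f y| <= c * `|x - y|.
Proof. by case=> *; apply: lipschitz_of_diff. Qed.

Lemma c3_growth f c x : C3_bounded f c -> `|f x| <= (c + `|f 0|) * (1 + `|x|).
Proof.
move=> hf; have := c3_lip x 0 hf; rewrite subr0 => h.
have := ler_normD (f x - f 0) (f 0); rewrite subrK.
have c0 := c3_ge0 hf; have : 0 <= `|f 0| * `|x| by rewrite mulr_ge0.
by move: h c0; clear; lra.
Qed.

Lemma c3_second f c x y e : C3_bounded f c ->
  `|f (x + e) - f x - (f (y + e) - f y)| <= c * `|e| * `|x - y|.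
Proof. by case=> *; apply: second_difference. Qed.

Lemma c3_diff_lip f c x y v : C3_bounded f c ->
  `|'d f x v - 'd f y v| <= c * `|x - y| * `|v|.
Proof.
case=> c0 _ df2 _ _ b2 _; rewrite mulrAC.
apply: (@lipschitz_of_diff R _ m n (fun z => 'd f z v)) => // z w.
by rewrite mulrAC.
Qed.

Lemma c3_diff_second f c x y v e : C3_bounded f c ->
  `|'d f (x + e) v - 'd f x v - ('d f (y + e) v - 'd f y v)|
    <= c * `|v| * `|e| * `|x - y|.
Proof.
case=> c0 _ df2 df3 _ _ b3.
have hb w u z : `|'d (fun z => 'd (fun z => 'd f z v) z w) z u|
    <= c * `|v| * `|u| * `|w|.
  by apply: le_trans (b3 v w u z) _; rewrite -!mulrA ler_wpM2l // mulrA mulrC.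
exact: (@second_difference R _ m n (fun z => 'd f z v) (c * `|v|) (df2 v) (df3 v) hb).
Qed.

Definition taylor2 f x g := f (x + g) - f x - 'd f x g.

Lemma taylor2_lip_base f c x y g : C3_bounded f c ->
  `|taylor2 f x g - taylor2 f y g| <= c * `|g| ^+ 2 * `|x - y|.
Proof.
move=> hf; have df := c3_diff hf; have c0 := c3_ge0 hf.
have := @mean_value_ineq R m n
  (fun r => f (x + r *: g) - f (y + r *: g) - r *: ('d f x g - 'd f y g))
  (fun r => 'd f (x + r *: g) g - 'd f (y + r *: g) g - ('d f x g - 'd f y g))
  (c * `|g| ^+ 2 * `|x - y|).
rewrite !scale1r !scale0r !addr0 subr0.
rewrite [X in `|X| <= _](_ : _ = taylor2 f x g - taylor2 f y g); last first.
  exact: sub_sub_subC.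
apply=> r.
  apply: is_deriveB; last exact: is_derive_scale.
  by apply: is_deriveB; exact: is_derive_line.
move=> /andP[r0 r1].
rewrite [X in `|X|](_ : _ = 'd f (x + r *: g) g - 'd f x g
  - ('d f (y + r *: g) g - 'd f y g)); last first.
  exact: sub_subC.
apply: le_trans (c3_diff_second _ _ _ _ hf) _.
rewrite ler_wpM2r // expr2 mulrA ler_wpM2l ?mulr_ge0 //.
by rewrite normrZ ger0_norm // ler_piMl.
Qed.

Lemma taylor2_lip f c x g g' : C3_bounded f c ->
  `|taylor2 f x g - taylor2 f x g'| <= c * `|g - g'| * (`|g| + `|g'|).
Proof.
move=> hf; have df := c3_diff hf; have c0 := c3_ge0 hf.
pose p := x + g'; pose q := g - g'.
have := @mean_value_ineq R m n
  (fun r => f (p + r *: q) - r *: 'd f x q)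
  (fun r => 'd f (p + r *: q) q - 'd f x q)
  (c * `|g - g'| * (`|g| + `|g'|)).
rewrite !scale1r !scale0r !addr0 subr0.
rewrite [X in `|X| <= _](_ : _ = taylor2 f x g - taylor2 f x g'); last first.
  have -> : 'd f x q = 'd f x g - 'd f x g' by rewrite /q linearB.
  have -> : p + q = x + g by rewrite /p /q; zmod.
  exact: sub_sub_subK.
apply=> r; first by apply: is_deriveB; [exact: is_derive_line|exact: is_derive_scale].
move=> /andP[r0 r1]; apply: le_trans (c3_diff_lip _ _ _ hf) _.
rewrite -/q mulrAC ler_wpM2l ?mulr_ge0 //.
have -> : p + r *: q - x = r *: g + (1 - r) *: g'.
  by rewrite /p /q scalerBr scalerBl scale1r; zmod.
apply: le_trans (ler_normD _ _) _; rewrite !normrZ !ger0_norm ?subr_ge0 //.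
by rewrite lerD // ler_piMl //; rewrite lerBlDr lerDl.
Qed.

Lemma differentiable_mx f x :
  (forall i j, differentiable (fun z => f z i j : R) x) -> differentiable f x.
Proof.
move=> hf.
have -> : f = \sum_(i < m) \sum_(j < n) (fun z => f z i j *: delta_mx i j).
  apply/funext => z; rewrite fct_sumE {1}(matrix_sum_delta (f z)).
  by apply: eq_bigr => i _; rewrite fct_sumE.
apply: differentiable_sum => i; apply: differentiable_sum => j.
exact: differentiableZl.
Qed.

Lemma differentiable_entry f x i j :
  differentiable f x -> differentiable (fun z => f z i j : R) x.
Proof.
move=> df; apply: (@differentiable_comp _ _ _ _ f (fun N : 'M[R]_(m, n) => N i j : R)) => //.
exact: differentiable_coord.
Qed.

End SmoothMap.

Section SecondDifference.
Context {R : realType} {U : normedModType R}.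

Record loc_C11 {V : normedModType R} (f : U -> V) (r c : R) : Prop := LocC11 {
  lc_ge0 : 0 <= c;
  lc_bound : forall x, `|x| <= r -> `|f x| <= c;
  lc_lip : forall x y, `|x| <= r -> `|y| <= r -> `|f x - f y| <= c * `|x - y|;
  lc_second : forall x y e, `|x| <= r -> `|y| <= r -> `|x + e| <= r -> `|y + e| <= r ->
    `|f (x + e) - f x - (f (y + e) - f y)| <= c * `|e| * `|x - y| }.

Lemma loc_C11_scale {V : normedModType R} (k : U -> R) (f : U -> V) (r c1 c2 : R) :
  loc_C11 k r c1 -> loc_C11 f r c2 -> loc_C11 (fun z => k z *: f z) r (4 * c1 * c2).
Proof.
move=> [c10 b1 l1 s1] [c20 b2 l2 s2]; split.
- by rewrite !mulr_ge0.
- move=> x xr; rewrite normrZ; apply: le_trans (_ : c1 * c2 <= _).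
    by rewrite ler_pM ?b1 ?b2.
  by have := mulr_ge0 c10 c20; clear; lra.
- move=> x y xr yr.
  have -> : k x *: f x - k y *: f y = (k x - k y) *: f x + k y *: (f x - f y).
    by rewrite scalerBl scalerBr; zmod.
  apply: le_trans (ler_normD _ _) _; rewrite !normrZ.
  have h1 : `|k x - k y| * `|f x| <= c1 * `|x - y| * c2 by rewrite ler_pM ?b2 ?l1.
  have h2 : `|k y| * `|f x - f y| <= c1 * (c2 * `|x - y|) by rewrite ler_pM ?b1 ?l2.
  have := mulr_ge0 (mulr_ge0 c10 c20) (normr_ge0 (x - y)).
  by move: h1 h2; clear; lra.
- move=> x y e xr yr xer yer.
  have -> : k (x + e) *: f (x + e) - k x *: f x - (k (y + e) *: f (y + e) - k y *: f y)
    = (k (x + e) - k x - (k (y + e) - k y)) *: f (x + e)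
    + (k (y + e) - k y) *: (f (x + e) - f (y + e))
    + (k x - k y) *: (f (x + e) - f x)
    + k y *: (f (x + e) - f x - (f (y + e) - f y)).
    by rewrite !(scalerBl, scalerBr); zmod.
  apply: le_trans (ler_normD _ _) _.
  apply: le_trans (lerD (ler_normD _ _) (lexx _)) _.
  apply: le_trans (lerD (lerD (ler_normD _ _) (lexx _)) (lexx _)) _.
  rewrite !normrZ.
  have exy : x + e - (y + e) = x - y by zmod.
  have h1 : `|k (x + e) - k x - (k (y + e) - k y)| * `|f (x + e)|
     <= c1 * `|e| * `|x - y| * c2 by rewrite ler_pM ?b2 ?s1.
  have h2 : `|k (y + e) - k y| * `|f (x + e) - f (y + e)|
     <= c1 * `|e| * (c2 * `|x - y|).
    rewrite ler_pM //; first by have := l1 _ _ yer yr; rewrite [y + e - y](_ : _ = e) //; zmod.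
    by have := l2 _ _ xer yer; rewrite exy.
  have h3 : `|k x - k y| * `|f (x + e) - f x| <= c1 * `|x - y| * (c2 * `|e|).
    rewrite ler_pM ?l1 //.
    by have := l2 _ _ xer xr; rewrite [x + e - x](_ : _ = e) //; zmod.
  have h4 : `|k y| * `|f (x + e) - f x - (f (y + e) - f y)|
     <= c1 * (c2 * `|e| * `|x - y|) by rewrite ler_pM ?b1 ?s2.
  by move: h1 h2 h3 h4; clear; lra.
Qed.

Lemma loc_C11_cst0 {V : normedModType R} (r : R) : loc_C11 (fun=> 0 : V) r 0.
Proof.
by split=> [|x _|x y _ _|x y e _ _ _ _] //; rewrite ?normr0 ?subrr ?normr0 ?mul0r.
Qed.

Lemma loc_C11_add {V : normedModType R} (f g : U -> V) (r c1 c2 : R) :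
  loc_C11 f r c1 -> loc_C11 g r c2 -> loc_C11 (fun z => f z + g z) r (c1 + c2).
Proof.
move=> [c10 b1 l1 s1] [c20 b2 l2 s2]; split.
- by rewrite addr_ge0.
- by move=> x xr; apply: le_trans (ler_normD _ _) _; rewrite lerD ?b1 ?b2.
- move=> x y xr yr; rewrite [_ - _](_ : _ = f x - f y + (g x - g y)); last by zmod.
  by apply: le_trans (ler_normD _ _) _; rewrite mulrDl lerD ?l1 ?l2.
- move=> x y e xr yr xer yer.
  rewrite [X in `|X|](_ : _ = f (x + e) - f x - (f (y + e) - f y)
    + (g (x + e) - g x - (g (y + e) - g y))); last by zmod.
  by apply: le_trans (ler_normD _ _) _; rewrite !mulrDl lerD ?s1 ?s2.
Qed.

Lemma loc_C11_sum {V : normedModType R} (r : R) (k : nat) (f : 'I_k -> U -> V) :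
  (forall i, exists c, loc_C11 (f i) r c) ->
  exists c, loc_C11 (fun z => \sum_(i < k) f i z) r c.
Proof.
elim: k f => [|k ih] f hf.
  exists 0; rewrite (_ : (fun z => _) = fun=> 0); first exact: loc_C11_cst0.
  by apply/funext => z; rewrite big_ord0.
have [c hc] := ih (fun i => f (widen_ord (leqnSn k) i)) (fun i => hf _).
have [c' hc'] := hf ord_max.
exists (c + c'); rewrite (_ : (fun z => _) = (fun z =>
   (\sum_(i < k) f (widen_ord (leqnSn k) i) z) + f ord_max z)).
  exact: loc_C11_add.
by apply/funext => z; rewrite big_ord_recr.
Qed.

End SecondDifference.

Section VectorFields.
Context {R : realType} {D M : nat}.
Implicit Types (G : 'cV[R]_D -> 'M[R]_(D, M)) (x y z e : 'cV[R]_D) (w v : 'cV[R]_M).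

Definition dirfield G (i : 'I_M) z : 'M[R]_(D, M) := 'd G z (G z *m delta_mx i 0).

Definition tens (K : 'I_M -> 'M[R]_(D, M)) (A : 'M[R]_M) : 'cV[R]_D :=
  \sum_(i < M) \sum_(j < M) A i j *: (K i *m delta_mx j 0).

Lemma cV_delta (n : nat) (u : 'cV[R]_n) : u = \sum_(i < n) u i 0 *: delta_mx i 0.
Proof.
by rewrite {1}(matrix_sum_delta u); apply: eq_bigr => i _; rewrite big_ord1.
Qed.

Lemma linear_cV (n : nat) (V : lmodType R) (L : {linear 'cV[R]_n -> V}) u :
  L u = \sum_(k < n) u k 0 *: L (delta_mx k 0).
Proof.
rewrite [in LHS](cV_delta u) linear_sum; apply: eq_bigr => k _; exact: linearZ.
Qed.

Lemma linear_sub_subC (U V : lmodType R) (L : {linear U -> V}) u u1 u2 p :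
  u = u1 - u2 -> L u - p = L u1 - p - L u2.
Proof. by move=> ->; rewrite linearB addrAC. Qed.

Lemma delta_norm (n : nat) (i : 'I_n) : `|delta_mx i 0 : 'cV[R]_n| <= 1.
Proof.
by apply: mx_norm_le => // k l; rewrite mxE; case: (_ && _); rewrite ?normr1 ?normr0.
Qed.

Lemma dirfieldE G z w : 'd G z (G z *m w) = \sum_(i < M) w i 0 *: dirfield G i z.
Proof.
rewrite {1}(cV_delta w) mulmx_sumr linear_sum; apply: eq_bigr => i _.
by rewrite -scalemxAr linearZ.
Qed.

Lemma tensB K K' A : tens K A - tens K' A = tens (fun i => K i - K' i) A.
Proof.
rewrite /tens -sumrB; apply: eq_bigr => i _; rewrite -sumrB; apply: eq_bigr => j _.
by rewrite mulmxBl scalerBr.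
Qed.

Lemma tens_norm K A (k : R) : 0 <= k -> (forall i, `|K i| <= k) ->
  `|tens K A| <= M%:R ^+ 3 * k * `|A|.
Proof.
move=> k0 hK; rewrite /tens; apply: le_trans (ler_norm_sum _ _ _) _.
apply: (@le_trans _ _ (\sum_(i < M) \sum_(j < M) `|A| * (M%:R * k))).
  apply: ler_sum => i _; apply: le_trans (ler_norm_sum _ _ _) _.
  apply: ler_sum => j _; rewrite normrZ; apply: ler_pM => //; first exact: mx_norm_entry.
  apply: le_trans (mulmx_norm _ _) _; rewrite -mulrA ler_wpM2l //.
  rewrite -[leRHS]mulr1; apply: ler_pM => //; exact: delta_norm.
rewrite sumr_const sumr_const !card_ord -mulrnA -[X in X <= _]mulr_natr natrM.
by apply: le_of_eq; ring.
Qed.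

Lemma differentiable_dirfield G c v x : C3_bounded G c ->
  differentiable (fun z => 'd G z (G z *m v)) x.
Proof.
move=> hG; apply: differentiable_mx => p q.
have -> : (fun z => ('d G z (G z *m v)) p q : R) = \sum_(k < D)
    ((fun z => (G z *m v) k 0 : R) * (fun z => ('d G z (delta_mx k 0)) p q : R)).
  apply/funext => z; rewrite fct_sumE.
  have /matrixP/(_ p q) := linear_cV ('d G z) (G z *m v).
  rewrite summxE => e; apply: etrans e _; apply: eq_bigr => k _.
  by rewrite [LHS]mxE.
apply: differentiable_sum => k; apply: differentiableM.
  have -> : (fun z => (G z *m v) k 0 : R) = \sum_(j < M)
      ((fun z => G z k j : R) * (fun=> v j 0)).
    by apply/funext => z; rewrite fct_sumE mxE.
  apply: differentiable_sum => j; apply: differentiableM; last exact: differentiable_cst.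
  by apply: differentiable_entry; exact: c3_diff hG _.
by apply: differentiable_entry; exact: c3_diff2 hG _ _.
Qed.

Lemma dirfield_lip G c : C3_bounded G c -> DGG_bounded_derivative G ->
  exists2 c', 0 <= c' & forall v x y,
    `|'d G x (G x *m v) - 'd G y (G y *m v)| <= c' * `|x - y| * `|v|.
Proof.
move=> hG [C hC]; exists `|C| => // v x y; rewrite mulrAC.
have hd z u : `|'d (fun z => 'd G z (G z *m v)) z u| <= `|C| * `|v| * `|u|.
  apply: le_trans (hC z u v) _; rewrite mulrAC.
  by rewrite ler_wpM2r // ler_wpM2r // ler_norm.
exact: (@lipschitz_of_diff R _ D M (fun z => 'd G z (G z *m v)) (`|C| * `|v|)
  (fun z => differentiable_dirfield v z hG) hd).
Qed.

(* Along [r |-> x + r G(x) w] the derivative of [G] differs from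
   [DG(x) G(x) w] by the increment of the field [DG G], which is globally
   Lipschitz, and by [DG] applied to an increment of [G]: this is why the error
   is only linear in [x] although [G] is unbounded. *)
Lemma dirfield_taylor G c : C3_bounded G c -> DGG_bounded_derivative G ->
  exists2 k, 0 <= k & forall x w,
    `|G (x + G x *m w) - G x - 'd G x (G x *m w)| <= k * (1 + `|x|) * `|w| ^+ 2.
Proof.
move=> hG hDGG; have [c' c'0 hF] := dirfield_lip hG hDGG.
have c0 := c3_ge0 hG; have df := c3_diff hG.
pose g := c + `|G 0|; have g0 : 0 <= g by rewrite addr_ge0.
exists ((c' + c * M%:R * c) * (M%:R * g)).
  by rewrite mulr_ge0 ?addr_ge0 // !mulr_ge0.
move=> x w; set h := G x *m w.
have hh : `|h| <= M%:R * g * (1 + `|x|) * `|w|.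
  apply: le_trans (mulmx_norm _ _) _; rewrite ler_wpM2r // -mulrA ler_wpM2l //.
  exact: c3_growth.
have := @mean_value_ineq R D M (fun r => G (x + r *: h) - r *: 'd G x h)
  (fun r => 'd G (x + r *: h) h - 'd G x h)
  ((c' + c * M%:R * c) * (M%:R * g) * (1 + `|x|) * `|w| ^+ 2).
rewrite !scale1r !scale0r !addr0 subr0 [_ - _ - 'd G x h]addrAC; apply.
  by move=> r; apply: is_deriveB; [exact: is_derive_line|exact: is_derive_scale].
move=> r /andP[r0 r1]; set y := x + r *: h.
have hE : h = G y *m w - (G y - G x) *m w by rewrite mulmxBl opprB addrC subrK.
have yx : `|y - x| <= `|h|.
  by rewrite /y addrAC subrr add0r normrZ ger0_norm // ler_piMl.
have -> : 'd G y h - 'd G x h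
    = 'd G y (G y *m w) - 'd G x (G x *m w) - 'd G y ((G y - G x) *m w).
  exact: (linear_sub_subC ('d G y) _ hE).
apply: le_trans (ler_normB _ _) _.
have n1 := hF w y x.
have n2 := c3_bound1 hG y ((G y - G x) *m w).
have n3 := mulmx_norm (G y - G x) w.
have n4 := c3_lip y x hG.
move: (normr_ge0 w) n1 n2 n3 n4.
move: (`|'d G y (G y *m w) - 'd G x (G x *m w)|) => N1.
move: (`|'d G y ((G y - G x) *m w)|) => N2.
move: (`|(G y - G x) *m w|) (`|G y - G x|) (`|w|) hh => N3 N4 W hh W0 n1 n2 n3 n4.
have X0 : 0 <= 1 + `|x| by rewrite addr_ge0.
have m1 : N1 <= c' * (M%:R * g * (1 + `|x|) * W) * W.
  apply: le_trans n1 _; rewrite ler_wpM2r // ler_wpM2l //; exact: le_trans yx hh.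
have m2 : N2 <= c * (M%:R * (c * (M%:R * g * (1 + `|x|) * W)) * W).
  apply: le_trans n2 _; rewrite ler_wpM2l //; apply: le_trans n3 _.
  rewrite ler_wpM2r // ler_wpM2l //; apply: le_trans n4 _.
  by rewrite ler_wpM2l //; exact: le_trans yx hh.
apply: le_trans (lerD m1 m2) _; apply: le_of_eq; ring.
Qed.

Lemma loc_C11_dirfield G c i (r : R) : C3_bounded G c -> 0 <= r ->
  exists k, loc_C11 (dirfield G i) r k.
Proof.
move=> hG r0; have c0 := c3_ge0 hG.
have -> : dirfield G i = fun z => \sum_(k < D) (G z k i *: 'd G z (delta_mx k 0)).
  apply/funext => z; rewrite /dirfield (linear_cV ('d G z) (G z *m _)).
  apply: eq_bigr => k _; congr (_ *: _).
  rewrite mxE (bigD1 i) //= mxE !eqxx mulr1 big1 ?addr0 // => j ji.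
  by rewrite mxE (negbTE ji) mulr0.
apply: (@loc_C11_sum R _ _ r D (fun k z => G z k i *: 'd G z (delta_mx k 0))) => k.
have entryB (A B : 'M[R]_(D, M)) : A k i - B k i = (A - B) k i by rewrite !mxE.
pose g := (c + `|G 0|) * (1 + r) + c.
have g0 : 0 <= g by rewrite !addr_ge0 // mulr_ge0 ?addr_ge0.
have cg : c <= g by rewrite lerDr mulr_ge0 ?addr_ge0.
have h1 : loc_C11 (fun z => G z k i : R) r g.
  split=> // [x xr|x y _ _|x y e _ _ _ _].
  - apply: le_trans (mx_norm_entry _ _ _) _; apply: le_trans (c3_growth x hG) _.
    by rewrite -[leLHS]addr0 lerD // ler_wpM2l ?addr_ge0 // lerD2l.
  - rewrite entryB; apply: le_trans (mx_norm_entry _ _ _) _.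
    by apply: le_trans (c3_lip x y hG) _; rewrite ler_wpM2r.
  - rewrite !entryB; apply: le_trans (mx_norm_entry _ _ _) _.
    apply: le_trans (c3_second x y e hG) _.
    by rewrite ler_wpM2r // ler_wpM2r.
have d1 := delta_norm k.
have h2 : loc_C11 (fun z => 'd G z (delta_mx k 0)) r c.
  split=> // [x xr|x y _ _|x y e _ _ _ _].
  - by apply: le_trans (c3_bound1 hG x _) _; rewrite -[leRHS]mulr1 ler_wpM2l.
  - apply: le_trans (c3_diff_lip x y _ hG) _.
    by rewrite -[leRHS]mulr1 ler_wpM2l // mulr_ge0.
  - apply: le_trans (c3_diff_second x y _ e hG) _.
    rewrite ler_wpM2r // ler_wpM2r // -[leRHS]mulr1 ler_wpM2l //.
by exists (4 * g * c); exact: loc_C11_scale h1 h2.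
Qed.

Definition mil G z (A : 'M[R]_M) : 'cV[R]_D := tens (fun i => dirfield G i z) A.

Lemma mil_tensor G z w v : mil G z (tensor w v) = 'd G z (G z *m w) *m v.
Proof.
rewrite dirfieldE mulmx_suml; apply: eq_bigr => i _.
rewrite {2}(cV_delta v) mulmx_sumr; apply: eq_bigr => j _.
by rewrite -scalemxAl -scalemxAr scalerA /tensor !mxE big_ord1 !mxE.
Qed.

Lemma milD G z A B : mil G z (A + B) = mil G z A + mil G z B.
Proof.
rewrite /mil /tens -big_split /=; apply: eq_bigr => i _.
by rewrite -big_split /=; apply: eq_bigr => j _; rewrite mxE scalerDl.
Qed.

Lemma mil0 G z : mil G z 0 = 0.
Proof.
by rewrite /mil /tens; apply: big1 => i _; apply: big1 => j _; rewrite mxE scale0r.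
Qed.

Record field_bounds (G0 : 'cV[R]_D -> 'cV[R]_D) G (c : R) : Prop := FieldBounds {
  fb_ge0 : 0 <= c;
  fb_G : C3_bounded G c;
  fb_G0 : C3_bounded G0 c;
  fb_growth : forall x, `|G x| <= c * (1 + `|x|);
  fb_growth0 : forall x, `|G0 x| <= c * (1 + `|x|);
  fb_mil_growth : forall x A, `|mil G x A| <= c * (1 + `|x|) * `|A|;
  fb_mil_lip : forall x y A, `|mil G x A - mil G y A| <= c * `|x - y| * `|A|;
  fb_taylor : forall x w,
    `|G (x + G x *m w) - G x - 'd G x (G x *m w)| <= c * (1 + `|x|) * `|w| ^+ 2;
  fb_mul : forall (A : 'M[R]_(D, M)) w, `|A *m w| <= c * `|A| * `|w|;
  fb_mil_second : forall r, 0 <= r -> exists2 k, 0 <= k &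
    forall x y e A, `|x| <= r -> `|y| <= r -> `|x + e| <= r -> `|y + e| <= r ->
    `|mil G (x + e) A - mil G x A - (mil G (y + e) A - mil G y A)|
      <= k * `|e| * `|x - y| * `|A| }.

Lemma C3_bounded_le {m n : nat} (f : 'cV[R]_D -> 'M[R]_(m, n)) (c c' : R) :
  c <= c' -> C3_bounded f c -> C3_bounded f c'.
Proof.
move=> cc [c0 d1 d2 d3 b1 b2 b3]; split.
- exact: le_trans cc.
- exact: d1.
- exact: d2.
- exact: d3.
- by move=> z v; apply: le_trans (b1 z v) _; rewrite ler_wpM2r.
- by move=> v w z; apply: le_trans (b2 v w z) _; rewrite !ler_wpM2r.
- by move=> v w u z; apply: le_trans (b3 v w u z) _; rewrite !ler_wpM2r.
Qed.

Lemma field_bounds_exist (G0 : 'cV[R]_D -> 'cV[R]_D) G :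
  C_b 3 G0 -> C_b 3 G -> DGG_bounded_derivative G ->
  exists c, field_bounds G0 G c.
Proof.
move=> /C_b3_bounded[c1 h1] /C_b3_bounded[c2 h2] hDGG.
have [c3 c30 h3] := dirfield_lip h2 hDGG.
have [c4 c40 h4] := dirfield_taylor h2 hDGG.
have c10 := c3_ge0 h1; have c20 := c3_ge0 h2.
have N0 := normr_ge0 (G0 0); have N1 := normr_ge0 (G 0).
have c50 : 0 <= \sum_(i < M) `|dirfield G i 0| by apply: sumr_ge0.
pose m3 : R := M%:R ^+ 3; have m30 : 0 <= m3 by rewrite exprn_ge0.
pose c5 := m3 * (c3 + \sum_(i < M) `|dirfield G i 0|).
have c5_0 : 0 <= c5 by rewrite mulr_ge0 // addr_ge0.
have M0 : 0 <= M%:R :> R by [].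
have m3c3 : 0 <= m3 * c3 by rewrite mulr_ge0.
pose c := c1 + `|G0 0| + (c2 + `|G 0|) + c4 + c5 + m3 * c3 + M%:R.
have c_0 : 0 <= c by rewrite !addr_ge0.
have le1 : c1 + `|G0 0| <= c.
  by rewrite /c; move: c20 N1 c40 c5_0 m3c3 M0; clear; lra.
have le2 : c2 + `|G 0| <= c.
  by rewrite /c; move: c10 N0 c40 c5_0 m3c3 M0; clear; lra.
have le4 : c4 <= c by rewrite /c; move: c10 N0 c20 N1 c5_0 m3c3 M0; clear; lra.
have le5 : c5 <= c by rewrite /c; move: c10 N0 c20 N1 c40 m3c3 M0; clear; lra.
have le6 : m3 * c3 <= c by rewrite /c; move: c10 N0 c20 N1 c40 c5_0 M0; clear; lra.
have le7 : M%:R <= c by rewrite /c; move: c10 N0 c20 N1 c40 c5_0 m3c3; clear; lra.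
have dl i x y : `|dirfield G i x - dirfield G i y| <= c3 * `|x - y|.
  apply: le_trans (h3 (delta_mx i 0) x y) _.
  by rewrite -[leRHS]mulr1; apply: ler_pM (delta_norm i); rewrite ?mulr_ge0.
exists c; split=> //.
- by apply: C3_bounded_le h2; apply: le_trans le2; rewrite lerDl.
- by apply: C3_bounded_le h1; apply: le_trans le1; rewrite lerDl.
- by move=> x; apply: le_trans (c3_growth x h2) _; rewrite ler_wpM2r ?addr_ge0.
- by move=> x; apply: le_trans (c3_growth x h1) _; rewrite ler_wpM2r ?addr_ge0.
- move=> x A; apply: le_trans (tens_norm (k := (c3 + \sum_(i < M) `|dirfield G i 0|)
    * (1 + `|x|)) _ _ _) _.
  + by rewrite mulr_ge0 ?addr_ge0.
  + move=> i; have := dl i x 0; rewrite subr0 => hl.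
    have : `|dirfield G i 0| <= \sum_(i < M) `|dirfield G i 0|.
      by rewrite (bigD1 i) //= lerDl; apply: sumr_ge0.
    have := ler_normD (dirfield G i x - dirfield G i 0) (dirfield G i 0).
    rewrite subrK; have := mulr_ge0 c50 (normr_ge0 x); move: hl c30.
    move: (`|dirfield G i x|) (`|dirfield G i x - dirfield G i 0|) (`|dirfield G i 0|).
    by move: (\sum_(i < M) _); clear; move=> p q u v; lra.
  + by rewrite mulrA ler_wpM2r // ler_wpM2r ?addr_ge0.
- move=> x y A; rewrite /mil tensB.
  apply: le_trans (tens_norm (k := c3 * `|x - y|) _ _ _) _.
  + by rewrite mulr_ge0.
  + by move=> i; exact: dl.
  + by rewrite mulrA ler_wpM2r // ler_wpM2r.
- move=> x w; apply: le_trans (h4 x w) _.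
  by rewrite ler_wpM2r ?exprn_ge0 // ler_wpM2r ?addr_ge0.
- by move=> A w; apply: le_trans (mulmx_norm A w) _; rewrite !ler_wpM2r.
- move=> r r0.
  have /choice[k hk] : forall i, exists k, loc_C11 (dirfield G i) r k.
    by move=> i; exact: loc_C11_dirfield h2 r0.
  have k0 i : 0 <= k i := lc_ge0 (hk i).
  have S0 : 0 <= \sum_i k i by apply: sumr_ge0.
  exists (m3 * \sum_i k i); first by rewrite mulr_ge0.
  move=> x y e A xr yr xer yer; rewrite /mil !tensB.
  apply: le_trans (tens_norm (k := (\sum_i k i) * `|e| * `|x - y|) _ _ _) _.
  + by rewrite !mulr_ge0.
  + move=> i; apply: le_trans (lc_second (hk i) xr yr xer yer) _.
    rewrite ler_wpM2r // ler_wpM2r // (bigD1 i) //= lerDl.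
    by apply: sumr_ge0.
  + by rewrite !mulrA.
Qed.

End VectorFields.

Lemma add_sub_split {V : zmodType} (p q u v w : V) :
  p + v - (u + w) = (p - q) + (q - u) + (v - w).
Proof. by zmod. Qed.

Lemma eq2_norm_le {R : realType} {V : normedModType R} (u v u' v' : V) (k : R) :
  u = u' -> v = v' -> `|u' - v'| <= k -> `|u - v| <= k.
Proof. by move=> -> ->. Qed.

Lemma defect_split {R : realType} (D M : nat) (tau : R) (a1 a0 b1 b0 b2 m1 m0 n1 n0 n2 : 'cV[R]_D)
    (P P' : 'M[R]_(D, M)) (w : 'cV[R]_M) :
  tau *: (a1 - a0) + P *m w + (m1 - m0) - (tau *: (b1 - b0) + P' *m w + (n1 - n0))
  = tau *: (a1 - a0 - (b2 - b0) + (b2 - b1)) + (P - P') *m w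
    + (m1 - m0 - (n2 - n0) + (n2 - n1)).
Proof. by rewrite !(scalerBr, scalerDr) mulmxBl; zmod. Qed.

Lemma linear_split {R : realType} (U V : lmodType R) (L : {linear U -> V}) u v (p : V) :
  p - L u = p - L (u + v) + L v.
Proof. by rewrite linearD opprD addrA subrK. Qed.

Lemma linear_sub_split {R : realType} (U V : lmodType R) (L : {linear U -> V}) u v (p : V) :
  L u - p = L (u - v) + (L v - p).
Proof. by rewrite linearB addrA subrK. Qed.

Section StepEstimates.
Context {R : realType} {D M : nat}.
Variables (G0 : 'cV[R]_D -> 'cV[R]_D) (G : 'cV[R]_D -> 'M[R]_(D, M)).
Implicit Types (x y z e : 'cV[R]_D) (w : 'cV[R]_M) (A : 'M[R]_M) (tau q : R).

Definition step_rest tau A x : 'cV[R]_D := tau *: G0 x + mil G x A.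
Definition step_inc tau w A x : 'cV[R]_D := G x *m w + step_rest tau A x.
Definition rde_step tau w A x : 'cV[R]_D := x + step_inc tau w A x.

Record step_data (k q tau : R) w A : Prop := StepData {
  sd_w : `|w| <= k * q;
  sd_A : `|A| <= k * q ^+ 2;
  sd_tau : `|tau| <= k * q ^+ 2 }.

Variables (c k Q : R) (hf : field_bounds G0 G c) (k0 : 0 <= k) (Q0 : 0 <= Q).

Let c0 : 0 <= c := fb_ge0 hf.

Lemma step_rest_growth q tau w A x : step_data k q tau w A ->
  `|step_rest tau A x| <= 2 * c * k * (1 + `|x|) * q ^+ 2.
Proof.
case=> _ hA ht; apply: le_trans (ler_normD _ _) _; rewrite normrZ.
have n1 : `|tau| * `|G0 x| <= k * q ^+ 2 * (c * (1 + `|x|)).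
  by apply: ler_pM => //; exact: fb_growth0 hf x.
have n2 : `|mil G x A| <= c * (1 + `|x|) * (k * q ^+ 2).
  apply: le_trans (fb_mil_growth hf x A) _.
  by rewrite ler_wpM2l // mulr_ge0 // addr_ge0.
apply: le_trans (lerD n1 n2) _.
by apply: le_of_eq; ring.
Qed.

Lemma step_rest_lip q tau w A x y : step_data k q tau w A ->
  `|step_rest tau A x - step_rest tau A y| <= 2 * c * k * `|x - y| * q ^+ 2.
Proof.
case=> _ hA ht.
have -> : step_rest tau A x - step_rest tau A y
    = tau *: (G0 x - G0 y) + (mil G x A - mil G y A).
  by rewrite /step_rest scalerBr; zmod.
apply: le_trans (ler_normD _ _) _; rewrite normrZ.
have n1 : `|tau| * `|G0 x - G0 y| <= k * q ^+ 2 * (c * `|x - y|).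
  by apply: ler_pM => //; exact: c3_lip (fb_G0 hf).
have n2 : `|mil G x A - mil G y A| <= c * `|x - y| * (k * q ^+ 2).
  apply: le_trans (fb_mil_lip hf x y A) _.
  by rewrite ler_wpM2l // mulr_ge0.
apply: le_trans (lerD n1 n2) _.
by apply: le_of_eq; ring.
Qed.

Definition inc_const := c * c * k + 2 * c * k * Q.

Lemma inc_const_ge0 : 0 <= inc_const.
Proof. by rewrite addr_ge0 // !mulr_ge0. Qed.

Lemma step_inc_growth q tau w A x : 0 <= q -> q <= Q -> step_data k q tau w A ->
  `|step_inc tau w A x| <= inc_const * (1 + `|x|) * q.
Proof.
move=> q0 qQ hd; apply: le_trans (ler_normD _ _) _.
have X0 : 0 <= 1 + `|x| by rewrite addr_ge0.
have n1 : `|G x *m w| <= c * (c * (1 + `|x|)) * (k * q).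
  apply: le_trans (fb_mul hf _ _) _; apply: ler_pM; rewrite ?mulr_ge0 //.
    by rewrite ler_wpM2l //; exact: fb_growth hf x.
  exact: sd_w hd.
have n2 : 2 * c * k * (1 + `|x|) * q ^+ 2 <= 2 * c * k * (1 + `|x|) * (Q * q).
  by rewrite ler_wpM2l ?mulr_ge0 // expr2 ler_wpM2r.
apply: le_trans (lerD n1 (le_trans (step_rest_growth x hd) n2)) _.
by rewrite /inc_const; apply: le_of_eq; ring.
Qed.

Lemma step_inc_lip q tau w A x y : 0 <= q -> q <= Q -> step_data k q tau w A ->
  `|step_inc tau w A x - step_inc tau w A y| <= inc_const * `|x - y| * q.
Proof.
move=> q0 qQ hd.
have -> : step_inc tau w A x - step_inc tau w A y
    = (G x - G y) *m w + (step_rest tau A x - step_rest tau A y).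
  by rewrite /step_inc mulmxBl; zmod.
apply: le_trans (ler_normD _ _) _.
have n1 : `|(G x - G y) *m w| <= c * (c * `|x - y|) * (k * q).
  apply: le_trans (fb_mul hf _ _) _; apply: ler_pM; rewrite ?mulr_ge0 //.
    by rewrite ler_wpM2l //; exact: c3_lip (fb_G hf).
  exact: sd_w hd.
have n2 : 2 * c * k * `|x - y| * q ^+ 2 <= 2 * c * k * `|x - y| * (Q * q).
  by rewrite ler_wpM2l ?mulr_ge0 // expr2 ler_wpM2r.
apply: le_trans (lerD n1 (le_trans (step_rest_lip x y hd) n2)) _.
by rewrite /inc_const; apply: le_of_eq; ring.
Qed.

Lemma rde_step_second r : 0 <= r -> exists2 k5, 0 <= k5 &
  forall q tau w A x y e, 0 <= q -> q <= Q -> step_data k q tau w A ->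
  `|x| <= r -> `|y| <= r -> `|x + e| <= r -> `|y + e| <= r ->
  `|rde_step tau w A (x + e) - rde_step tau w A x
    - (rde_step tau w A (y + e) - rde_step tau w A y)| <= k5 * `|e| * `|x - y| * q.
Proof.
move=> r0; have [m m0 hm] := fb_mil_second hf r0.
exists (c * c * k + k * Q * c + m * k * Q).
  by rewrite !addr_ge0 // !mulr_ge0.
move=> q tau w A x y e q0 qQ [hw hA ht] xr yr xer yer.
have -> : rde_step tau w A (x + e) - rde_step tau w A x
    - (rde_step tau w A (y + e) - rde_step tau w A y)
  = (G (x + e) - G x - (G (y + e) - G y)) *m w
  + tau *: (G0 (x + e) - G0 x - (G0 (y + e) - G0 y))
  + (mil G (x + e) A - mil G x A - (mil G (y + e) A - mil G y A)).
  by rewrite /rde_step /step_inc /step_rest !(mulmxBl, scalerBr); zmod.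
apply: le_trans (ler_normD _ _) _.
apply: le_trans (lerD (ler_normD _ _) (lexx _)) _; rewrite normrZ.
have E0 : 0 <= c * `|e| * `|x - y| by rewrite !mulr_ge0.
have q2 : q ^+ 2 <= Q * q by rewrite expr2 ler_wpM2r.
have n1 : `|(G (x + e) - G x - (G (y + e) - G y)) *m w|
    <= c * (c * `|e| * `|x - y|) * (k * q).
  apply: le_trans (fb_mul hf _ _) _; apply: ler_pM; rewrite ?mulr_ge0 //.
  by rewrite ler_wpM2l //; exact: c3_second (fb_G hf).
have n2 : `|tau| * `|G0 (x + e) - G0 x - (G0 (y + e) - G0 y)|
    <= k * (Q * q) * (c * `|e| * `|x - y|).
  apply: ler_pM => //; last exact: c3_second (fb_G0 hf).
  by apply: le_trans ht _; rewrite ler_wpM2l.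
have n3 : `|mil G (x + e) A - mil G x A - (mil G (y + e) A - mil G y A)|
    <= m * `|e| * `|x - y| * (k * (Q * q)).
  apply: le_trans (hm _ _ _ A xr yr xer yer) _.
  rewrite ler_wpM2l ?mulr_ge0 //; apply: le_trans hA _.
  by rewrite ler_wpM2l.
apply: le_trans (lerD (lerD n1 n2) n3) _.
by apply: le_of_eq; ring.
Qed.

Definition gain tau w A x := G (rde_step tau w A x) - G x - 'd G x (G x *m w).

Lemma step_defectE tau1 w1 A1 tau2 w2 A2 x :
  rde_step tau2 w2 A2 (rde_step tau1 w1 A1 x)
    - rde_step (tau1 + tau2) (w1 + w2) (A1 + A2 + tensor w1 w2) x
  = tau2 *: (G0 (rde_step tau1 w1 A1 x) - G0 x) + gain tau1 w1 A1 x *m w2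
    + (mil G (rde_step tau1 w1 A1 x) A2 - mil G x A2).
Proof.
rewrite /gain; set y := rde_step tau1 w1 A1 x.
have yE : y = x + (G x *m w1 + (tau1 *: G0 x + mil G x A1)) by [].
rewrite /rde_step /step_inc /step_rest {1}yE.
rewrite !milD mil_tensor mulmxDr scalerDl scalerBr !mulmxBl.
move: ('d G x _ *m w2) => p.
by move: (G y *m w2) (mil G y A2) (tau2 *: G0 y) => p1 p2 p3; zmod.
Qed.

Lemma gain_growth q tau w A x : 0 <= q -> step_data k q tau w A ->
  `|gain tau w A x| <= (2 * c * c * k + c * k ^+ 2) * (1 + `|x|) * q ^+ 2.
Proof.
move=> q0 hd; have [hw _ _] := hd.
have yE : rde_step tau w A x = x + G x *m w + step_rest tau A x.
  by rewrite /rde_step /step_inc addrA.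
have n1 : `|G (rde_step tau w A x) - G (x + G x *m w)|
    <= c * (2 * c * k * (1 + `|x|) * q ^+ 2).
  apply: le_trans (c3_lip _ _ (fb_G hf)) _; rewrite ler_wpM2l //.
  rewrite yE [X in `|X|](_ : _ = step_rest tau A x); last by zmod.
  exact: step_rest_growth hd.
have n2 : `|G (x + G x *m w) - G x - 'd G x (G x *m w)|
    <= c * (1 + `|x|) * (k * q) ^+ 2.
  apply: le_trans (fb_taylor hf x w) _; rewrite ler_wpM2l ?mulr_ge0 ?addr_ge0 //.
  by rewrite lerXn2r ?nnegrE ?mulr_ge0.
have -> : gain tau w A x = G (rde_step tau w A x) - G (x + G x *m w)
    + (G (x + G x *m w) - G x - 'd G x (G x *m w)).
  by rewrite /gain addrA addrA subrK.
apply: le_trans (ler_normD _ _) _; apply: le_trans (lerD n1 n2) _.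
by apply: le_of_eq; ring.
Qed.

Lemma gain_lip q tau w A x y r : 0 <= q -> q <= Q -> step_data k q tau w A ->
  0 <= r -> `|x| <= r -> `|y| <= r ->
  `|gain tau w A x - gain tau w A y|
    <= (c * (inc_const * (1 + r)) ^+ 2 + 2 * c * inc_const * (inc_const * (1 + r))
        + 2 * c * c * k + 2 * c * c * k * (1 + r)) * `|x - y| * q ^+ 2.
Proof.
move=> q0 qQ hd r0 xr yr.
have gE z : gain tau w A z = taylor2 G z (step_inc tau w A z)
    + 'd G z (step_rest tau A z).
  exact: linear_split.
pose gx := step_inc tau w A x; pose gy := step_inc tau w A y.
pose rx := step_rest tau A x; pose ry := step_rest tau A y.
have dE : 'd G x rx - 'd G y ry = 'd G x (rx - ry) + ('d G x ry - 'd G y ry).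
  exact: linear_sub_split.
have -> : gain tau w A x - gain tau w A y
  = (taylor2 G x gx - taylor2 G y gx) + (taylor2 G y gx - taylor2 G y gy)
   + ('d G x (rx - ry) + ('d G x ry - 'd G y ry)).
  by rewrite -dE (gE x) (gE y); exact: add_sub_split.
have i0 := inc_const_ge0.
pose g := inc_const * (1 + r).
have g0 : 0 <= g by rewrite mulr_ge0 // addr_ge0.
have ngx : `|gx| <= g * q.
  apply: le_trans (step_inc_growth x q0 qQ hd) _.
  by rewrite ler_wpM2r // ler_wpM2l // lerD2l.
have ngy : `|gy| <= g * q.
  apply: le_trans (step_inc_growth y q0 qQ hd) _.
  by rewrite ler_wpM2r // ler_wpM2l // lerD2l.
have X0 := normr_ge0 (x - y).
have n1 : `|taylor2 G x gx - taylor2 G y gx| <= c * (g * q) ^+ 2 * `|x - y|.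
  apply: le_trans (taylor2_lip_base x y gx (fb_G hf)) _.
  rewrite ler_wpM2r // ler_wpM2l //.
  by rewrite lerXn2r ?nnegrE //; apply: mulr_ge0.
have n2 : `|taylor2 G y gx - taylor2 G y gy|
    <= c * (inc_const * `|x - y| * q) * (g * q + g * q).
  apply: le_trans (taylor2_lip y gx gy (fb_G hf)) _.
  apply: ler_pM; rewrite ?mulr_ge0 ?addr_ge0 //; last exact: lerD.
  by rewrite ler_wpM2l //; exact: step_inc_lip.
have n3 : `|'d G x (rx - ry)| <= c * (2 * c * k * `|x - y| * q ^+ 2).
  apply: le_trans (c3_bound1 (fb_G hf) _ _) _; rewrite ler_wpM2l //.
  exact: step_rest_lip hd.
have n4 : `|'d G x ry - 'd G y ry| <= c * `|x - y| * (2 * c * k * (1 + r) * q ^+ 2).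
  apply: le_trans (c3_diff_lip x y ry (fb_G hf)) _.
  rewrite ler_wpM2l ?mulr_ge0 //; apply: le_trans (step_rest_growth y hd) _.
  by rewrite ler_wpM2r ?exprn_ge0 // ler_wpM2l ?mulr_ge0 // lerD2l.
apply: le_trans (ler_normD _ _) _.
apply: le_trans (lerD (ler_normD _ _) (ler_normD _ _)) _.
apply: le_trans (lerD (lerD n1 n2) (lerD n3 n4)) _.
by rewrite -/g; apply: le_of_eq; ring.
Qed.

Lemma rde_step_defect : exists2 k3, 0 <= k3 &
  forall q tau1 w1 A1 tau2 w2 A2 x, 0 <= q -> q <= Q ->
  step_data k q tau1 w1 A1 -> step_data k q tau2 w2 A2 ->
  `|rde_step tau2 w2 A2 (rde_step tau1 w1 A1 x)
    - rde_step (tau1 + tau2) (w1 + w2) (A1 + A2 + tensor w1 w2) x|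
    <= k3 * (1 + `|x|) * q ^+ 3.
Proof.
have i0 := inc_const_ge0.
pose g := 2 * c * c * k + c * k ^+ 2.
have g0 : 0 <= g by rewrite addr_ge0 // !mulr_ge0 // exprn_ge0.
exists (2 * k * c * inc_const + c * g * k); first by rewrite addr_ge0 // !mulr_ge0.
move=> q tau1 w1 A1 tau2 w2 A2 x q0 qQ h1 [hw2 hA2 ht2].
rewrite step_defectE.
have X0 : 0 <= 1 + `|x| by rewrite addr_ge0.
have ni := step_inc_growth x q0 qQ h1.
have yx : `|rde_step tau1 w1 A1 x - x| <= inc_const * (1 + `|x|) * q.
  by rewrite /rde_step addrAC subrr add0r.
apply: le_trans (ler_normD _ _) _.
apply: le_trans (lerD (ler_normD _ _) (lexx _)) _; rewrite normrZ.
have n1 : `|tau2| * `|G0 (rde_step tau1 w1 A1 x) - G0 x|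
    <= k * q ^+ 2 * (c * (inc_const * (1 + `|x|) * q)).
  apply: ler_pM => //; apply: le_trans (c3_lip _ _ (fb_G0 hf)) _.
  by rewrite ler_wpM2l.
have n2 : `|gain tau1 w1 A1 x *m w2| <= c * (g * (1 + `|x|) * q ^+ 2) * (k * q).
  apply: le_trans (fb_mul hf _ _) _; apply: ler_pM; rewrite ?mulr_ge0 //.
  by rewrite ler_wpM2l //; exact: gain_growth.
have n3 : `|mil G (rde_step tau1 w1 A1 x) A2 - mil G x A2|
    <= c * (inc_const * (1 + `|x|) * q) * (k * q ^+ 2).
  apply: le_trans (fb_mil_lip hf _ _ _) _; apply: ler_pM; rewrite ?mulr_ge0 //.
  by rewrite ler_wpM2l.
apply: le_trans (lerD (lerD n1 n2) n3) _.
by apply: le_of_eq; ring.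
Qed.

Lemma rde_step_defect_lip r : 0 <= r -> exists2 k4, 0 <= k4 &
  forall q tau1 w1 A1 tau2 w2 A2 x y, 0 <= q -> q <= Q ->
  step_data k q tau1 w1 A1 -> step_data k q tau2 w2 A2 -> `|x| <= r -> `|y| <= r ->
  let defect x := rde_step tau2 w2 A2 (rde_step tau1 w1 A1 x)
    - rde_step (tau1 + tau2) (w1 + w2) (A1 + A2 + tensor w1 w2) x in
  `|defect x - defect y| <= k4 * `|x - y| * q ^+ 3.
Proof.
move=> r0; have i0 := inc_const_ge0.
pose g := inc_const * (1 + r).
have g0 : 0 <= g by rewrite mulr_ge0 // addr_ge0.
pose r' := r + g * Q; have r'0 : 0 <= r' by rewrite addr_ge0 // mulr_ge0.
have [m m0 hm] := fb_mil_second hf r'0.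
pose kT := c * g ^+ 2 + 2 * c * inc_const * g + 2 * c * c * k + 2 * c * c * k * (1 + r).
have kT0 : 0 <= kT.
  have a1 : 0 <= c * g ^+ 2 by rewrite mulr_ge0 // exprn_ge0.
  have a2 : 0 <= 2 * c * inc_const * g by rewrite mulr_ge0 // !mulr_ge0.
  have a3 : 0 <= 2 * c * c * k * (1 + r).
    by apply: mulr_ge0; [rewrite !mulr_ge0 | rewrite addr_ge0].
  have a4 : 0 <= 2 * c * c * k by rewrite !mulr_ge0.
  by rewrite /kT !addr_ge0.
exists (k * c * (g + inc_const) + c * kT * k + m * g * k + c * inc_const * k).
  by rewrite !addr_ge0 // !mulr_ge0 // addr_ge0.
move=> q tau1 w1 A1 tau2 w2 A2 x y q0 qQ h1 [hw2 hA2 ht2] xr yr /=.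
have ex := step_defectE tau1 w1 A1 tau2 w2 A2 x.
have ey := step_defectE tau1 w1 A1 tau2 w2 A2 y.
apply: (eq2_norm_le ex ey) => {ex ey}.
pose gx := step_inc tau1 w1 A1 x; pose gy := step_inc tau1 w1 A1 y.
have x'E : rde_step tau1 w1 A1 x = x + gx by [].
have y'E : rde_step tau1 w1 A1 y = y + gy by [].
rewrite x'E y'E.
have gq : g * q <= g * Q by rewrite ler_wpM2l.
have ngx : `|gx| <= g * q.
  apply: le_trans (step_inc_growth x q0 qQ h1) _.
  by rewrite ler_wpM2r // ler_wpM2l // lerD2l.
have hxy := step_inc_lip x y q0 qQ h1; rewrite -/gx -/gy in hxy.
have X0 := normr_ge0 (x - y).
have rr' : r <= r' by rewrite lerDl mulr_ge0.
have xgr z : `|z| <= r -> `|z + gx| <= r'.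
  move=> zr; apply: le_trans (ler_normD _ _) _; rewrite lerD //.
  exact: le_trans ngx gq.
have -> : tau2 *: (G0 (x + gx) - G0 x) + gain tau1 w1 A1 x *m w2
     + (mil G (x + gx) A2 - mil G x A2)
     - (tau2 *: (G0 (y + gy) - G0 y) + gain tau1 w1 A1 y *m w2
     + (mil G (y + gy) A2 - mil G y A2))
  = tau2 *: (G0 (x + gx) - G0 x - (G0 (y + gx) - G0 y) + (G0 (y + gx) - G0 (y + gy)))
  + (gain tau1 w1 A1 x - gain tau1 w1 A1 y) *m w2
  + (mil G (x + gx) A2 - mil G x A2 - (mil G (y + gx) A2 - mil G y A2)
     + (mil G (y + gx) A2 - mil G (y + gy) A2)).
  exact: defect_split.
apply: le_trans (ler_normD _ _) _.
apply: le_trans (lerD (ler_normD _ _) (lexx _)) _; rewrite normrZ.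
have y_lip : y + gx - (y + gy) = gx - gy by zmod.
have n1 : `|tau2| * `|G0 (x + gx) - G0 x - (G0 (y + gx) - G0 y)
      + (G0 (y + gx) - G0 (y + gy))|
    <= k * q ^+ 2 * (c * (g * q) * `|x - y| + c * (inc_const * `|x - y| * q)).
  apply: ler_pM => //; apply: le_trans (ler_normD _ _) _; apply: lerD.
    apply: le_trans (c3_second _ _ _ (fb_G0 hf)) _.
    by rewrite ler_wpM2r // ler_wpM2l.
  apply: le_trans (c3_lip _ _ (fb_G0 hf)) _.
  by rewrite y_lip ler_wpM2l.
have n2 : `|(gain tau1 w1 A1 x - gain tau1 w1 A1 y) *m w2|
    <= c * (kT * `|x - y| * q ^+ 2) * (k * q).
  apply: le_trans (fb_mul hf _ _) _; apply: ler_pM; rewrite ?mulr_ge0 //.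
  by rewrite ler_wpM2l //; exact: gain_lip.
have n3 : `|mil G (x + gx) A2 - mil G x A2 - (mil G (y + gx) A2 - mil G y A2)
     + (mil G (y + gx) A2 - mil G (y + gy) A2)|
    <= m * (g * q) * `|x - y| * (k * q ^+ 2)
     + c * (inc_const * `|x - y| * q) * (k * q ^+ 2).
  apply: le_trans (ler_normD _ _) _; apply: lerD.
    apply: le_trans (hm _ _ _ A2 (le_trans xr rr') (le_trans yr rr') (xgr _ xr) (xgr _ yr)) _.
    apply: ler_pM; rewrite ?mulr_ge0 //.
    by rewrite ler_wpM2r // ler_wpM2l.
  apply: le_trans (fb_mil_lip hf _ _ _) _; apply: ler_pM; rewrite ?mulr_ge0 //.
  by rewrite y_lip ler_wpM2l.
apply: le_trans (lerD (lerD n1 n2) n3) _.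
by apply: le_of_eq; ring.
Qed.

End StepEstimates.

(** * Rough increments *)

Section MatrixContinuity.
Context {R : realType} {T : topologicalType}.

Lemma continuous_mx {m n : nat} (f : T -> 'M[R]_(m, n)) :
  (forall i j, continuous (fun z => f z i j : R)) -> continuous f.
Proof.
move=> cf z; apply/cvgrPdist_le => e e0.
have H : \forall y \near z, forall ij : 'I_m * 'I_n, `|f z ij.1 ij.2 - f y ij.1 ij.2| <= e.
  apply: filter_forall => ij.
  by have /cvgrPdist_le/(_ _ e0) := cf ij.1 ij.2 z.
apply: filterS H => y hy; apply: mx_norm_le; first exact: ltW.
by move=> i j; rewrite !mxE; exact: (hy (i, j)).
Qed.

Lemma continuous_entry {m n : nat} (f : T -> 'M[R]_(m, n)) i j :
  continuous f -> continuous (fun z => f z i j : R).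
Proof.
move=> cf z; apply/cvgrPdist_le => e e0.
have /cvgrPdist_le/(_ _ e0) := cf z; apply: filterS => y; apply: le_trans.
by have := mx_norm_entry (f z - f y) i j; rewrite !mxE.
Qed.

Lemma continuous_fsum {n : nat} (f : 'I_n -> T -> R) :
  (forall i, continuous (f i)) -> continuous (fun z => \sum_(i < n) f i z).
Proof.
elim: n f => [|n ih] f cf.
  rewrite (_ : (fun z => _) = fun=> 0); last by apply/funext => z; rewrite big_ord0.
  by move=> z; exact: cvg_cst.
rewrite (_ : (fun z => _) = fun z =>
   \sum_(i < n) f (widen_ord (leqnSn n) i) z + f ord_max z); last first.
  by apply/funext => z; rewrite big_ord_recr.
by move=> z; apply: cvgD; [exact: ih|exact: cf].
Qed.

Lemma continuous_mulmx {m n p : nat} (f : T -> 'M[R]_(m, n)) (g : T -> 'M[R]_(n, p)) :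
  continuous f -> continuous g -> continuous (fun z => f z *m g z).
Proof.
move=> cf cg; apply: continuous_mx => i j.
rewrite (_ : (fun z => _) = fun z => \sum_(k < n) (f z i k * g z k j)); last first.
  by apply/funext => z; rewrite mxE.
by apply: continuous_fsum => k z; apply: cvgM; exact: continuous_entry.
Qed.

Lemma continuous_trmx {m n : nat} (f : T -> 'M[R]_(m, n)) :
  continuous f -> continuous (fun z => (f z)^T).
Proof.
move=> cf; apply: continuous_mx => i j.
rewrite (_ : (fun z => _) = fun z => f z j i); first exact: continuous_entry.
by apply/funext => z; rewrite mxE.
Qed.

Lemma continuous_tens {D M : nat} (K : 'I_M -> T -> 'M[R]_(D, M)) (A : T -> 'M[R]_M) :
  (forall i, continuous (K i)) -> continuous A ->
  continuous (fun z => tens (fun i => K i z) (A z)).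
Proof.
move=> cK cA; apply: continuous_mx => i j.
rewrite (_ : (fun z => _) = fun z => \sum_(k < M) \sum_(l < M)
    (A z k l * (K k z *m delta_mx l 0) i j)); last first.
  apply/funext => z; rewrite /tens summxE; apply: eq_bigr => k _.
  by rewrite summxE; apply: eq_bigr => l _; rewrite mxE.
apply: continuous_fsum => k; apply: continuous_fsum => l z.
apply: cvgM; first exact: continuous_entry.
apply: continuous_entry; apply: continuous_mulmx => // y; exact: cvg_cst.
Qed.

End MatrixContinuity.

Section Area.
Context {R : realType} {M : nat}.
Implicit Types (W : R -> 'cV[R]_M) (WW : R -> R -> 'M[R]_M) (s t u : R).

(* [area W WW s t] extends [WW] from [s < t] to all times so that Chen's relation
   holds for every triple of times; [area0 W WW t] is its value on [(0, t)]. *)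
Definition area0 W WW t : 'M[R]_M :=
  if 0 < t then WW 0 t
  else if t < 0 then tensor (W 0 - W t) (W 0 - W t) - WW t 0 else 0.

Definition area W WW s t : 'M[R]_M :=
  area0 W WW t - area0 W WW s - tensor (W s - W 0) (W t - W s).

Lemma tensorDl (v v' w : 'cV[R]_M) : tensor (v + v') w = tensor v w + tensor v' w.
Proof. exact: mulmxDl. Qed.

Lemma tensorDr (v w w' : 'cV[R]_M) : tensor v (w + w') = tensor v w + tensor v w'.
Proof. by rewrite /tensor linearD mulmxDr. Qed.

Lemma tensorNl (v w : 'cV[R]_M) : tensor (- v) w = - tensor v w.
Proof. exact: mulNmx. Qed.

Lemma tensorNr (v w : 'cV[R]_M) : tensor v (- w) = - tensor v w.
Proof. by rewrite /tensor linearN mulmxN. Qed.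

Lemma tensor_norm (v w : 'cV[R]_M) : `|tensor v w| <= `|v| * `|w|.
Proof.
apply: mx_norm_le => [|i j]; first by rewrite mulr_ge0.
by rewrite mxE big_ord1 mxE normrM ler_pM // mx_norm_entry.
Qed.

Lemma area_chen W WW s u t :
  area W WW s t = area W WW s u + area W WW u t + tensor (W u - W s) (W t - W u).
Proof.
by rewrite /area !(tensorDl, tensorDr, tensorNl, tensorNr); zmod.
Qed.

Lemma area_id W WW s : area W WW s s = 0.
Proof. by rewrite /area !subrr /tensor trmx0 mulmx0 subr0. Qed.

Lemma area_rev W WW s t :
  area W WW t s = tensor (W t - W s) (W t - W s) - area W WW s t.
Proof.
have := area_chen W WW s t s; rewrite area_id.
rewrite -[W s - W t]opprB tensorNr => /esym/eqP.
by rewrite subr_eq0 => /eqP <-; rewrite addrAC subrr add0r.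
Qed.

Lemma areaE al W WW s t : rough_path al W WW -> s < t -> area W WW s t = WW s t.
Proof.
move=> hW st.
have chen p q r : p < q -> q < r ->
    tensor (W q - W p) (W r - W q) = WW p r - WW p q - WW q r.
  move=> pq qr; have := hW (Num.min 0 p) (Num.max 0 r).
  case; rewrite ?ge_min ?le_max ?lexx // => _ _.
  by apply=> //; rewrite ?ge_min ?le_max ?lexx ?orbT.
rewrite /area /area0; case: (ltgtP 0 t) => t0; case: (ltgtP 0 s) => s0 //.
- by rewrite chen //; zmod.
- have := chen _ _ _ s0 t0.
  rewrite !(tensorDl, tensorDr, tensorNl, tensorNr) => h.
  have -> : WW s t = WW s 0 + WW 0 t + (tensor (W 0) (W t) + tensor (W 0) (- W 0)
     + (tensor (- W s) (W t) + tensor (- W s) (- W 0))).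
    by rewrite !(tensorDl, tensorDr, tensorNl, tensorNr) h; zmod.
  by rewrite !(tensorDl, tensorDr, tensorNl, tensorNr); zmod.
- by rewrite -s0 subrr /tensor mul0mx !subr0.
- by have := lt_trans st t0; rewrite ltNge (ltW s0).
- have := chen _ _ _ st t0.
  rewrite !(tensorDl, tensorDr, tensorNl, tensorNr) => h.
  have -> : WW s t = WW s 0 - WW t 0 - (tensor (W t) (W 0) + tensor (W t) (- W t)
     + (tensor (- W s) (W 0) + tensor (- W s) (- W t))).
    by rewrite !(tensorDl, tensorDr, tensorNl, tensorNr) h; zmod.
  by rewrite !(tensorDl, tensorDr, tensorNl, tensorNr); zmod.
- by move: st; rewrite -s0 => /(lt_trans t0); rewrite ltxx.
- by move: st; rewrite -t0 => /(lt_trans s0); rewrite ltxx.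
- by rewrite -t0 sub0r !(tensorDl, tensorDr, tensorNl, tensorNr); zmod.
- by move: st; rewrite -t0 -s0 ltxx.
Qed.

Lemma sqr_powR (x al : R) : 0 <= x -> (x `^ al) ^+ 2 = x `^ (2 * al).
Proof. by move=> x0; rewrite -powR_mulrn ?powR_ge0 // -powRrM mulrC. Qed.

Lemma cube_powR (x al : R) : 0 <= x -> (x `^ al) ^+ 3 = x `^ (3 * al).
Proof. by move=> x0; rewrite -powR_mulrn ?powR_ge0 // -powRrM mulrC. Qed.

Lemma powR_le_interval (x y p q : R) : 0 <= x -> x <= y -> 0 < q -> q <= p ->
  x `^ p <= y `^ (p - q) * x `^ q.
Proof.
move=> x0 xy q0 qp; have [->|xn0] := eqVneq x 0.
  by rewrite !powR0 ?mulr0 ?gt_eqF // (lt_le_trans q0).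
by apply: powR_le_bound => //; [exact: ltW | rewrite lt_neqAle eq_sym xn0].
Qed.

Lemma rough_path_data al W WW (T : R) : 0 < al -> al <= 1 / 2 -> 0 <= T ->
  rough_path al W WW ->
  exists2 k, 0 <= k & forall s t, - T <= s <= T -> - T <= t <= T ->
    step_data k (`|t - s| `^ al) (t - s) (W t - W s) (area W WW s t).
Proof.
move=> al0 al1 T0 hW.
have NT : - T <= 0 by rewrite oppr_le0.
have [[c1 h1] [c2 h2] _] := hW _ _ NT T0.
pose k1 := `|c1|; pose k2 := `|c2| + k1 ^+ 2.
pose k3 := (T + T) `^ (1 - 2 * al).
have k10 : 0 <= k1 by exact: normr_ge0.
have k20 : 0 <= k2 by rewrite addr_ge0 ?exprn_ge0.
have k30 : 0 <= k3 by rewrite powR_ge0.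
exists (k1 + k2 + k3); first by rewrite addr_ge0 // addr_ge0.
have key s t : - T <= s <= T -> - T <= t <= T -> s < t ->
    `|W t - W s| <= k1 * (t - s) `^ al /\ `|area W WW s t| <= `|c2| * ((t - s) `^ al) ^+ 2.
  move=> /andP[s1 s2] /andP[t1 t2] st; have ts0 : 0 <= t - s by rewrite subr_ge0 ltW.
  split; first by apply: le_trans (h1 s t s1 st t2) _; rewrite ler_wpM2r ?powR_ge0 // ler_norm.
  rewrite (areaE hW) // sqr_powR //; apply: le_trans (h2 s t s1 st t2) _.
  by rewrite ler_wpM2r ?powR_ge0 // ler_norm.
have key2 s t : - T <= s <= T -> - T <= t <= T ->
    `|W t - W s| <= k1 * `|t - s| `^ al /\ `|area W WW s t| <= k2 * (`|t - s| `^ al) ^+ 2.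
  move=> hs ht; case: (ltgtP s t) => [st|ts|<-].
  - have [H1 H2] := key _ _ hs ht st.
    rewrite ger0_norm; last by rewrite subr_ge0 ltW.
    split=> //.
    by apply: le_trans H2 _; rewrite ler_wpM2r ?exprn_ge0 ?powR_ge0 // lerDl exprn_ge0.
  - have [H1 H2] := key _ _ ht hs ts; rewrite distrC [`|t - s|]distrC.
    rewrite ger0_norm; last by rewrite subr_ge0 ltW.
    split=> //.
    rewrite area_rev; apply: le_trans (ler_normB _ _) _.
    have p0 : 0 <= (s - t) `^ al by rewrite powR_ge0.
    have := tensor_norm (W s - W t) (W s - W t).
    have : `|W s - W t| * `|W s - W t| <= (k1 * (s - t) `^ al) * (k1 * (s - t) `^ al).
      exact: ler_pM.
    by move: H2; rewrite /k2; clear; lra.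
  - by rewrite !subrr area_id !normr0; split; rewrite mulr_ge0 ?exprn_ge0 ?powR_ge0.
move=> s t hs ht; have [H1 H2] := key2 _ _ hs ht.
have q0 : 0 <= `|t - s| `^ al by rewrite powR_ge0.
have q20 : 0 <= (`|t - s| `^ al) ^+ 2 by rewrite exprn_ge0.
split.
- by apply: le_trans H1 _; rewrite ler_wpM2r // -addrA lerDl addr_ge0.
- by apply: le_trans H2 _; rewrite ler_wpM2r // addrAC lerDr addr_ge0.
- apply: (@le_trans _ _ (k3 * (`|t - s| `^ al) ^+ 2)); last first.
    by rewrite ler_wpM2r // lerDr addr_ge0.
  rewrite sqr_powR // -{1}(powRr1 (normr_ge0 (t - s))).
  apply: powR_le_interval => //; [|by lra|by lra].
  by case/andP: hs ht => ? ? /andP[? ?]; rewrite ler_norml; apply/andP; split; lra.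
Qed.

Lemma hoelder_continuous {V : normedModType R} (f : R -> V) (al : R) : 0 < al ->
  (forall T, 0 <= T -> exists2 k, 0 <= k & forall s t, - T <= s <= T -> - T <= t <= T ->
     `|f t - f s| <= k * `|t - s| `^ al) -> continuous f.
Proof.
move=> al0 hf t; apply/cvgrPdist_le => e e0.
have T0 : 0 <= `|t| + 1 by rewrite addr_ge0.
have [k k0 hk] := hf _ T0; have [d d0 hd] := powR_small k0 al0 e0.
near=> s; rewrite distrC.
have ts1 : `|t - s| <= 1.
  by near: s; have /cvgrPdist_le := @cvg_id _ (nbhs t); apply.
have tsd : `|t - s| <= d.
  by near: s; have /cvgrPdist_le := @cvg_id _ (nbhs t); apply.
have hs : - (`|t| + 1) <= s <= `|t| + 1.
  rewrite -ler_norml; have := ler_normB t (t - s); rewrite opprB addrC subrK.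
  by move: ts1; clear; lra.
have ht : - (`|t| + 1) <= t <= `|t| + 1 by rewrite -ler_norml lerDl.
by apply: le_trans (hk _ _ ht hs) _; apply: hd => //; rewrite distrC.
Unshelve. all: by end_near. Qed.

End Area.

Section RdeFlow.
Context {R : realType} {D M : nat}.
Variables (G0 : 'cV[R]_D -> 'cV[R]_D) (G : 'cV[R]_D -> 'M[R]_(D, M)).

Definition rde_mu (W : R -> 'cV[R]_M) (WW : R -> R -> 'M[R]_M) (s t : R) :=
  rde_step G0 G (t - s) (W t - W s) (area W WW s t).

Lemma rde_step0 x : rde_step G0 G 0 0 0 x = x.
Proof.
by rewrite /rde_step /step_inc /step_rest scale0r mulmx0 mil0 !addr0.
Qed.

Lemma rde_mu_id W WW s x : rde_mu W WW s s x = x.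
Proof. by rewrite /rde_mu !subrr area_id rde_step0. Qed.

Lemma rde_mu_defectE W WW s u t x :
  rde_mu W WW u t (rde_mu W WW s u x) - rde_mu W WW s t x
  = rde_step G0 G (t - u) (W t - W u) (area W WW u t)
      (rde_step G0 G (u - s) (W u - W s) (area W WW s u) x)
    - rde_step G0 G ((u - s) + (t - u)) ((W u - W s) + (W t - W u))
        (area W WW s u + area W WW u t + tensor (W u - W s) (W t - W u)) x.
Proof.
rewrite /rde_mu -area_chen [u - s + _](_ : _ = t - s); last by ring.
by rewrite [W u - W s + _](_ : _ = W t - W s) //; zmod.
Qed.

Lemma step_data_le k q q' tau (w : 'cV[R]_M) A : 0 <= k -> 0 <= q -> q <= q' ->
  step_data k q tau w A -> step_data k q' tau w A.
Proof.
move=> k0 q0 qq' [h1 h2 h3]; have q2 : q ^+ 2 <= q' ^+ 2.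
  by rewrite lerXn2r ?nnegrE // (le_trans q0).
by split; [apply: le_trans h1 _|apply: le_trans h2 _|apply: le_trans h3 _];
  rewrite ler_wpM2l.
Qed.

Lemma rde_sewable (al : R) (W : R -> 'cV[R]_M) (WW : R -> R -> 'M[R]_M) (T : R) :
  1 / 3 < al <= 1 / 2 -> 0 <= T -> rough_path al W WW ->
  C_b 3 G0 -> C_b 3 G -> DGG_bounded_derivative G ->
  exists C : R, [/\ sewable (- T) T al (3 * al) C (rde_mu W WW),
    sewable_loc (- T) T al (3 * al) (rde_mu W WW)
  & forall u v y, - T <= u <= T -> - T <= v <= T ->
     `|rde_mu W WW u v (rde_mu W WW v u y) - y|
       <= C * (1 + `|y|) * `|v - u| `^ (3 * al)].
Proof.
move=> /andP[al1 al2] T0 hW hG0 hG hDGG.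
have al0 : 0 < al by lra.
have [c hf] := field_bounds_exist hG0 hG hDGG.
have [k k0 hk] := rough_path_data al0 al2 T0 hW.
pose Q := (T + T) `^ al; have Q0 : 0 <= Q by exact: powR_ge0.
have [k3 k30 h3] := rde_step_defect hf k0 Q0.
have i0 := inc_const_ge0 hf k0 Q0.
pose C := inc_const c k Q + k3; have C0 : 0 <= C by rewrite addr_ge0.
have q0 (s t : R) : 0 <= `|t - s| `^ al by exact: powR_ge0.
have le_q (s u t u' : R) : `|u' - u| <= `|t - s| -> `|u' - u| `^ al <= `|t - s| `^ al.
  by move=> h; apply: le_powR => //; exact: ltW.
have qQ (s t : R) : - T <= s <= T -> - T <= t <= T -> `|t - s| `^ al <= Q.
  move=> /andP[? ?] /andP[? ?]; apply: le_powR => //; first exact: ltW.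
  by rewrite ler_norml; apply/andP; split; lra.
have sub_between (s u t : R) : (s <= u <= t) || (t <= u <= s) ->
    `|u - s| <= `|t - s| /\ `|t - u| <= `|t - s|.
  case/orP=> /andP[h1 h2].
    by have h3' := le_trans h1 h2; rewrite !ger0_norm ?subr_ge0 //; split; lra.
  have h3' := le_trans h1 h2; rewrite distrC [`|t - u|]distrC [`|t - s|]distrC.
  by rewrite !ger0_norm ?subr_ge0 //; split; lra.
have data (s u s' t' : R) : - T <= s <= T -> - T <= u <= T -> `|u - s| <= `|t' - s'| ->
    step_data k (`|t' - s'| `^ al) (u - s) (W u - W s) (area W WW s u).
  by move=> hs hu h; apply: step_data_le (hk _ _ hs hu) => //; exact: le_q.
exists C; split; first split.
- exact: al0.
- by lra.
- exact: C0.
- move=> s t x hs ht.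
  rewrite /rde_mu /rde_step addrAC subrr add0r.
  apply: le_trans (step_inc_growth hf k0 x (q0 s t) (qQ _ _ hs ht) (hk _ _ hs ht)) _.
  by rewrite ler_wpM2r // ler_wpM2r ?addr_ge0 // lerDl.
- move=> s t x y hs ht.
  have E (x' y' p q : 'cV[R]_D) : x' + p - (y' + q) - (x' - y') = p - q by zmod.
  rewrite /rde_mu /rde_step E.
  apply: le_trans (step_inc_lip hf k0 x y (q0 s t) (qQ _ _ hs ht) (hk _ _ hs ht)) _.
  by rewrite mulrAC ler_wpM2r // ler_wpM2r // lerDl.
- move=> s u t x hs hu ht hb; rewrite rde_mu_defectE.
  have [su ut] := sub_between _ _ _ hb.
  apply: le_trans (h3 _ _ _ _ _ _ _ x (q0 s t) (qQ _ _ hs ht)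
    (data s u s t hs hu su) (data u t s t hu ht ut)) _.
  by rewrite cube_powR // ler_wpM2r ?powR_ge0 // ler_wpM2r ?addr_ge0 // lerDr.
- split=> r.
  + have r0 : 0 <= `|r| by [].
    have [k4 k40 h4] := rde_step_defect_lip hf k0 Q0 r0.
    exists k4 => // s u t x y hs hu ht hb xr yr.
    have [su ut] := sub_between _ _ _ hb.
    have H := h4 _ _ _ _ _ _ _ x y (q0 s t) (qQ _ _ hs ht)
      (data s u s t hs hu su) (data u t s t hu ht ut)
      (le_trans xr (ler_norm _)) (le_trans yr (ler_norm _)).
    rewrite cube_powR in H; last exact: normr_ge0.
    apply: (eq2_norm_le (rde_mu_defectE W WW s u t x) (rde_mu_defectE W WW s u t y)).
    exact: H.
  + have r0 : 0 <= `|r| by [].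
    have [k5 k50 h5] := rde_step_second hf k0 Q0 r0.
    exists k5 => // s t x y e hs ht xr yr xer yer.
    by apply: h5 => //; rewrite ?q0 ?qQ //; try exact: hk;
      apply: le_trans (ler_norm _).
- move=> u v y hu hv.
  have := rde_mu_defectE W WW v u v y.
  rewrite rde_mu_id => ->.
  rewrite [`|v - u|]distrC.
  have vu : `|v - u| <= `|u - v| by rewrite distrC.
  apply: le_trans (h3 _ _ _ _ _ _ _ y (q0 v u) (qQ _ _ hv hu)
    (data v u v u hv hu (lexx _)) (data u v v u hu hv vu)) _.
  by rewrite cube_powR // ler_wpM2r ?powR_ge0 // ler_wpM2r ?addr_ge0 // lerDr.
Qed.

Lemma rough_path_continuous (al : R) (W : R -> 'cV[R]_M) (WW : R -> R -> 'M[R]_M) :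
  1 / 3 < al <= 1 / 2 -> rough_path al W WW ->
  continuous W /\ continuous (fun p : R * R => area W WW p.1 p.2).
Proof.
move=> /andP[al1 al2] hW; have al0 : 0 < al by lra.
have cW : continuous W.
  apply: (hoelder_continuous al0) => T T0.
  have [k k0 hk] := rough_path_data al0 al2 T0 hW.
  by exists k => // s t hs ht; have [] := hk _ _ hs ht.
have cA : continuous (area0 W WW).
  apply: (hoelder_continuous al0) => T T0.
  have [k k0 hk] := rough_path_data al0 al2 T0 hW.
  pose Q := (T + T) `^ al; have Q0 : 0 <= Q by exact: powR_ge0.
  exists (k * Q + k * Q * k); first by rewrite addr_ge0 // !mulr_ge0.
  have qQ (s t : R) : - T <= s <= T -> - T <= t <= T -> `|t - s| `^ al <= Q.
    move=> /andP[? ?] /andP[? ?]; apply: le_powR => //; first exact: ltW.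
    by rewrite ler_norml; apply/andP; split; lra.
  move=> s t hs ht.
  have h0 : - T <= 0 <= T by rewrite oppr_le0 T0.
  have -> : area0 W WW t - area0 W WW s
      = area W WW s t + tensor (W s - W 0) (W t - W s) by rewrite /area subrK.
  apply: le_trans (ler_normD _ _) _.
  have [w1 a1 _] := hk _ _ hs ht; have [w0 _ _] := hk _ _ h0 hs.
  have q0 : 0 <= `|t - s| `^ al by exact: powR_ge0.
  have n1 : `|area W WW s t| <= k * (Q * `|t - s| `^ al).
    by apply: le_trans a1 _; rewrite ler_wpM2l // expr2 ler_wpM2r // qQ.
  have n2 : `|tensor (W s - W 0) (W t - W s)| <= (k * Q) * (k * `|t - s| `^ al).
    apply: le_trans (tensor_norm _ _) _; apply: ler_pM => //.
    by apply: le_trans w0 _; rewrite ler_wpM2l // qQ.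
  apply: le_trans (lerD n1 n2) _.
  by apply: le_of_eq; ring.
split=> // p.
have c1 : {for p, continuous (fun p : R * R => area0 W WW p.1)}.
  by apply: continuous_comp; [exact: cvg_fst | exact: cA].
have c2 : {for p, continuous (fun p : R * R => area0 W WW p.2)}.
  by apply: continuous_comp; [exact: cvg_snd | exact: cA].
rewrite /area; apply: cvgB; first exact: cvgB c2 c1.
have cW1 : continuous (fun p : R * R => W p.1).
  by move=> q; apply: continuous_comp; [exact: cvg_fst | exact: cW].
have cW2 : continuous (fun p : R * R => W p.2).
  by move=> q; apply: continuous_comp; [exact: cvg_snd | exact: cW].
apply: (continuous_mulmx (f := fun p : R * R => W p.1 - W 0)
  (g := fun p : R * R => (W p.2 - W p.1)^T)).
  by move=> q; apply: cvgB; [exact: cW1 | exact: cvg_cst].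
apply: continuous_trmx => q.
by apply: cvgB; [exact: cW2 | exact: cW1].
Qed.

Lemma continuous_dirfield c i : C3_bounded G c -> continuous (dirfield G i).
Proof.
by move=> hG z; apply: differentiable_continuous; exact: differentiable_dirfield hG.
Qed.

Lemma rde_mu_continuous (al : R) (W : R -> 'cV[R]_M) (WW : R -> R -> 'M[R]_M) :
  1 / 3 < al <= 1 / 2 -> rough_path al W WW ->
  C_b 3 G0 -> C_b 3 G -> DGG_bounded_derivative G ->
  continuous (fun p : R * R * 'cV[R]_D => rde_mu W WW p.1.1 p.1.2 p.2).
Proof.
move=> hal hW hG0 hG hDGG; have [c hf] := field_bounds_exist hG0 hG hDGG.
have [cW cA] := rough_path_continuous hal hW.
have cG : continuous G.
  by move=> z; apply: differentiable_continuous; exact: c3_diff (fb_G hf) z.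
have cG0 : continuous G0.
  by move=> z; apply: differentiable_continuous; exact: c3_diff (fb_G0 hf) z.
have p1 : continuous (fun p : R * R * 'cV[R]_D => p.1.1).
  by move=> p; apply: continuous_comp; exact: cvg_fst.
have p2 : continuous (fun p : R * R * 'cV[R]_D => p.1.2).
  by move=> p; apply: continuous_comp; [exact: cvg_fst | exact: cvg_snd].
have p3 : continuous (fun p : R * R * 'cV[R]_D => p.2) by move=> p; exact: cvg_snd.
have pA : continuous (fun p : R * R * 'cV[R]_D => area W WW p.1.1 p.1.2).
  by move=> p; apply: (@continuous_comp _ _ _ fst (fun q => area W WW q.1 q.2));
    [exact: cvg_fst | exact: cA].
move=> p; rewrite /rde_mu /rde_step /step_inc /step_rest.
apply: cvgD; first exact: p3.
apply: cvgD.
  apply: (continuous_mulmx (f := fun p => G p.2) (g := fun p => W p.1.2 - W p.1.1)).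
    by move=> q; apply: continuous_comp; [exact: p3 | exact: cG].
  move=> q; apply: cvgB.
    by apply: continuous_comp; [exact: p2 | exact: cW].
  by apply: continuous_comp; [exact: p1 | exact: cW].
apply: cvgD.
  apply: cvgZ; first by apply: cvgB; [exact: p2 | exact: p1].
  by apply: continuous_comp; [exact: p3 | exact: cG0].
apply: (continuous_tens (K := fun i p => dirfield G i p.2)) => // i q.
have cF : continuous (dirfield G i) by apply: continuous_dirfield; exact: fb_G hf.
by apply: continuous_comp; [exact: p3 | exact: cF].
Qed.

End RdeFlow.

(** * Rough integrals *)

Section Partitions.
Context {R : realType}.
Implicit Types (s t u v h e : R) (P : seq R).

Lemma steps_rcons s P x : steps s (rcons P x) = rcons (steps s P) (last s P, x).
Proof.
rewrite /steps; elim: P s => [|y P ih] s //=.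
by congr (_ :: _); exact: ih.
Qed.

Lemma steps_cat s P P' : steps s (P ++ P') = steps s P ++ steps (last s P) P'.
Proof. by rewrite /steps; elim: P s => [|y P ih] s //=; rewrite ih. Qed.

Lemma sum_steps_telescope {V : zmodType} (Z : R -> V) s P :
  \sum_(x <- steps s P) (Z x.2 - Z x.1) = Z (last s P) - Z s.
Proof.
elim/last_ind: P => [|P y ih]; first by rewrite /steps big_nil /= subrr.
by rewrite steps_rcons big_rcons /= ih last_rcons; zmod.
Qed.

Lemma mem_steps_bounds s t P : itv_partition s t P -> forall x, x \in steps s P ->
  [/\ s <= x.1, x.1 < x.2, x.2 <= t & x.2 - x.1 <= mesh s P].
Proof.
move=> [hp /eqP hl] x xP.
have m : x.2 - x.1 <= mesh s P.
  exact: (le_bigmax_seq 0 x xpredT (fun x : R * R => x.2 - x.1) xP isT).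
suff [h1 h2 h3] : [/\ s <= x.1, x.1 < x.2 & x.2 <= last s P] by split; rewrite -?hl.
elim: P s hp {m hl} xP => [|y P ih] s //= /andP[sy hp].
have yl : y <= last y P.
  elim: P y hp {ih sy} => [|z P ih'] y //= /andP[yz hp].
  by apply: le_trans (ltW yz) _; exact: ih'.
rewrite /steps /= in_cons => /orP[/eqP -> //|xP].
by have [h1 h2 h3] := ih _ hp xP; split=> //; apply: le_trans h1; exact: ltW.
Qed.

Lemma mesh_filter_filter s t : Filter (mesh_filter s t).
Proof.
apply: filter_from_filter; first by exists 1 => /=.
move=> e1 e2 /= e10 e20; exists (Num.min e1 e2); first by rewrite /= lt_min e10.
by move=> P /= [hP]; rewrite lt_min => /andP[h1 h2].
Qed.

Definition grid s h k : seq R := [seq s + j.+1%:R * h | j <- iota 0 k].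

Lemma gridS s h k : grid s h k.+1 = rcons (grid s h k) (s + k.+1%:R * h).
Proof.
rewrite /grid (_ : iota 0 k.+1 = rcons (iota 0 k) k) ?map_rcons //.
by rewrite -addn1 iotaD add0n cats1.
Qed.

Lemma grid_last s h k : last s (grid s h k) = s + k%:R * h.
Proof. by case: k => [|k]; [rewrite mul0r addr0 | rewrite gridS last_rcons]. Qed.

Lemma grid_path s h k : 0 < h -> path <%R s (grid s h k).
Proof.
move=> h0; elim: k => [|k ih] //.
by rewrite gridS rcons_path ih grid_last /= ltrD2l ltr_pM2r // ltr_nat.
Qed.

Lemma grid_mesh s h k e : 0 < e -> h < e -> mesh s (grid s h k) < e.
Proof.
move=> e0 he; rewrite /mesh big_seq; apply: bigmax_lt => // x.
elim: k => [|k ih] //; rewrite gridS steps_rcons mem_rcons in_cons grid_last.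
case/orP=> [/eqP -> /=|//]; apply: le_lt_trans he.
by rewrite -natr1; apply: le_of_eq; ring.
Qed.

Lemma mesh_cat s P P' e : mesh s P < e -> mesh (last s P) P' < e -> mesh s (P ++ P') < e.
Proof.
rewrite /mesh steps_cat; elim: (steps s P) => [|x l ih] //=.
by rewrite !big_cons !gt_max => /andP[-> /ih h1] /h1 ->.
Qed.

Definition upart s t n : seq R :=
  if s < t then grid s ((t - s) / n.+1%:R) n.+1 else [::].

Lemma upart_itv s t n : s <= t -> itv_partition s t (upart s t n).
Proof.
rewrite le_eqVlt /upart => /orP[/eqP <-|st]; first by rewrite ltxx; split.
rewrite st; split; last by rewrite grid_last uniform_end.
by apply: grid_path; rewrite divr_gt0 ?subr_gt0.
Qed.

Lemma upart_last s t n : s <= t -> last s (upart s t n) = t.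
Proof. by move=> st; have [_ /eqP] := upart_itv n st. Qed.

Lemma upart_mesh s t n e : 0 < e -> (t - s) / n.+1%:R < e -> mesh s (upart s t n) < e.
Proof.
move=> e0 he; rewrite /upart; case: ifP => _; first exact: grid_mesh.
by rewrite /mesh /steps big_nil.
Qed.

Lemma upart_cat_itv s u t n : s <= u -> u <= t ->
  itv_partition s t (upart s u n ++ upart u t n).
Proof.
move=> su ut; have [p1 _] := upart_itv n su; have [p2 _] := upart_itv n ut.
split; last by rewrite last_cat upart_last // upart_last.
by rewrite cat_path p1 upart_last.
Qed.

Lemma upart_cvg {V : normedModType R} s u t (S : seq R -> V) (I : V) e :
  s <= u -> u <= t -> S P @[P --> mesh_filter s t] --> I -> 0 < e ->
  exists N, forall n, (N <= n)%N -> `|I - S (upart s u n ++ upart u t n)| <= e.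
Proof.
move=> su ut hI e0; have FF := mesh_filter_filter s t.
have /cvgrPdist_le/(_ _ e0)[d /= d0 hd] := hI.
have hstep p q : p <= q -> forall n,
    (Num.truncn ((t - s) / (d / 2)) <= n)%N -> q - p <= t - s -> (q - p) / n.+1%:R < d.
  move=> pq n hn hle; apply: (@le_lt_trans _ _ (d / 2)); last by lra.
  rewrite ler_pdivrMr ?ltr0n // mulrC -ler_pdivrMr ?divr_gt0 //.
  apply: (@le_trans _ _ ((t - s) / (d / 2))); first by rewrite ler_pM2r ?invr_gt0 ?divr_gt0.
  by apply: le_trans (le_truncS _) _; rewrite ler_nat.
exists (Num.truncn ((t - s) / (d / 2))) => n hn; apply: hd; split.
  exact: upart_cat_itv.
apply: mesh_cat; first by apply: upart_mesh => //; apply: hstep => //; lra.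
by rewrite upart_last //; apply: upart_mesh => //; apply: hstep => //; lra.
Qed.

Lemma sewing_sum_cvg {V : normedModType R} (Z : R -> V) (Xi : R -> R -> V) K ga t :
  1 < ga -> 0 <= K ->
  (forall u v, 0 <= u -> u < v -> v <= t -> `|Z v - Z u - Xi u v| <= K * (v - u) `^ ga) ->
  (\sum_(x <- steps 0 P) Xi x.1 x.2) @[P --> mesh_filter 0 t] --> Z t - Z 0.
Proof.
move=> ga1 K0 hZ; have FF := mesh_filter_filter 0 t.
apply/cvgrPdist_le => e e0.
have [t0|t0] := ltP t 0.
  exists 1 => //= P [hP _].
  case: P hP => [|y P] hP; first by have [_ /eqP /= h0] := hP; move: t0; rewrite -h0 ltxx.
  have [h1 h2 h3 _] := mem_steps_bounds hP (mem_head (0, y) _).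
  by have := lt_le_trans (le_lt_trans h1 h2) h3; rewrite ltNge (ltW t0).
have Kt0 : 0 <= K * t by rewrite mulr_ge0.
have ga0 : 0 < ga - 1 by lra.
have [d d0 hd] := powR_small Kt0 ga0 e0.
exists d => //= P [hP mP]; have [_ /eqP hl] := hP.
rewrite -{1}hl -sum_steps_telescope -sumrB.
apply: le_trans (ler_norm_sum _ _ _) _.
apply: (@le_trans _ _ (\sum_(x <- steps 0 P) K * d `^ (ga - 1) * (x.2 - x.1))).
  rewrite big_seq [leRHS]big_seq; apply: ler_sum => x xP.
  have [h1 h2 h3 h4] := mem_steps_bounds hP xP.
  have x0 : 0 <= x.2 - x.1 by rewrite subr_ge0 ltW.
  apply: le_trans (hZ _ _ h1 h2 h3) _.
  rewrite powR_succ //; last by lra.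
  rewrite mulrCA mulrC ler_wpM2r // ler_wpM2l // le_powR //; first exact: ltW.
  by apply: le_trans h4 _; exact: ltW.
rewrite -mulr_sumr (sum_steps_telescope id) hl subr0 mulrAC.
by apply: hd => //; exact: ltW.
Qed.

End Partitions.

Lemma Rintegral_step {R : realType} (f : R -> R) (T u v E : R) :
  {within `[0, T], continuous f} -> 0 <= u -> u < v -> v <= T ->
  (forall r, u <= r <= v -> `|f r - f u| <= E) ->
  `|\int[lebesgue_measure]_(r in `[0, v]) f r - \int[lebesgue_measure]_(r in `[0, u]) f r
    - (v - u) * f u| <= E * (v - u).
Proof.
move=> cf u0 uv vT hE.
have itgT : lebesgue_measure.-integrable `[0, T] (EFin \o f).
  by apply: continuous_compact_integrable => //; exact: segment_compact.
have itg (a b : itv_bound R) : (BLeft 0 <= a)%O -> (b <= BRight T)%O ->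
    lebesgue_measure.-integrable [set` Interval a b] (EFin \o f).
  by move=> h1 h2; apply: integrableS itgT => //; exact: subset_itv.
have muv : lebesgue_measure.-integrable `[u, v] (EFin \o f).
  by apply: itg; rewrite bnd_simp.
rewrite Rintegral_itvB; last first.
- by rewrite bnd_simp ltW.
- by rewrite bnd_simp.
- by apply: itg; rewrite bnd_simp.
rewrite Rintegral_itv_obnd_cbnd; last by apply: itg; rewrite bnd_simp.
have mc (c : R) : lebesgue_measure.-integrable `[u, v] (EFin \o (fun=> c : R)).
  apply: continuous_compact_integrable; first exact: segment_compact.
  by apply: continuous_subspaceT => z; exact: cvg_cst.
have fm : fine (lebesgue_measure (`[u, v]%classic : set R)) = v - u.
  by rewrite lebesgue_measure_itv /= lte_fin uv.
have -> : (v - u) * f u = \int[lebesgue_measure]_(r in `[u, v]) f u.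
  by rewrite Rintegral_cst // fm mulrC.
rewrite -RintegralB //.
have mB : lebesgue_measure.-integrable `[u, v] (EFin \o (fun r => f r - f u)).
  rewrite (_ : _ \o _ = ((EFin \o f) \- (EFin \o (fun=> f u : R)))%E) //.
  exact: integrableB.
apply: le_trans (le_normr_Rintegral _ mB) _ => //.
have -> : E * (v - u) = \int[lebesgue_measure]_(r in `[u, v]) E.
  by rewrite Rintegral_cst // fm.
apply: le_Rintegral => //.
exact: (integrable_abse mB).
Qed.

Lemma hoelder_sym {R : realType} {V : normedModType R} (a b al : R) (f : R -> V) :
  Defs.hoelder a b al f -> exists2 k, 0 <= k & forall s t, a <= s <= b -> a <= t <= b ->
    `|f t - f s| <= k * `|t - s| `^ al.
Proof.
move=> [C hC]; exists `|C| => // s t /andP[s1 s2] /andP[t1 t2].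
case: (ltgtP s t) => [st|ts|<-].
- rewrite [`|t - s|]ger0_norm ?subr_ge0 ?(ltW st) //; apply: le_trans (hC _ _ s1 st t2) _.
  by rewrite ler_wpM2r ?powR_ge0 // ler_norm.
- rewrite distrC [`|t - s|]distrC [`|s - t|]ger0_norm ?subr_ge0 ?(ltW ts) //.
  apply: le_trans (hC _ _ t1 ts s2) _.
  by rewrite ler_wpM2r ?powR_ge0 // ler_norm.
- by rewrite !subrr normr0 mulr_ge0 ?powR_ge0.
Qed.

Lemma hoelder_within {R : realType} (f : R -> R) (T al k : R) : 0 < al -> 0 <= k ->
  (forall s t, 0 <= s <= T -> 0 <= t <= T -> `|f t - f s| <= k * `|t - s| `^ al) ->
  {within `[0, T], continuous f}.
Proof.
move=> al0 k0 hf; apply/subspace_continuousP => x; rewrite /= in_itv /= => xT.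
apply/cvgrPdist_le => e e0; have [d d0 hd] := powR_small k0 al0 e0.
rewrite near_withinE; near=> r; rewrite /= in_itv /= => rT.
have xd : `|x - r| <= d.
  by near: r; have /cvgrPdist_le := @cvg_id _ (nbhs x); apply.
rewrite distrC; apply: le_trans (hf _ _ xT rT) _; rewrite distrC.
by apply: hd.
Unshelve. all: by end_near. Qed.

Lemma drift_step {R : realType} {D : nat} (G0 : 'cV[R]_D -> 'cV[R]_D) (Y : R -> 'cV[R]_D)
    (T al c k : R) : 0 < al <= 1 / 2 -> 0 <= T -> 0 <= c -> 0 <= k ->
  (forall x y, `|G0 x - G0 y| <= c * `|x - y|) ->
  (forall s t, 0 <= s <= T -> 0 <= t <= T -> `|Y t - Y s| <= k * `|t - s| `^ al) ->
  exists2 C, 0 <= C & forall u v, 0 <= u -> u < v -> v <= T ->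
    `|cV_integral 0 v (fun s => G0 (Y s)) - cV_integral 0 u (fun s => G0 (Y s))
      - (v - u) *: G0 (Y u)| <= C * (v - u) `^ (3 * al).
Proof.
move=> /andP[al0 al1] T0 c0 k0 lG hY.
exists (c * k * T `^ (1 + al - 3 * al)); first by rewrite !mulr_ge0 ?powR_ge0.
move=> u v u0 uv vT; have vu0 : 0 <= v - u by rewrite subr_ge0 ltW.
have hG i s t : 0 <= s <= T -> 0 <= t <= T ->
    `|G0 (Y t) i 0 - G0 (Y s) i 0| <= c * k * `|t - s| `^ al.
  move=> hs ht.
  have -> : G0 (Y t) i 0 - G0 (Y s) i 0 = (G0 (Y t) - G0 (Y s)) i 0 by rewrite !mxE.
  apply: le_trans (mx_norm_entry _ _ _) _; apply: le_trans (lG _ _) _.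
  by rewrite -mulrA ler_wpM2l // hY.
apply: mx_norm_le => [|i j]; first by rewrite !mulr_ge0 ?powR_ge0.
rewrite ord1 !mxE.
have := @Rintegral_step R (fun r => G0 (Y r) i 0) T u v (c * k * (v - u) `^ al)
  (hoelder_within al0 (mulr_ge0 c0 k0) (hG i)) u0 uv vT.
move=> H; apply: le_trans (H _) _.
  move=> r /andP[ur rv].
  have hu : 0 <= u <= T by apply/andP; split; lra.
  have hr : 0 <= r <= T by apply/andP; split; lra.
  apply: le_trans (hG i _ _ hu hr) _; rewrite ler_wpM2l ?mulr_ge0 //.
  rewrite ger0_norm ?subr_ge0 //; apply: le_powR; [exact: ltW| by rewrite subr_ge0|].
  by rewrite lerD2r.
have E : (v - u) `^ al * (v - u) = (v - u) `^ (1 + al).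
  have -> : 1 + al = al + 1 by exact: addrC.
  rewrite [RHS]powR_succ //; last by rewrite addr_gt0.
  by rewrite addrK mulrC.
rewrite -mulrA E -[leRHS]mulrA ler_wpM2l ?mulr_ge0 //.
apply: powR_le_interval => //; lra.
Qed.

Lemma sub_shift {V : zmodType} (x y z : V) : x + z - (y + z) - (x - y) = 0.
Proof. by rewrite opprD addrACA subrr addr0 subrr. Qed.

Section RoughIntegralStep.
Context {R : realType} {D M : nat}.
Variables (al : R) (W : R -> 'cV[R]_M) (WW : R -> R -> 'M[R]_M).
Variables (A : R -> 'M[R]_(D, M)) (A' : R -> {linear 'cV[R]_M -> 'M[R]_(D, M)}).

Definition germ u v : 'cV[R]_D := A u *m (W v - W u) + tensor_apply (A' u) (area W WW u v).

Lemma tensor_apply_tens (L : {linear 'cV[R]_M -> 'M[R]_(D, M)}) B :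
  tensor_apply L B = tens (fun i => L (delta_mx i 0)) B.
Proof. by []. Qed.

Lemma tensor_applyB L (B B' : 'M[R]_M) :
  tensor_apply L (B + B') = tensor_apply L B + tensor_apply L B' :> 'cV[R]_D.
Proof.
rewrite /tensor_apply -big_split /=; apply: eq_bigr => i _.
by rewrite -big_split /=; apply: eq_bigr => j _; rewrite mxE scalerDl.
Qed.

Lemma germ_defect s u t : germ s u + germ u t - germ s t
  = (A u - A s - A' s (W u - W s)) *m (W t - W u)
    + (tensor_apply (A' u) (area W WW u t) - tensor_apply (A' s) (area W WW u t)).
Proof.
rewrite /germ (area_chen W WW s u t).
move: (area W WW s u) (area W WW u t) => B B'.
have -> : W t - W s = (W u - W s) + (W t - W u) by zmod.
move: (W u - W s) (W t - W u) => w w'.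
rewrite 2!tensor_applyB tensor_applyE mulmxDr !mulmxBl.
by zmod.
Qed.

(* The sewing of this state-independent step is the rough integral. *)
Definition germ_shift s t (x : 'cV[R]_D) : 'cV[R]_D :=
  x + (if s < t then germ s t else if t < s then - germ t s else 0).

Lemma germ_bounds T : 1 / 3 < al <= 1 / 2 -> 0 <= T -> rough_path al W WW ->
  controlled 0 T al W A A' ->
  exists2 C, 0 <= C &
    (forall u v, 0 <= u -> u < v -> v <= T -> `|germ u v| <= C * (v - u) `^ al) /\
    (forall s u t, 0 <= s -> s < u -> u < t -> t <= T ->
      `|germ s u + germ u t - germ s t| <= C * (t - s) `^ (3 * al)).
Proof.
move=> /andP[al1 al2] T0 hW [hA [C1 hA'] [C2 hR]]; have al0 : 0 < al by lra.
have [k k0 hk] := rough_path_data al0 al2 T0 hW.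
have [kA kA0 hkA] := hoelder_sym hA.
pose Q := T `^ al; have Q0 : 0 <= Q by exact: powR_ge0.
have m30 : 0 <= M%:R ^+ 3 :> R by rewrite exprn_ge0.
pose a0 := `|A 0| + kA * Q; have a00 : 0 <= a0 by rewrite addr_ge0 // mulr_ge0.
pose b0 := \sum_(i < M) `|A' 0 (delta_mx i 0)| + `|C1| * Q.
have b00 : 0 <= b0 by rewrite addr_ge0 ?mulr_ge0 //; apply: sumr_ge0.
have h0T : 0 <= (0 : R) <= T by rewrite lexx.
have in2 u : 0 <= u <= T -> - T <= u <= T.
  by move=> /andP[u0 uT]; rewrite uT andbT; lra.
have qQ u v : 0 <= u -> u <= v -> v <= T -> (v - u) `^ al <= Q.
  by move=> u0 uv vT; apply: le_powR; [exact: ltW|rewrite subr_ge0|lra].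
have bA u : 0 <= u <= T -> `|A u| <= a0.
  move=> /[dup] /andP[u0 uT] hu; have := hkA _ _ h0T hu; rewrite subr0 ger0_norm // => h.
  have := ler_normD (A u - A 0) (A 0); rewrite subrK.
  have : u `^ al <= Q by have := qQ _ _ (lexx 0) u0 uT; rewrite subr0.
  move=> /(ler_wpM2l kA0); rewrite /a0; move: h; clear; lra.
have bA' u i : 0 <= u <= T -> `|A' u (delta_mx i 0)| <= b0.
  move=> /andP[]; rewrite le_eqVlt => /orP[/eqP <-|u0] uT.
    apply: (@le_trans _ _ (\sum_(i < M) `|A' 0 (delta_mx i 0)|)).
      by rewrite (bigD1 i) //= lerDl; apply: sumr_ge0.
    by rewrite lerDl mulr_ge0.
  have := hA' 0 u (delta_mx i 0) (lexx 0) u0 uT; rewrite subr0 => h.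
  have h1 : C1 * u `^ al * `|delta_mx i 0 : 'cV[R]_M| <= `|C1| * Q.
    apply: le_trans (_ : `|C1| * u `^ al * 1 <= _).
      apply: le_trans (ler_wpM2r _ (ler_wpM2r _ (ler_norm C1))) _ => //.
        exact: powR_ge0.
      by rewrite ler_wpM2l ?delta_norm // mulr_ge0 // powR_ge0.
    rewrite mulr1 ler_wpM2l //.
    by have := qQ _ _ (lexx 0) (ltW u0) uT; rewrite subr0.
  have h2 : `|A' 0 (delta_mx i 0)| <= \sum_(i < M) `|A' 0 (delta_mx i 0)|.
    by rewrite (bigD1 i) //= lerDl; apply: sumr_ge0.
  have := ler_normD (A' u (delta_mx i 0) - A' 0 (delta_mx i 0)) (A' 0 (delta_mx i 0)).
  rewrite subrK /b0; move: h h1 h2.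
  move: (`|A' u _ - A' 0 _|) (`|A' u _|) (`|A' 0 (delta_mx i 0)|) (\sum_(i < M) _).
  by move: (C1 * _ * _) (`|C1| * Q); clear; move=> x y z w p q; lra.
pose Ca := M%:R * a0 * k + M%:R ^+ 3 * b0 * (k * Q).
pose Cb := M%:R * `|C2| * k + M%:R ^+ 3 * `|C1| * k.
have Ca0 : 0 <= Ca by rewrite /Ca addr_ge0 // !mulr_ge0.
have Cb0 : 0 <= Cb by rewrite /Cb addr_ge0 // !mulr_ge0.
exists (Ca + Cb); first by rewrite addr_ge0.
split=> [u v u0 uv vT|s u t s0 su ut tT].
  have hu : 0 <= u <= T by rewrite u0 /=; lra.
  have hv : 0 <= v <= T by rewrite vT andbT; lra.
  have [w1 a1 _] := hk _ _ (in2 _ hu) (in2 _ hv).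
  rewrite ger0_norm ?subr_ge0 ?(ltW uv) // in w1 a1.
  have q0 : 0 <= (v - u) `^ al by exact: powR_ge0.
  have n1 : `|A u *m (W v - W u)| <= M%:R * a0 * (k * (v - u) `^ al).
    apply: le_trans (mulmx_norm _ _) _; apply: ler_pM; rewrite ?mulr_ge0 //.
    by rewrite ler_wpM2l // bA.
  have n2 : `|tensor_apply (A' u) (area W WW u v)|
      <= M%:R ^+ 3 * b0 * (k * (Q * (v - u) `^ al)).
    rewrite tensor_apply_tens; apply: le_trans (tens_norm _ b00 (fun i => bA' u i hu)) _.
    rewrite ler_wpM2l ?mulr_ge0 //; apply: le_trans a1 _.
    by rewrite ler_wpM2l // expr2 ler_wpM2r // qQ // ltW.
  apply: le_trans (ler_normD _ _) _; apply: le_trans (lerD n1 n2) _.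
  rewrite [leRHS]mulrDl (_ : _ + _ = Ca * (v - u) `^ al); last by rewrite /Ca; ring.
  by rewrite lerDl mulr_ge0.
have st := lt_trans su ut.
have ss : 0 <= s <= T by rewrite s0 /=; lra.
have hu : 0 <= u <= T by apply/andP; split; lra.
have ht : 0 <= t <= T by rewrite tT andbT; lra.
rewrite germ_defect.
have [w1 a1 _] := hk _ _ (in2 _ hu) (in2 _ ht).
have tu0 : 0 <= t - u by rewrite subr_ge0 ltW.
have us0 : 0 <= u - s by rewrite subr_ge0 ltW.
have ts0 : 0 <= t - s by rewrite subr_ge0 ltW.
rewrite ger0_norm // in w1 a1.
have q1 : (t - u) `^ al <= (t - s) `^ al by apply: le_powR; [exact: ltW|by []|lra].
have q2 : (u - s) `^ al <= (t - s) `^ al by apply: le_powR; [exact: ltW|by []|lra].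
have p1 : 0 <= (t - u) `^ al by exact: powR_ge0.
have p2 : 0 <= (u - s) `^ al by exact: powR_ge0.
rewrite -cube_powR //; set q := (t - s) `^ al in q1 q2 *.
have q0 : 0 <= q by exact: powR_ge0.
have n1 : `|(A u - A s - A' s (W u - W s)) *m (W t - W u)|
    <= M%:R * (`|C2| * q ^+ 2) * (k * q).
  apply: le_trans (mulmx_norm _ _) _; apply: ler_pM; rewrite ?mulr_ge0 //.
    rewrite ler_wpM2l //.
    have uT : u <= T by lra.
    apply: le_trans (hR s u s0 su uT) _; rewrite -sqr_powR //.
    apply: ler_pM; rewrite ?exprn_ge0 ?ler_norm //; last by rewrite lerXn2r ?nnegrE.
    have h := hR s u s0 su uT; rewrite -sqr_powR // in h.
    have us2 : 0 < ((u - s) `^ al) ^+ 2 by apply: exprn_gt0; apply: powR_gt0; rewrite subr_gt0.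
    by have := le_trans (normr_ge0 _) h; rewrite pmulr_lge0.
  by apply: le_trans w1 _; rewrite ler_wpM2l.
have n2 : `|tensor_apply (A' u) (area W WW u t) - tensor_apply (A' s) (area W WW u t)|
    <= M%:R ^+ 3 * (`|C1| * q) * (k * q ^+ 2).
  rewrite !tensor_apply_tens tensB.
  apply: le_trans (tens_norm (k := `|C1| * q) _ _ _) _; first by rewrite mulr_ge0.
    move=> i; have uT : u <= T by lra.
    apply: le_trans (hA' s u (delta_mx i 0) s0 su uT) _.
    apply: le_trans (_ : `|C1| * (u - s) `^ al * 1 <= _).
      apply: le_trans (ler_wpM2r _ (ler_wpM2r _ (ler_norm C1))) _ => //.
      by rewrite ler_wpM2l ?delta_norm // mulr_ge0.
    by rewrite mulr1 ler_wpM2l.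
  rewrite ler_wpM2l ?mulr_ge0 //; apply: le_trans a1 _.
  by rewrite ler_wpM2l // lerXn2r ?nnegrE.
apply: le_trans (ler_normD _ _) _; apply: le_trans (lerD n1 n2) _.
rewrite [leRHS]mulrDl (_ : _ + _ = Cb * q ^+ 3); last by rewrite /Cb; ring.
by rewrite lerDr mulr_ge0 ?exprn_ge0.
Qed.

Lemma germ_sewable T : 1 / 3 < al <= 1 / 2 -> 0 <= T -> rough_path al W WW ->
  controlled 0 T al W A A' -> exists C, sewable 0 T al (3 * al) C germ_shift.
Proof.
move=> hal T0 hW hA; have [C C0 [b1 b2]] := germ_bounds hal T0 hW hA.
have /andP[al1 al2] := hal; have al0 : 0 < al by lra.
exists C; split=> //; first by lra.
- move=> s t x /andP[s0 sT] /andP[t0 tT]; rewrite /germ_shift addrAC subrr add0r.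
  have X1 : 1 <= 1 + `|x| by rewrite lerDl.
  case: (ltgtP s t) => [st|ts|->]; last by rewrite normr0 !mulr_ge0 ?powR_ge0 ?addr_ge0.
    rewrite [X in X `^ _]ger0_norm ?subr_ge0 ?(ltW st) //.
    apply: le_trans (b1 _ _ s0 st tT) _.
    by rewrite ler_wpM2r ?powR_ge0 // ler_peMr.
  rewrite normrN distrC [X in X `^ _]ger0_norm ?subr_ge0 ?(ltW ts) //.
  apply: le_trans (b1 _ _ t0 ts sT) _.
  by rewrite ler_wpM2r ?powR_ge0 // ler_peMr.
- move=> s t x y _ _; rewrite /germ_shift.
  move: (if _ then _ else _) => z.
  rewrite [X in `|X|](_ : _ = 0) ?normr0 ?mulr_ge0 ?powR_ge0 //.
  exact: sub_shift.
- move=> s u t x /andP[s0 sT] /andP[u0 uT] /andP[t0 tT] hb.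
  have X1 : 1 <= 1 + `|x| by rewrite lerDl.
  have R0 : 0 <= C * (1 + `|x|) * `|t - s| `^ (3 * al).
    by rewrite !mulr_ge0 ?powR_ge0 ?addr_ge0.
  rewrite /germ_shift.
  have [su|us|su] := ltgtP s u.
  + have [ut|tu|ut] := ltgtP u t.
    * have st := lt_trans su ut; rewrite st.
      rewrite [X in `|X|](_ : _ = germ s u + germ u t - germ s t); last by zmod.
      rewrite [X in X `^ _]ger0_norm ?subr_ge0 ?(ltW st) //.
      apply: le_trans (b2 _ _ _ s0 su ut tT) _.
      by rewrite ler_wpM2r ?powR_ge0 // ler_peMr.
    * by case/orP: hb => /andP[h1 h2]; lra.
    * by move: R0; rewrite -ut su addr0 subrr normr0.
  + have [ut|tu|ut] := ltgtP u t.
    * by case/orP: hb => /andP[h1 h2]; lra.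
    * have ts := lt_trans tu us; rewrite (lt_gtF ts) ts.
      rewrite [X in `|X|](_ : _ = - (germ t u + germ u s - germ t s)); last by zmod.
      rewrite normrN [`|t - s|]distrC [X in X `^ _]ger0_norm ?subr_ge0 ?(ltW ts) //.
      apply: le_trans (b2 _ _ _ t0 tu us sT) _.
      by rewrite ler_wpM2r ?powR_ge0 // ler_peMr.
    * by move: R0; rewrite -ut (lt_gtF us) us addr0 subrr normr0.
  + by rewrite -su !addr0 subrr normr0 -?su //; rewrite su.
Qed.

Lemma scheme_germ_shift u h k x : rough_path al W WW -> 0 < h ->
  scheme germ_shift u h k x = x + rough_sum W WW A A' u (grid u h k).
Proof.
move=> hW h0; elim: k => [|k ih]; first by rewrite /rough_sum /steps big_nil addr0.
have lt : u + k%:R * h < u + k.+1%:R * h by rewrite ltrD2l ltr_pM2r // ltr_nat.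
rewrite /= ih /germ_shift lt /rough_sum gridS steps_rcons big_rcons /= grid_last.
by rewrite /germ (areaE hW lt) -addrA.
Qed.

Lemma rough_sum_cat s P P' : rough_sum W WW A A' s (P ++ P')
  = rough_sum W WW A A' s P + rough_sum W WW A A' (last s P) P'.
Proof. by rewrite /rough_sum steps_cat big_cat. Qed.

Lemma rough_integral_step T (I : R -> 'cV[R]_D) : 1 / 3 < al <= 1 / 2 -> 0 <= T ->
  rough_path al W WW -> controlled 0 T al W A A' ->
  (forall t, 0 <= t <= T -> is_rough_integral W WW A A' 0 t (I t)) ->
  exists K d, [/\ 0 <= K, 0 < d & forall u v, 0 <= u -> u < v -> v <= T -> v - u <= d ->
    `|I v - I u - germ u v| <= K * (v - u) `^ (3 * al)].
Proof.
move=> hal T0 hW hA hI; have [C hC] := germ_sewable hal T0 hW hA.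
have [K [d [K0 d0 HK]]] := scheme_move hC.
exists K, d; split=> // u v u0 uv vT vud.
have hu : 0 <= u <= T by rewrite u0 /=; lra.
have hv : 0 <= v <= T by rewrite vT andbT; lra.
apply/ler_addgt0Pr => e e0; have e20 : 0 < e / 2 by rewrite divr_gt0.
have [N1 H1] := upart_cvg u0 (ltW uv) (hI v hv) e20.
have [N2 H2] := upart_cvg u0 (lexx u) (hI u hu) e20.
pose n := maxn N1 N2.
have {}H1 := H1 n (leq_maxl _ _); have {}H2 := H2 n (leq_maxr _ _).
have uu : upart u u n = [::] by rewrite /upart ltxx.
rewrite uu cats0 in H2.
rewrite rough_sum_cat upart_last // in H1.
have h0 : 0 < (v - u) / n.+1%:R by rewrite divr_gt0 ?subr_gt0.
have := HK u ((v - u) / n.+1%:R) n.+1 0 hu; rewrite uniform_end => /(_ hv).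
rewrite ger0_norm ?(ltW h0) // [_ * (_ / _)]mulrC divfK ?pnatr_eq0 //.
case/(_ vud) => + _; rewrite normr0 addr0 mulr1 scheme_germ_shift // add0r.
have -> : grid u ((v - u) / n.+1%:R) n.+1 = upart u v n by rewrite /upart uv.
rewrite /germ_shift uv add0r.
set S := rough_sum _ _ _ _ u _ in H1 *; set S0 := rough_sum _ _ _ _ 0 _ in H1 H2.
move=> H3.
have -> : I v - I u - germ u v = (I v - (S0 + S)) - (I u - S0) + (S - germ u v) by zmod.
apply: le_trans (ler_normD _ _) _.
apply: le_trans (lerD (ler_normB _ _) (lexx _)) _.
by move: H1 H2 H3; clear; lra.
Qed.

Lemma rough_integral_nil (I : 'cV[R]_D) : is_rough_integral W WW A A' 0 0 I -> I = 0.
Proof.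
move=> hI; apply/eqP; rewrite -normr_le0; apply/ler_addgt0Pr => e e0.
have [N /(_ N (leqnn N))] := upart_cvg (lexx 0) (lexx 0) hI e0.
by rewrite /upart ltxx /rough_sum /steps big_nil subr0 add0r.
Qed.

End RoughIntegralStep.

(** * Solutions *)

HB.instance Definition _ (R : realType) (m n : nat) := Complete.on 'M[R]_(m, n).

Lemma sub_norm_via {R : realType} {V : normedModType R} (m u v w : V) :
  `|u - v - w| <= `|u - m| + `|m - v - w|.
Proof. by apply: le_trans (ler_normD _ _); rewrite !addrA subrK. Qed.

Lemma integral_split {V : zmodType} (y1 j1 y0 j0 g m e : V) :
  y1 - j1 - (y0 - j0) - (g + m) = y1 - (y0 + (g + (e + m))) - (j1 - j0 - e).
Proof. by zmod. Qed.

Lemma solution_split {V : zmodType} (y1 y z j1 j0 g m e : V) :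
  y1 - (y + (g + (e + m)))
    = y1 - z - j1 - (y - z - j0) - (g + m) + (j1 - j0 - e).
Proof. by zmod. Qed.

Section RdeSolutions.
Context {R : realType} {D M : nat}.
Variables (G0 : 'cV[R]_D -> 'cV[R]_D) (G : 'cV[R]_D -> 'M[R]_(D, M)).
Variables (al : R) (W : R -> 'cV[R]_M) (WW : R -> R -> 'M[R]_M).
Implicit Types (Y : R -> 'cV[R]_D) (T : R).

Definition davie T Y := exists K r : R, [/\ 0 <= K, 0 <= r,
  forall u, 0 <= u <= T -> `|Y u| <= r
  & forall u v, 0 <= u -> u < v -> v <= T ->
    `|Y v - rde_mu G0 G W WW u v (Y u)| <= K * (v - u) `^ (3 * al)].

Lemma step_splitE Y u v :
  Y v - Y u = (Y v - rde_mu G0 G W WW u v (Y u))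
    + step_inc G0 G (v - u) (W v - W u) (area W WW u v) (Y u).
Proof. by rewrite /rde_mu /rde_step; zmod. Qed.

Lemma davie_increment c T Y : field_bounds G0 G c -> 0 < al <= 1 / 2 -> 0 <= T ->
  rough_path al W WW -> davie T Y ->
  exists2 C, 0 <= C & forall s t, 0 <= s -> s < t -> t <= T ->
    `|Y t - Y s| <= C * (t - s) `^ al /\
    `|Y t - Y s - G (Y s) *m (W t - W s)| <= C * (t - s) `^ (2 * al).
Proof.
move=> hf /andP[al0 al1] T0 hW [K [r [K0 r0 Yr hY]]].
have [k k0 hk] := rough_path_data al0 al1 T0 hW.
have c0 := fb_ge0 hf.
pose Q := T `^ al; have Q0 : 0 <= Q by exact: powR_ge0.
pose C1 := inc_const c k Q * (1 + r); pose C2 := 2 * c * k * (1 + r).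
have C10 : 0 <= C1 by rewrite mulr_ge0 ?(inc_const_ge0 hf) ?addr_ge0.
have C20 : 0 <= C2 by rewrite !mulr_ge0 ?addr_ge0.
exists (K * Q ^+ 2 + C1 + (K * Q + C2)).
  by rewrite !addr_ge0 // mulr_ge0 // exprn_ge0.
move=> s t s0 st tT; have ts0 : 0 <= t - s by rewrite subr_ge0 ltW.
have hs : - T <= s <= T by apply/andP; split; lra.
have ht : - T <= t <= T by apply/andP; split; lra.
have hs' : 0 <= s <= T by apply/andP; split; lra.
have := hk _ _ hs ht; rewrite ger0_norm // => hd.
have := hY _ _ s0 st tT; rewrite -cube_powR // -sqr_powR //.
set q := (t - s) `^ al in hd * => n0.
have q0 : 0 <= q by exact: powR_ge0.
have qQ : q <= Q by apply: le_powR => //; [exact: ltW|lra].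
have n1 : `|step_inc G0 G (t - s) (W t - W s) (area W WW s t) (Y s)| <= C1 * q.
  apply: le_trans (step_inc_growth hf k0 (Y s) q0 qQ hd) _.
  by rewrite ler_wpM2r // ler_wpM2l ?(inc_const_ge0 hf) // lerD2l Yr.
have n2 : `|step_rest G0 G (t - s) (area W WW s t) (Y s)| <= C2 * q ^+ 2.
  apply: le_trans (step_rest_growth hf (Y s) hd) _.
  rewrite ler_wpM2r ?exprn_ge0 // ler_wpM2l ?mulr_ge0 //.
  by rewrite lerD2l Yr.
have m1 : K * q ^+ 3 <= K * Q * q ^+ 2.
  by rewrite exprS mulrA ler_wpM2r ?exprn_ge0 // ler_wpM2l.
have m2 : K * q ^+ 3 <= K * Q ^+ 2 * q.
  by rewrite exprSr mulrA ler_wpM2r // ler_wpM2l // lerXn2r ?nnegrE.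
have P1 : 0 <= C1 * q by rewrite mulr_ge0.
have P2 : 0 <= C2 * q by rewrite mulr_ge0.
have P3 : 0 <= K * Q ^+ 2 * q by rewrite !mulr_ge0 ?exprn_ge0.
have P4 : 0 <= K * Q * q by rewrite !mulr_ge0.
have P5 : 0 <= C1 * q ^+ 2 by rewrite mulr_ge0 ?exprn_ge0.
have P6 : 0 <= K * Q ^+ 2 * q ^+ 2 by rewrite !mulr_ge0 ?exprn_ge0.
split.
  rewrite (step_splitE Y s t); apply: le_trans (ler_normD _ _) _.
  by move: n0 n1 m2 P1 P2 P3 P4; clear; lra.
have -> : Y t - Y s - G (Y s) *m (W t - W s)
    = (Y t - rde_mu G0 G W WW s t (Y s))
      + step_rest G0 G (t - s) (area W WW s t) (Y s).
  by rewrite /rde_mu /rde_step /step_inc; zmod.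
apply: le_trans (ler_normD _ _) _.
by move: n0 n2 m1 P5 P6; clear; lra.
Qed.

Lemma davie_controlled c T Y : field_bounds G0 G c -> 0 < al <= 1 / 2 -> 0 <= T ->
  rough_path al W WW -> davie T Y ->
  controlled 0 T al W Y (fun s => mulmx (G (Y s))).
Proof.
move=> hf hal T0 hW hY; have [C C0 hC] := davie_increment hf hal T0 hW hY.
have c0 := fb_ge0 hf; split.
- by exists C => s t s0 st tT; have [] := hC _ _ s0 st tT.
- exists (c * (c * C)) => s t v s0 st tT; have [n1 _] := hC _ _ s0 st tT.
  rewrite /= -mulmxBl; apply: le_trans (fb_mul hf _ _) _; rewrite ler_wpM2r //.
  rewrite -!mulrA ler_wpM2l //; apply: le_trans (c3_lip _ _ (fb_G hf)) _.
  by rewrite ler_wpM2l.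
- by exists C => s t s0 st tT; have [] := hC _ _ s0 st tT.
Qed.

Lemma davie_controlled_field c T Y : DGG_bounded_derivative G ->
  field_bounds G0 G c -> 0 < al <= 1 / 2 -> 0 <= T ->
  rough_path al W WW -> davie T Y ->
  controlled 0 T al W (fun s => G (Y s))
    (fun s => 'd G (Y s) \o (mulmx (G (Y s)) : {linear 'cV[R]_M -> 'cV[R]_D})).
Proof.
move=> hDGG hf hal T0 hW hY; have [C C0 hC] := davie_increment hf hal T0 hW hY.
have [K [r [K0 r0 Yr _]]] := hY; have /andP[al0 al1] := hal.
have [k k0 hk] := rough_path_data al0 al1 T0 hW.
have c0 := fb_ge0 hf; have [c' c'0 hc'] := dirfield_lip (fb_G hf) hDGG; split.
- exists (c * C) => s t s0 st tT; have [n1 _] := hC _ _ s0 st tT.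
  apply: le_trans (c3_lip _ _ (fb_G hf)) _.
  by rewrite -mulrA ler_wpM2l.
- exists (c' * C) => s t v s0 st tT; have [n1 _] := hC _ _ s0 st tT.
  apply: le_trans (hc' v (Y t) (Y s)) _; rewrite ler_wpM2r //.
  by rewrite -mulrA ler_wpM2l.
exists (c * C + c * (1 + r) * k ^+ 2) => s t s0 st tT; have [_ n2] := hC _ _ s0 st tT.
have ts0 : 0 <= t - s by rewrite subr_ge0 ltW.
have hs : - T <= s <= T by apply/andP; split; lra.
have ht : - T <= t <= T by apply/andP; split; lra.
have hs' : 0 <= s <= T by apply/andP; split; lra.
have := hk _ _ hs ht; rewrite ger0_norm // => -[hw _ _].
have n3 := fb_taylor hf (Y s) (W t - W s).
have n4 := c3_lip (Y t) (Y s + G (Y s) *m (W t - W s)) (fb_G hf).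
rewrite opprD addrA in n4.
have n5 : c * `|Y t - Y s - G (Y s) *m (W t - W s)| <= c * (C * (t - s) `^ (2 * al)).
  by rewrite ler_wpM2l.
have n6 : c * (1 + `|Y s|) * `|W t - W s| ^+ 2
    <= c * (1 + r) * k ^+ 2 * (t - s) `^ (2 * al).
  rewrite -sqr_powR // -[leRHS]mulrA -exprMn; apply: ler_pM; rewrite ?exprn_ge0 //.
  - by rewrite mulr_ge0 ?addr_ge0.
  - by rewrite ler_wpM2l // lerD2l Yr.
  - by rewrite lerXn2r ?nnegrE // mulr_ge0 // powR_ge0.
apply: le_trans (sub_norm_via (G (Y s + G (Y s) *m (W t - W s))) _ _ _) _.
apply: le_trans (lerD (le_trans n4 n5) (le_trans n3 n6)) _.
by rewrite [leRHS]mulrDl mulrA.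
Qed.

Lemma cV_integral_nil (f : R -> 'cV[R]_D) : cV_integral 0 0 f = 0.
Proof.
by apply/matrixP => i j; rewrite !mxE set_itv1 Rintegral_set1.
Qed.

Lemma davie_integral c T t Y : DGG_bounded_derivative G -> field_bounds G0 G c ->
  1 / 3 < al <= 1 / 2 -> 0 <= T -> rough_path al W WW -> davie T Y -> 0 <= t <= T ->
  is_rough_integral W WW (fun s => G (Y s))
    (fun s => 'd G (Y s) \o (mulmx (G (Y s)) : {linear 'cV[R]_M -> 'cV[R]_D})) 0 t
    (Y t - Y 0 - cV_integral 0 t (fun s => G0 (Y s))).
Proof.
move=> hDGG hf /andP[al1 al2] T0 hW hY /andP[t0 tT]; have al0 : 0 < al by lra.
have hal : 0 < al <= 1 / 2 by rewrite al0.
have [C C0 hC] := davie_increment hf hal T0 hW hY.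
have hH : Defs.hoelder 0 T al Y.
  by exists C => s u s0 su uT; have [] := hC _ _ s0 su uT.
have [kY kY0 hkY] := hoelder_sym hH.
have [CJ CJ0 hJ] := drift_step (G0 := G0) hal T0 (fb_ge0 hf) kY0
  (fun x y => c3_lip x y (fb_G0 hf)) hkY.
have [K [r [K0 r0 Yr hK]]] := hY.
pose J s := cV_integral 0 s (fun s => G0 (Y s)).
have := @sewing_sum_cvg R _ (fun s => Y s - J s)
  (fun u v => G (Y u) *m (W v - W u)
    + tensor_apply ('d G (Y u) \o (mulmx (G (Y u)) : {linear 'cV[R]_M -> 'cV[R]_D}))
        (WW u v)) (K + CJ) (3 * al) t.
rewrite /J cV_integral_nil subr0 addrAC; apply.
- by lra.
- by rewrite addr_ge0.
move=> u v u0 uv vt; have vT := le_trans vt tT.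
have n1 := hK _ _ u0 uv vT; have n2 := hJ _ _ u0 uv vT.
rewrite -(areaE hW uv) mulrDl; apply: le_trans (lerD n1 n2).
rewrite /rde_mu /rde_step /step_inc /step_rest.
apply: le_trans (ler_normB _ _); apply: le_of_eq; congr (`| _ |); exact: integral_split.
Qed.

Lemma rde_solution_initial y0 Y : rde_solution al W WW G0 G y0 Y -> Y 0 = y0.
Proof.
case=> _ _ /(_ 0 (lexx 0))[I /rough_integral_nil -> ->].
by rewrite cV_integral_nil !addr0.
Qed.

(* The sewing lemma recovers the local expansion of a rough integral, so every
   solution is a Davie path. *)
Lemma rde_solution_unique c T t C y0 Y : field_bounds G0 G c ->
  1 / 3 < al <= 1 / 2 -> 0 < T -> rough_path al W WW ->
  sewable (- T) T al (3 * al) C (rde_mu G0 G W WW) ->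
  sewable_loc (- T) T al (3 * al) (rde_mu G0 G W WW) ->
  rde_solution al W WW G0 G y0 Y -> 0 <= t <= T ->
  Y t = flow (rde_mu G0 G W WW) 0 t y0.
Proof.
move=> hf hal T0 hW hmu hloc hY /andP[t0 tT].
have /andP[al1 al2] := hal; have al0 : 0 < al by lra.
have hal' : 0 < al <= 1 / 2 by rewrite al0.
rewrite -(rde_solution_initial hY); case: hY => hY1 hY2 hI.
have [hH _ _] := hY1 T T0; have hG := hY2 T T0.
have [kY kY0 hkY] := hoelder_sym hH.
have [CJ CJ0 hJ] := drift_step (G0 := G0) hal' (ltW T0) (fb_ge0 hf) kY0
  (fun x y => c3_lip x y (fb_G0 hf)) hkY.
have [|K [d [K0 d0 hK]]] := @rough_integral_step R D M al W WW _ _ T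
  (fun t => Y t - y0 - cV_integral 0 t (fun s => G0 (Y s))) hal (ltW T0) hW hG.
  move=> u /andP[u0 uT]; have [I hIu ->] := hI u u0.
  by rewrite [X in is_rough_integral _ _ _ _ _ _ X](_ : _ = I) //; zmod.
have Tin u : 0 <= u <= t -> - T <= u <= T by move=> /andP[? ?]; apply/andP; split; lra.
apply: (@flow_unique R _ (- T) T al (3 * al) C (rde_mu G0 G W WW) Y 0 t
  (`|Y 0| + kY * T `^ al) (K + CJ) d hmu hloc) => //.
- by apply: Tin; rewrite lexx.
- by apply: Tin; rewrite t0 lexx.
- by rewrite addr_ge0.
- move=> u hu; have /andP[u0 ut] : 0 <= u <= t.
    by case/orP: hu => [//|/andP[h1 h2]]; apply/andP; split; lra.
  have h0 : 0 <= (0 : R) <= T by rewrite lexx ltW.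
  have hu' : 0 <= u <= T by apply/andP; split; lra.
  have := hkY _ _ h0 hu'; rewrite subr0 ger0_norm // => n1.
  have n2 : kY * u `^ al <= kY * T `^ al.
    by rewrite ler_wpM2l //; apply: le_powR; [exact: ltW| |lra].
  have := ler_normD (Y u - Y 0) (Y 0); rewrite subrK.
  by move: n1 n2; clear; lra.
move=> u v huv; have [u0 uv vt] : [/\ 0 <= u, u <= v & v <= t].
  case/orP: huv => [/andP[h1 /andP[h2 h3]]//|/andP[h1 /andP[h2 h3]]].
  by split; lra.
have vT := le_trans vt tT.
move: uv; rewrite le_eqVlt => /orP[/eqP <- _|uv].
  by rewrite rde_mu_id subrr normr0 mulr_ge0 ?powR_ge0 ?addr_ge0.
rewrite ger0_norm ?subr_ge0 ?(ltW uv) // => vud.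
have n1 := hK _ _ u0 uv vT vud; have n2 := hJ _ _ u0 uv vT.
rewrite mulrDl; apply: le_trans (lerD n1 n2).
apply: le_trans (ler_normD _ _); apply: le_of_eq; congr (`| _ |).
rewrite /rde_mu /rde_step /step_inc /step_rest /germ.
exact: solution_split.
Qed.

Lemma flow_davie c T C y0 : field_bounds G0 G c -> 0 < T ->
  sewable (- T) T al (3 * al) C (rde_mu G0 G W WW) ->
  sewable_loc (- T) T al (3 * al) (rde_mu G0 G W WW) ->
  continuous (fun p : R * R * 'cV[R]_D => rde_mu G0 G W WW p.1.1 p.1.2 p.2) ->
  davie T (fun t => flow (rde_mu G0 G W WW) 0 t y0).
Proof.
move=> hf T0 hmu hloc cmu.
have [g g1 hg] := flow_growth hmu hloc; have g0 : 0 <= g := le_trans ler01 g1.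
have r0 : 0 <= g * (1 + `|y0|) by rewrite mulr_ge0 // addr_ge0.
have [K K0 hK] := flow_close_ball hmu hloc r0.
have in0 : - T <= 0 <= T by apply/andP; split; lra.
have Yr u : 0 <= u <= T -> `|flow (rde_mu G0 G W WW) 0 u y0| <= g * (1 + `|y0|).
  move=> /andP[u0 uT]; have hu : - T <= u <= T by apply/andP; split; lra.
  by have := hg _ _ y0 in0 hu; lra.
exists K, (g * (1 + `|y0|)); split=> // u v u0 uv vT.
have hu : - T <= u <= T by apply/andP; split; lra.
have hv : - T <= v <= T by apply/andP; split; lra.
have hu' : 0 <= u <= T by apply/andP; split; lra.
have E : flow (rde_mu G0 G W WW) 0 v y0
    = flow (rde_mu G0 G W WW) u v (flow (rde_mu G0 G W WW) 0 u y0).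
  by apply: (flow_add _ hmu hloc cmu) => //; rewrite u0 ltW.
have vu0 : 0 <= v - u by rewrite subr_ge0 ltW.
by have := hK _ _ _ hu hv (Yr _ hu'); rewrite -E (ger0_norm vu0).
Qed.

Lemma davie_solution c Y : DGG_bounded_derivative G -> field_bounds G0 G c ->
  1 / 3 < al <= 1 / 2 -> rough_path al W WW -> (forall T, 0 < T -> davie T Y) ->
  rde_solution al W WW G0 G (Y 0) Y.
Proof.
move=> hDGG hf hal hW hY; have /andP[al1 al2] := hal.
have hal' : 0 < al <= 1 / 2 by apply/andP; split; lra.
split=> [T T0|T T0|t t0].
- exact: (davie_controlled hf hal' (ltW T0) hW (hY _ T0)).
- exact: (davie_controlled_field hDGG hf hal' (ltW T0) hW (hY _ T0)).
have T0 : 0 < t + 1 by lra.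
have ht : 0 <= t <= t + 1 by apply/andP; split; lra.
eexists; first exact: (davie_integral hDGG hf hal (ltW T0) hW (hY _ T0) ht).
by zmod.
Qed.

End RdeSolutions.

(** * Measurability *)

Lemma measurable_countable_pieces {d1 d2 : measure_display} {T1 : measurableType d1}
    {T2 : measurableType d2} {I : countType} (idx : T1 -> I) (g : I -> T1 -> T2) :
  (forall i, measurable (idx @^-1` [set i])) ->
  (forall i, measurable_fun setT (g i)) ->
  measurable_fun setT (fun x => g (idx x) x).
Proof.
move=> midx mg _ B mB; rewrite setTI.
have -> : (fun x => g (idx x) x) @^-1` B
    = \bigcup_i (idx @^-1` [set i] `&` (g i @^-1` B)).
  apply/seteqP; split=> [x /= hx|x [i _ [/= <-]] //].
  by exists (idx x).
apply: countable_bigcupT_measurable => [|i]; first exact: countableP.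
by apply: measurableI; [exact: midx | rewrite -[X in measurable X]setTI; exact: mg].
Qed.

Section Rounding.
Context {R : realType}.
Implicit Types (r : R) (n : nat).

Definition cell n r : int := Num.floor (r * n.+1%:R).
Definition cell_pt n (z : int) : R := z%:~R / n.+1%:R.

Lemma cell_pt_close n r r' : cell n r = cell n r' -> `|r - r'| <= n.+1%:R^-1.
Proof.
rewrite /cell => h; have /andP[a1 a2] := floor_itv (r * n.+1%:R).
have /andP[] := floor_itv (r' * n.+1%:R); rewrite -h => b1 b2.
have n0 : 0 < n.+1%:R :> R by rewrite ltr0n.
rewrite -[_^-1]mul1r ler_pdivlMr //.
have -> : `|r - r'| * n.+1%:R = `|r * n.+1%:R - r' * n.+1%:R|.
  by rewrite -mulrBl normrM (ger0_norm (ltW n0)).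
rewrite ler_norml; move: a1 a2 b1 b2; rewrite rmorphD /=.
by move: (r * _) (r' * _) (_%:~R) => x y z; clear; move=> *; apply/andP; split; lra.
Qed.

Lemma cell_ptK n z : cell n (cell_pt n z) = z.
Proof.
by rewrite /cell /cell_pt divfK ?pnatr_eq0 // intrKfloor.
Qed.

Lemma measurable_cell {d : measure_display} {T : measurableType d} (f : T -> R) n z :
  measurable_fun setT f -> measurable [set x | cell n (f x) = z].
Proof.
move=> mf.
have mg : measurable_fun setT (fun x => f x * n.+1%:R).
  by apply: measurable_funM => //; exact: measurable_cst.
have := mg measurableT _ (measurable_itv `[z%:~R, (z + 1)%:~R[); rewrite setTI.
congr (measurable _); apply/seteqP; split=> x /=; rewrite in_itv /=.
  by move=> h; apply/eqP; rewrite floor_eq.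
by move=> <-; exact: floor_itv.
Qed.

End Rounding.

Section MeasurableMatrices.
Context {R : realType} {d : measure_display} {T : measurableType d}.

Lemma measurable_mx_cell {m n : nat} (f : T -> 'M[R]_(m, n)) k (z : 'M[int]_(m, n)) :
  (forall i j, measurable_fun setT (fun x => f x i j)) ->
  measurable [set x | map_mx (cell k) (f x) = z].
Proof.
move=> mf.
have -> : [set x | map_mx (cell k) (f x) = z]
    = \bigcap_(i in [set: 'I_m * 'I_n]) [set x | cell k (f x i.1 i.2) = z i.1 i.2].
  apply/seteqP; split=> x /= h.
    by move=> i _ /=; rewrite -h mxE.
  by apply/matrixP => i j; rewrite mxE; exact: (h (i, j)).
by apply: fin_bigcap_measurable => [|i _]; [exact: finite_finset|exact: measurable_cell].
Qed.

Lemma measurable_mx {m n : nat} (f : T -> 'M[R]_(m, n)) :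
  (forall i j, measurable_fun setT (fun x => f x i j)) ->
  measurable_fun setT (f : T -> borel_mx R m n).
Proof.
move=> mf; apply: (@measurability _ _ T (borel_mx R m n) setT f (@open 'M[R]_(m, n)) erefl).
move=> _ [U oU <-]; rewrite setTI.
pose good (p : nat * 'M[int]_(m, n)) : bool :=
  `[< forall y, map_mx (cell p.1) y = p.2 -> U y >].
have -> : f @^-1` U = \bigcup_(p in [set: nat * 'M[int]_(m, n)])
    (if good p then [set x | map_mx (cell p.1) (f x) = p.2] else set0).
  apply/seteqP; split=> x /=; last first.
    by move=> [p _]; case: ifPn => // /asboolP h /= /h.
  move=> Ux; have /nbhs_ballP[e /= e0 he] := open_nbhs_nbhs (conj oU Ux).
  have [k _ /(_ k (leqnn k)) /= hk] := near_infty_natSinv_lt (PosNum e0).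
  exists (k, map_mx (cell k) (f x)) => //.
  case: ifPn => // /asboolPn[] y /= hy; apply: he.
  rewrite -ball_normE /=; apply: le_lt_trans hk.
  apply: mx_norm_le => [|i j]; first by rewrite invr_ge0.
  rewrite !mxE; apply: cell_pt_close.
  by move/matrixP/(_ i j): hy; rewrite !mxE.
apply: countable_bigcupT_measurable => [|p]; first exact: countableP.
by case: ifP => _; [exact: measurable_mx_cell|exact: measurable0].
Qed.

Lemma continuous_measurable_mx {m n p q : nat} (F : 'M[R]_(m, n) -> 'M[R]_(p, q)) :
  continuous F -> measurable_fun setT (F : borel_mx R m n -> borel_mx R p q).
Proof.
move=> /continuousP cF; apply: (@measurability _ _ (borel_mx R m n) (borel_mx R p q) setT F
  (@open 'M[R]_(p, q)) erefl).
by move=> _ [U oU <-]; rewrite setTI; apply: sub_sigma_algebra; exact: cF.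
Qed.

Lemma measurable_entry {m n : nat} (f : T -> 'M[R]_(m, n)) i j :
  measurable_fun setT (f : T -> borel_mx R m n) ->
  measurable_fun setT (fun x => f x i j).
Proof.
move=> mf; apply: (measurability _ (RGenOpens.measurableE R)) => //.
move=> _ [U [a [b ->]] <-]; rewrite setTI.
have oU : open ((fun A : 'M[R]_(m, n) => A i j) @^-1` `]a, b[%classic).
  have /continuousP c := @coord_continuous R m n i j.
  by apply: c; exact: itv_open.
have mU : measurable ((fun A : borel_mx R m n => (A : 'M[R]_(m, n)) i j) @^-1` `]a, b[%classic).
  exact: sub_sigma_algebra.
by have := mf measurableT _ mU; rewrite setTI.
Qed.

Lemma measurable_mx_cvg {m n : nat} (h : nat -> T -> 'M[R]_(m, n)) (f : T -> 'M[R]_(m, n)) :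
  (forall k, measurable_fun setT (h k : T -> borel_mx R m n)) ->
  (forall x, h k x @[k --> \oo] --> f x) ->
  measurable_fun setT (f : T -> borel_mx R m n).
Proof.
move=> mh hf; apply: measurable_mx => i j.
apply: (@measurable_fun_cvg _ _ _ _ (fun k x => h k x i j)) => [k|x _].
  exact: measurable_entry.
exact: (cvg_comp _ _ (hf x) (@coord_continuous R m n i j (f x))).
Qed.

Lemma measurable_mxD {m n : nat} (f g : T -> 'M[R]_(m, n)) :
  measurable_fun setT (f : T -> borel_mx R m n) ->
  measurable_fun setT (g : T -> borel_mx R m n) ->
  measurable_fun setT ((fun x => f x + g x) : T -> borel_mx R m n).
Proof.
move=> mf mg; apply: measurable_mx => i j.
rewrite (_ : (fun x => _) = (fun x => f x i j) \+ (fun x => g x i j)); last first.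
  by apply/funext => x; rewrite mxE.
by apply: measurable_funD; exact: measurable_entry.
Qed.

Lemma measurable_mxN {m n : nat} (f : T -> 'M[R]_(m, n)) :
  measurable_fun setT (f : T -> borel_mx R m n) ->
  measurable_fun setT ((fun x => - f x) : T -> borel_mx R m n).
Proof.
move=> mf; apply: measurable_mx => i j.
rewrite (_ : (fun x => _) = \- (fun x => f x i j)); last first.
  by apply/funext => x; rewrite mxE.
by apply: measurable_funN; exact: measurable_entry.
Qed.

Lemma measurable_mxZ {m n : nat} (a : T -> R) (f : T -> 'M[R]_(m, n)) :
  measurable_fun setT a -> measurable_fun setT (f : T -> borel_mx R m n) ->
  measurable_fun setT ((fun x => a x *: f x) : T -> borel_mx R m n).
Proof.
move=> ma mf; apply: measurable_mx => i j.
rewrite (_ : (fun x => _) = a \* (fun x => f x i j)); last first.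
  by apply/funext => x; rewrite mxE.
by apply: measurable_funM => //; exact: measurable_entry.
Qed.

Lemma measurable_mxM {m n p : nat} (f : T -> 'M[R]_(m, n)) (g : T -> 'M[R]_(n, p)) :
  measurable_fun setT (f : T -> borel_mx R m n) ->
  measurable_fun setT (g : T -> borel_mx R n p) ->
  measurable_fun setT ((fun x => f x *m g x) : T -> borel_mx R m p).
Proof.
move=> mf mg; apply: measurable_mx => i j.
rewrite (_ : (fun x => _) = fun x => \sum_k f x i k * g x k j); last first.
  by apply/funext => x; rewrite mxE.
by apply: measurable_sum => k; apply: measurable_funM; exact: measurable_entry.
Qed.

Lemma measurable_mx_sum {I : finType} {m n : nat} (f : I -> T -> 'M[R]_(m, n)) :
  (forall k, measurable_fun setT (f k : T -> borel_mx R m n)) ->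
  measurable_fun setT ((fun x => \sum_k f k x) : T -> borel_mx R m n).
Proof.
move=> mf; apply: measurable_mx => i j.
rewrite (_ : (fun x => _) = fun x => \sum_k f k x i j); last first.
  by apply/funext => x; rewrite summxE.
by apply: measurable_sum => k; exact: measurable_entry.
Qed.

Lemma measurable_mx_tr {m n : nat} (f : T -> 'M[R]_(m, n)) :
  measurable_fun setT (f : T -> borel_mx R m n) ->
  measurable_fun setT ((fun x => (f x)^T) : T -> borel_mx R n m).
Proof.
move=> mf; apply: measurable_mx => i j.
rewrite (_ : (fun x => _) = fun x => f x j i); last by apply/funext => x; rewrite mxE.
exact: measurable_entry.
Qed.

End MeasurableMatrices.

(* Carathéodory functions are jointly measurable: round [(t, x)] to a grid. *)
Lemma caratheodory_measurable {R : realType} {d : measure_display} {T : measurableType d}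
    {m n : nat} (f : R -> T -> 'cV[R]_m -> 'cV[R]_n) :
  (forall t x, measurable_fun setT ((fun w => f t w x) : T -> borel_mx R n 1)) ->
  (forall w, continuous (fun p : R * 'cV[R]_m => f p.1 w p.2)) ->
  measurable_fun [set: measurableTypeR R * T * borel_mx R m 1]
    ((fun p => f p.1.1 p.1.2 p.2) : _ -> borel_mx R n 1).
Proof.
move=> mf cf.
pose cl k (p : measurableTypeR R * T * borel_mx R m 1) : int * 'cV[int]_m :=
  (cell k p.1.1, map_mx (cell k) (p.2 : 'cV[R]_m)).
pose g k (z : int * 'cV[int]_m) (p : measurableTypeR R * T * borel_mx R m 1) : 'cV[R]_n :=
  f (cell_pt k z.1) p.1.2 (map_mx (cell_pt k) z.2).
have mt : measurable_fun [set: measurableTypeR R * T * borel_mx R m 1]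
    (fun p => p.1.1 : R).
  exact: (measurableT_comp measurable_fst measurable_fst).
have mw : measurable_fun [set: measurableTypeR R * T * borel_mx R m 1] (fun p => p.1.2).
  exact: (measurableT_comp measurable_snd measurable_fst).
have mx i j : measurable_fun [set: measurableTypeR R * T * borel_mx R m 1]
    (fun p => (p.2 : 'cV[R]_m) i j).
  by apply: measurable_entry; exact: measurable_snd.
apply: (@measurable_mx_cvg _ _ _ _ _ (fun k p => g k (cl k p) p)) => [k|[[t w] x]].
  apply: measurable_countable_pieces => [[z1 z2]|z].
    rewrite (_ : _ @^-1` _ = [set p | cell k p.1.1 = z1]
      `&` [set p | map_mx (cell k) (p.2 : 'cV[R]_m) = z2]).
      by apply: measurableI; [exact: measurable_cell|exact: measurable_mx_cell].
    by apply/seteqP; split=> p; rewrite /cl /= => -[-> ->].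
  by apply: (measurableT_comp (mf _ _)); exact: mw.
have key (e : R) : 0 < e -> \forall k \near \oo, k.+1%:R^-1 < e.
  by move=> e0; exact: (near_infty_natSinv_lt (PosNum e0)).
have c1 : cell_pt k (cell k (t : R)) @[k --> \oo] --> (t : R).
  apply/cvgrPdist_le => e e0; near=> k.
  apply: (@le_trans _ _ k.+1%:R^-1); last by apply: ltW; near: k; exact: key.
  by apply: cell_pt_close; rewrite cell_ptK.
have c2 : map_mx (cell_pt k) (map_mx (cell k) (x : 'cV[R]_m)) @[k --> \oo]
    --> (x : 'cV[R]_m).
  apply/cvgrPdist_le => e e0; near=> k.
  apply: (@le_trans _ _ k.+1%:R^-1); last by apply: ltW; near: k; exact: key.
  apply: mx_norm_le => [|i j]; first by rewrite invr_ge0.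
  by rewrite !mxE; apply: cell_pt_close; rewrite cell_ptK.
exact: (cvg_comp _ _ (cvg_pair c1 c2) (cf w (t : R, x : 'cV[R]_m))).
Unshelve. all: by end_near. Qed.

(** * The cocycle *)

Lemma flow_cvg {R : realType} {V : completeNormedModType R} (a b al ga C : R)
    (mu : R -> R -> V -> V) s t x :
  sewable a b al ga C mu -> sewable_loc a b al ga mu ->
  a <= s <= b -> a <= t <= b ->
  scheme mu s ((t - s) / N.+1%:R) N.+1 x @[N --> \oo] --> flow mu s t x.
Proof.
move=> hmu hloc hs ht; have [N0 [E [E0 HE]]] := flow_rate hmu hloc (normr_ge0 x).
have [_ ga1 _ _ _ _] := hmu.
apply/cvgrPdist_le => e e0; near=> N.
apply: le_trans (HE _ _ _ N hs ht (lexx _) _) _; first by near: N; exact: nbhs_infty_ge.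
near: N; have [N1 hN1] := grid_rate_small ga1 E0 e0.
by exists N1 => // N /= hN; exact: hN1.
Unshelve. all: by end_near. Qed.

Lemma scheme_shift {R : realType} {V : normedModType R}
    (mu1 mu2 : R -> R -> V -> V) (c s h : R) k x :
  (forall u v y, mu1 u v y = mu2 (u + c) (v + c) y) ->
  scheme mu1 s h k x = scheme mu2 (s + c) h k x.
Proof.
move=> hmu; elim: k => [|k ih] //=.
by rewrite ih hmu addrAC [s + k.+1%:R * h + c]addrAC.
Qed.

Lemma flow_shift {R : realType} {V : completeNormedModType R}
    (mu1 mu2 : R -> R -> V -> V) (c s t : R) x :
  (forall u v y, mu1 u v y = mu2 (u + c) (v + c) y) ->
  flow mu1 s t x = flow mu2 (s + c) (t + c) x.
Proof.
move=> hmu; have E : t + c - (s + c) = t - s by rewrite opprD addrACA subrr addr0.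
rewrite /flow E; congr (lim (_ @ \oo)).
by apply/funext => N; exact: scheme_shift.
Qed.

Lemma rde_mu_shift {R : realType} {D M : nat} (G0 : 'cV[R]_D -> 'cV[R]_D)
    (G : 'cV[R]_D -> 'M[R]_(D, M)) (al c : R) (W1 W2 : R -> 'cV[R]_M)
    (WW1 WW2 : R -> R -> 'M[R]_M) u v y :
  rough_path al W1 WW1 -> rough_path al W2 WW2 ->
  (forall s t, s < t -> W1 t - W1 s = W2 (t + c) - W2 (s + c) /\
     WW1 s t = WW2 (s + c) (t + c)) ->
  rde_mu G0 G W1 WW1 u v y = rde_mu G0 G W2 WW2 (u + c) (v + c) y.
Proof.
move=> h1 h2 hs.
have key s t : s < t -> W1 t - W1 s = W2 (t + c) - W2 (s + c) /\
    area W1 WW1 s t = area W2 WW2 (s + c) (t + c).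
  move=> st; have [e1 e2] := hs _ _ st; split=> //.
  by rewrite (areaE h1 st) (areaE h2) ?ltrD2r.
have E : v + c - (u + c) = v - u by rewrite opprD addrACA subrr addr0.
rewrite /rde_mu E; have [uv|vu|->] := ltgtP u v; last by rewrite !subrr !area_id.
  by have [-> ->] := key _ _ uv.
have [e1 e2] := key _ _ vu.
rewrite (area_rev W1 WW1 v u) (area_rev W2 WW2 (v + c) (u + c)) e1 e2.
by rewrite -[W1 v - W1 u]opprB e1 opprB.
Qed.

Section RdeCocycle.
Context {R : realType} {D M : nat}.
Variables (G0 : 'cV[R]_D -> 'cV[R]_D) (G : 'cV[R]_D -> 'M[R]_(D, M)) (al : R).
Implicit Types (W : R -> 'cV[R]_M) (WW : R -> R -> 'M[R]_M).

Definition rde_flow W WW := flow (rde_mu G0 G W WW).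

Lemma rde_flow_id W WW s x : 1 / 3 < al <= 1 / 2 -> rough_path al W WW ->
  C_b 3 G0 -> C_b 3 G -> DGG_bounded_derivative G -> rde_flow W WW s s x = x.
Proof.
move=> hal hW hG0 hG hDGG.
have [C [hmu hloc _]] := rde_sewable hal (normr_ge0 s) hW hG0 hG hDGG.
by apply: (flow_id _ hmu hloc); rewrite -ler_norml.
Qed.

Lemma rde_flow_comp W WW s u t x : 1 / 3 < al <= 1 / 2 -> rough_path al W WW ->
  C_b 3 G0 -> C_b 3 G -> DGG_bounded_derivative G ->
  rde_flow W WW u t (rde_flow W WW s u x) = rde_flow W WW s t x.
Proof.
move=> hal hW hG0 hG hDGG.
have T0 : 0 <= `|s| + `|u| + `|t| by rewrite !addr_ge0.
have [C [hmu hloc hback]] := rde_sewable hal T0 hW hG0 hG hDGG.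
by apply: (flow_comp _ hmu hloc (rde_mu_continuous hal hW hG0 hG hDGG) hback);
  rewrite -ler_norml // ?lerDr // -?addrA ?lerDl ?addr_ge0 // addrCA lerDl addr_ge0.
Qed.

Lemma rde_flow_continuous W WW : 1 / 3 < al <= 1 / 2 -> rough_path al W WW ->
  C_b 3 G0 -> C_b 3 G -> DGG_bounded_derivative G ->
  continuous (fun p : R * 'cV[R]_D => rde_flow W WW 0 p.1 p.2).
Proof.
move=> hal hW hG0 hG hDGG [t x]; apply/cvgrPdist_le => e e0 /=.
have T0 : 0 <= `|t| + 1 by rewrite addr_ge0.
have [C [hmu hloc _]] := rde_sewable hal T0 hW hG0 hG hDGG.
have cmu := rde_mu_continuous hal hW hG0 hG hDGG.
have r0 : 0 <= `|x| + 1 by rewrite addr_ge0.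
have [L L1 HL] := flow_lipschitz hmu hloc r0.
have h0 : - (`|t| + 1) <= 0 <= `|t| + 1 by rewrite oppr_le0 T0.
have ht : - (`|t| + 1) <= t <= `|t| + 1 by rewrite -ler_norml lerDl.
have e20 : 0 < e / 2 by rewrite divr_gt0.
have [d1 d10 H1] := flow_continuous_end x hmu hloc cmu h0 ht e20.
have L0 : 0 < L := lt_le_trans ltr01 L1.
have eL0 : 0 < e / 2 / L by rewrite divr_gt0.
have c1 : p.1 @[p --> (t, x)] --> t by exact: cvg_fst.
have c2 : p.2 @[p --> (t, x)] --> x by exact: cvg_snd.
near=> p.
have p1d : `|t - p.1| <= d1.
  by near: p; move/cvgrPdist_le: c1; apply.
have p1l : `|t - p.1| <= 1.
  by near: p; move/cvgrPdist_le: c1; apply.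
have p2d : `|x - p.2| <= e / 2 / L.
  by near: p; move/cvgrPdist_le: c2; apply.
have p2l : `|x - p.2| <= 1.
  by near: p; move/cvgrPdist_le: c2; apply.
have hp : - (`|t| + 1) <= p.1 <= `|t| + 1.
  rewrite -ler_norml; have := ler_normB t (t - p.1); rewrite opprB addrC subrK => h.
  by apply: le_trans h _; rewrite lerD2l.
have xr : `|x| <= `|x| + 1 by rewrite lerDl.
have pr : `|p.2| <= `|x| + 1.
  have := ler_normB x (x - p.2); rewrite opprB addrC subrK => h.
  by apply: le_trans h _; rewrite lerD2l.
have n1 : `|rde_flow W WW 0 t x - rde_flow W WW 0 p.1 x| <= e / 2.
  by apply: H1 => //; rewrite distrC.
have n2 : `|rde_flow W WW 0 p.1 x - rde_flow W WW 0 p.1 p.2| <= e / 2.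
  apply: le_trans (HL _ _ _ _ h0 hp xr pr) _; apply: le_trans (ler_wpM2l (ltW L0) p2d) _.
  by rewrite mulrC divfK ?gt_eqF.
rewrite -(subrK (rde_flow W WW 0 p.1 x) (rde_flow W WW 0 t x)) -addrA.
apply: le_trans (ler_normD _ _) _; apply: le_trans (lerD n1 n2) _.
by rewrite -splitr.
Unshelve. all: by end_near. Qed.

Lemma rde_flow_measurable {d : measure_display} {T : measurableType d}
    (W : T -> R -> 'cV[R]_M) (WW : T -> R -> R -> 'M[R]_M) t x :
  1 / 3 < al <= 1 / 2 -> (forall w, rough_path al (W w) (WW w)) ->
  C_b 3 G0 -> C_b 3 G -> DGG_bounded_derivative G ->
  (forall s t, s < t ->
     measurable_fun setT ((fun w => W w t - W w s) : T -> borel_mx R M 1) /\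
     measurable_fun setT ((fun w => WW w s t) : T -> borel_mx R M M)) ->
  measurable_fun setT ((fun w => rde_flow (W w) (WW w) 0 t x) : T -> borel_mx R D 1).
Proof.
move=> hal hW hG0 hG hDGG mW; have [c hf] := field_bounds_exist hG0 hG hDGG.
have cst m n (A : 'M[R]_(m, n)) : measurable_fun setT ((fun=> A) : T -> borel_mx R m n).
  exact: measurable_cst.
have mInc s u : measurable_fun setT ((fun w => W w u - W w s) : T -> borel_mx R M 1).
  have [su|us|->] := ltgtP s u; first by have [] := mW _ _ su.
    rewrite (_ : (fun w => _) = fun w => - (W w s - W w u)); last first.
      by apply/funext => w; rewrite opprB.
    by apply: measurable_mxN; have [] := mW _ _ us.
  by rewrite (_ : (fun w => _) = fun=> 0) //; apply/funext => w; rewrite subrr.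
have mArea s u : measurable_fun setT ((fun w => area (W w) (WW w) s u) : T -> borel_mx R M M).
  have [su|us|->] := ltgtP s u.
  - rewrite (_ : (fun w => _) = fun w => WW w s u); last first.
      by apply/funext => w; rewrite (areaE (hW w)).
    by have [] := mW _ _ su.
  - rewrite (_ : (fun w => _) = fun w =>
        tensor (W w s - W w u) (W w s - W w u) - WW w u s); last first.
      by apply/funext => w; rewrite area_rev (areaE (hW w)).
    apply: measurable_mxD; last by apply: measurable_mxN; have [] := mW _ _ us.
    by apply: measurable_mxM => //; exact: measurable_mx_tr.
  - by rewrite (_ : (fun w => _) = fun=> 0) //; apply/funext => w; rewrite area_id.
have mcomp m n (F : 'cV[R]_D -> 'M[R]_(m, n)) (y : T -> 'cV[R]_D) : continuous F ->
    measurable_fun setT (y : T -> borel_mx R D 1) ->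
    measurable_fun setT ((fun w => F (y w)) : T -> borel_mx R m n).
  by move=> cF my; exact: (measurableT_comp (continuous_measurable_mx cF) my).
have cG : continuous G.
  by move=> z; apply: differentiable_continuous; exact: c3_diff (fb_G hf) z.
have cG0 : continuous G0.
  by move=> z; apply: differentiable_continuous; exact: c3_diff (fb_G0 hf) z.
have cF i : continuous (dirfield G i) by apply: continuous_dirfield; exact: fb_G hf.
have mS h k : measurable_fun setT
    ((fun w => scheme (rde_mu G0 G (W w) (WW w)) 0 h k x) : T -> borel_mx R D 1).
  elim: k => [|k ih] /=; first exact: cst.
  rewrite /rde_mu /rde_step /step_inc /step_rest.
  apply: measurable_mxD => //; apply: measurable_mxD.
    by apply: measurable_mxM => //; exact: mcomp.
  apply: measurable_mxD.
    by apply: measurable_mxZ; [exact: measurable_cst|exact: mcomp].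
  rewrite /mil /tens; apply: measurable_mx_sum => i; apply: measurable_mx_sum => j.
  apply: measurable_mxZ; first exact: measurable_entry.
  by apply: measurable_mxM => //; exact: mcomp.
apply: (measurable_mx_cvg (fun N => mS ((t - 0) / N.+1%:R) N.+1)) => w.
have [C [hmu hloc _]] := rde_sewable hal (normr_ge0 t) (hW w) hG0 hG hDGG.
have h0 : - `|t| <= 0 <= `|t| by rewrite oppr_le0 normr_ge0.
have ht : - `|t| <= t <= `|t| by rewrite -ler_norml.
exact: (flow_cvg hmu hloc h0 ht).
Qed.

End RdeCocycle.

Theorem lemma4p9 (R : realType) (alpha : R)
    (halpha : 1 / 3 < alpha <= 1 / 2)
    (d : measure_display) (Omega : measurableType d) (P : probability Omega R)
    (theta : R -> Omega -> Omega) (htheta : metric_dynamical_system P theta)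
    (M D : nat)
    (W : Omega -> R -> 'cV[R]_M) (WW : Omega -> R -> R -> 'M[R]_M)
    (hW : rough_path_cocycle alpha theta W WW)
    (G0 : 'cV[R]_D -> 'cV[R]_D) (G : 'cV[R]_D -> 'M[R]_(D, M))
    (hG0 : C_infty G0) (hG0b : C_b 3 G0)
    (hG : C_infty G) (hGb : C_b 3 G)
    (hG0_lipschitz : lipschitz G0) (hG0_growth : linear_growth G0)
    (hDGG : DGG_bounded_derivative G) :
  exists phi : R -> Omega -> 'cV[R]_D -> 'cV[R]_D,
    extended_solution_flow alpha theta W WW G0 G phi /\ cocycle theta phi.
Proof.
have [hrp mW hst] := hW.
pose phi t omega x := rde_flow G0 G (W omega) (WW omega) 0 t x.
have shift s t u omega x : rde_flow G0 G (W (theta u omega)) (WW (theta u omega)) s t x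
    = rde_flow G0 G (W omega) (WW omega) (s + u) (t + u) x.
  apply: flow_shift => u' v' y; apply: rde_mu_shift (hrp _) (hrp _) _ => s' t' st'.
  by have [-> ->] := hst omega u s' t' st'.
have id omega s x : rde_flow G0 G (W omega) (WW omega) s s x = x.
  exact: (rde_flow_id s x halpha (hrp omega) hG0b hGb hDGG).
have comp omega s u t x : rde_flow G0 G (W omega) (WW omega) u t
    (rde_flow G0 G (W omega) (WW omega) s u x)
    = rde_flow G0 G (W omega) (WW omega) s t x.
  exact: (rde_flow_comp s u t x halpha (hrp omega) hG0b hGb hDGG).
have [c hf] := field_bounds_exist hG0b hGb hDGG.
exists phi; split; split.
- move=> omega y0; rewrite -{1}(id omega 0 y0).
  apply: (davie_solution hDGG hf halpha (hrp omega)) => T T0.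
  have [C [hmu hloc _]] := rde_sewable halpha (ltW T0) (hrp omega) hG0b hGb hDGG.
  apply: (flow_davie y0 hf T0 hmu hloc).
  exact: rde_mu_continuous halpha (hrp omega) hG0b hGb hDGG.
- move=> omega y0 Y hY t t0; have T0 : 0 < t + 1 by rewrite ltr_wpDl.
  have [C [hmu hloc _]] := rde_sewable halpha (ltW T0) (hrp omega) hG0b hGb hDGG.
  apply: (rde_solution_unique hf halpha T0 (hrp omega) hmu hloc hY).
  by rewrite t0 lerDl ler01.
- by move=> omega t _; split=> x; rewrite /phi shift add0r addNr comp id.
- apply: caratheodory_measurable => [t x|omega].
    exact: rde_flow_measurable halpha hrp hG0b hGb hDGG mW.
  exact: rde_flow_continuous halpha (hrp omega) hG0b hGb hDGG.
- by move=> omega x; exact: id.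
- by move=> t s omega x; rewrite /phi shift add0r comp.
- by move=> omega; exact: rde_flow_continuous halpha (hrp omega) hG0b hGb hDGG.
Qed.
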